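(* Fix a finite alphabet $\Sigma$ and a monoid morphism $h:\Sigma^*\to M$ into a finite monoid. Consider the class of languages $L\subseteq\Sigma^+$ such that $L$ is $h$-substitutable, $(L,h)$ is unit-separated and satisfies PTLD, the set $\mathcal P$ of relative primes is finite, and $(L,h)$ is lexically anchored, i.e. $P\cap\Sigma\ne\varnothing$ for every $P\in\mathcal P$. On this class the learner Relative-ASGOLD (defined in the context) has polynomial update time and polynomial characteristic data in the size of the explicit canonical direct relative-prime grammar: there are polynomials $p_1,p_2$ depending only on $\Sigma$ and $h$ such that the output on every finite sample $D$ is computed in time at most $p_1(\|D\|)$, and every $L$ in the class has a finite set $\mathcal{CS}\subseteq L$ with $\|\mathcal{CS}\|\le p_2(|G^\star_{L,h}|)$ such that on every finite $D$ with $\mathcal{CS}\subseteq D\subseteq L$ the learner outputs $G^\star_{L,h}$. Here $\|D\|=\sum_{w\in D}|w|$ and $|G^\star_{L,h}|$ is the encoding size of the explicitly listed grammar $G^\star_{L,h}$.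
   Context: Basic notions. $D_L(x)=\{(u,v):uxv\in L\}$; $x\equiv_L y$ iff $D_L(x)=D_L(y)$. $L$ is $h$-substitutable if $h(x)=h(y)$ and $D_L(x)\cap D_L(y)\ne\varnothing$ imply $x\equiv_L y$. The relative syntactic congruence $\theta$: $x\,\theta\,y$ iff $x\equiv_L y$ and $h(x)=h(y)$; its classes $[x]$ are relative classes; $h(P)$ is the common $h$-value of a class $P$. A class is live if $D_L(x)\ne\varnothing$ for its members; the unit class is $[\varepsilon]$; $(L,h)$ is unit-separated if $[\varepsilon]=\{\varepsilon\}$. $X\cdot Y=\{xy:x\in X,y\in Y\}$; $X*Y=[xy]$ for $x\in X,y\in Y$. A relative prime is a live class $P\ne[\varepsilon]$ such that $P=X\cdot Y$ (as sets) with relative classes $X,Y$ forces one of them to be $[\varepsilon]$. For a prime sequence $\alpha=P_1\cdots P_k$: $\overline\alpha=P_1\cdot\ldots\cdot P_k$, $[\overline\alpha]=P_1*\cdots*P_k$. $P\to\alpha$ ($P\in\mathcal P$, $|\alpha|\ge2$) is correct if $[\overline\alpha]=P$, and valid if moreover no proper contiguous block $\beta$ of $\alpha$ with $|\beta|\ge2$ has $[\overline\beta]\in\mathcal P$. PTLD: with $\mathsf T=h(\{x:D_L(x)\neq\varnothing\})$, for all $m,r,r'\in\mathsf T$ and every relative prime $P$, $mr=h(P)=mr'$ implies $r=r'$. Under these hypotheses every live non-unit class has a unique exact factorization $X=\overline\alpha$ into relative primes, and there are at most $|\mathcal P|^2$ valid productions. Target. $G^\star_{L,h}$ has the relative primes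 as nonterminals (each $P$ named by its shortlex-least word) and a start symbol $S$; its rules are all valid productions, the lexical rules $P\to a$ for $a\in P\cap\Sigma$, and, for each relative class $X\subseteq L$, the rule $S\to\alpha$ where $\alpha$ is the unique exact prime factorization of $X$. Relative-ASGOLD on a finite sample $D\subseteq\Sigma^+$. Let $\mathrm{Sub}(D)$ be the set of nonempty substrings of words in $D$. (1) Build the CFG $W=W_h(D)$ with start symbol $S_D$, nonterminals $\langle u\rangle$ ($u\in\mathrm{Sub}(D)$), rules $S_D\to\langle w\rangle$ ($w\in D$), $\langle uv\rangle\to\langle u\rangle\langle v\rangle$ whenever $u,v,uv\in\mathrm{Sub}(D)$, $\langle a\rangle\to a$ for observed letters, and $\langle u\rangle\to\langle v\rangle$, $\langle v\rangle\to\langle u\rangle$ whenever $h(u)=h(v)$ and there are $\ell,r$ with $\ell ur,\ell vr\in D$. (2) For each $u\in\mathrm{Sub}(D)$ fix (by a fixed deterministic rule) a pair $(\ell_u,r_u)$ with $\ell_uur_u\in D$; partition $\mathrm{Sub}(D)$ into observed classes by equality of the signature consisting of $h(u)$ and the truth values of $\ell_xur_x\in L(W)$ for $x\in\mathrm{Sub}(D)$. (3) Represent each observed class $X$ by its shortlex-least member $w_X$. Define $\mathrm{ClassTest}(z,X)$ to hold iff $h(z)=h(w_X)$ and $\ell_{w_X}\,z\,r_{w_X}\in L(W)$. (4) Declare $X$ prime iff for every cut $w_X=uv$ with $u,v\ne\varepsilon$, with observed classes $Y\ni u$, $Z\ni v$, there is an observed word $x\in X$ having no cut $x=x_1x_2$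 with $\mathrm{ClassTest}(x_1,Y)$ and $\mathrm{ClassTest}(x_2,Z)$. (5) For an observed word $w$ form the directed graph on $0,\dots,|w|$ with an edge $i\to j$ ($i<j$) whenever the substring of $w$ from position $i$ to $j$ lies in a class declared prime; a minimum-edge path from $0$ to $|w|$ yields a sequence of declared primes; let $\alpha(Q)$ be the sequence so obtained from $w_Q$. (6) For all declared primes $N,A$ and observed classes $Q$, keep the rule $N\to A\,\alpha(Q)$ iff the concatenation of the representatives of the symbols of $A\,\alpha(Q)$ passes $\mathrm{ClassTest}(\cdot,N)$ and no proper contiguous block of length $\ge2$ has a concatenation of representatives passing $\mathrm{ClassTest}(\cdot,P)$ for a declared prime $P$. (7) Add lexical rules $P\to a$ for observed letters $a$ in declared primes $P$, and start rules $S\to\alpha(X)$ for the observed class $X$ of each $w\in D$. (8) Output the resulting grammar with each declared prime named by its shortlex-least representative. *)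

(* Defs.v *)
From mathcomp Require Import all_boot all_order all_algebra finmap.
From mathcomp Require Import boolp classical_sets cardinality.

Set Implicit Arguments.
Unset Strict Implicit.
Unset Printing Implicit Defensive.

Import Order.TTheory.

Local Open Scope nat_scope.
Local Open Scope classical_set_scope.

(** * Words and grammars *)

Notation word := seq (only parsing).

Section Words.
Context {disp : Order.disp_t} {Sigma : finOrderType disp}.

Definition shortlex_le (u v : word Sigma) : bool :=
  (size u < size v) ||
  (size u == size v) && (((u : seqlexi Sigma) <= (v : seqlexi Sigma))%O).

Definition shortlex_least (X : set (word Sigma)) (w : word Sigma) : Prop :=
  X w /\ forall v, X v -> shortlex_le w v.

(* The junk value [::] is only taken on the empty set. *)
Definition name (X : set (word Sigma)) : word Sigma := xget [::] [set w | shortlex_least X w].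

(* [None] is the start symbol ($S$ or $S_D$); [Some w] is the nonterminal named
   by the word [w] ($\langle w\rangle$, or the class whose name is [w]). *)
Definition nonterminal : Type := option (word Sigma).
Definition symbol : Type := (nonterminal + Sigma)%type.
Definition rule : Type := (nonterminal * seq symbol)%type.

Definition NT (w : word Sigma) : symbol := inl (Some w).
Definition T (a : Sigma) : symbol := inr a.

(* The start symbol of a grammar is always [None]. *)
Record grammar := Grammar { nonterminals : set nonterminal; rules : set rule }.

Inductive derives (R : set rule) : seq symbol -> seq symbol -> Prop :=
| derives_refl s : derives R s s
| derives_step s l n a r :
    derives R s (l ++ inl n :: r) -> R (n, a) -> derives R s (l ++ a ++ r).

Definition generated (G : grammar) : set (word Sigma) :=
  [set w | derives (rules G) [:: inl None] (map T w)].

(* An explicit, repetition-free listing of a finite grammar. *)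
Definition listing : Type := (seq nonterminal * seq rule)%type.

Definition lists (G : grammar) (g : listing) : Prop :=
  [/\ uniq g.1, uniq g.2,
      forall n, n \in g.1 <-> nonterminals G n &
      forall r, r \in g.2 <-> rules G r].

(* Encoding size: nonterminals are written as the words naming them, and each
   of them is written out at every occurrence. *)
Definition nonterminal_size (n : nonterminal) : nat :=
  if n is Some w then size w else 1.

Definition symbol_size (s : symbol) : nat :=
  if s is inl n then nonterminal_size n else 1.

Definition rule_size (r : rule) : nat :=
  nonterminal_size r.1 + \sum_(s <- r.2) symbol_size s.

Definition listing_size (g : listing) : nat :=
  \sum_(n <- g.1) nonterminal_size n + \sum_(r <- g.2) rule_size r.

Definition sample_size (D : {fset (word Sigma)}) : nat := \sum_(w <- D) size w.

Definition set_cat (X Y : set (word Sigma)) : set (word Sigma) := [set x ++ y | x in X & y in Y].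

Definition set_cats (alpha : seq (set (word Sigma))) : set (word Sigma) :=
  foldr set_cat [set [::]] alpha.

Definition block {A : Type} (beta alpha : seq A) : Prop :=
  exists l r, alpha = l ++ beta ++ r.

Definition proper_block {A : Type} (beta alpha : seq A) : Prop :=
  block beta alpha /\ size beta < size alpha.

End Words.

Arguments nonterminal {disp} Sigma.
Arguments symbol {disp} Sigma.
Arguments rule {disp} Sigma.
Arguments grammar {disp} Sigma.
Arguments listing {disp} Sigma.

(** * Relative syntactic classes and the target grammar *)

Section Target.
Context {disp : Order.disp_t} {Sigma : finOrderType disp} {M : monoidType}.
Variables (h : word Sigma -> M) (L : set (word Sigma)).

Definition contexts (x : word Sigma) : set (word Sigma * word Sigma) :=
  [set c | L (c.1 ++ x ++ c.2)].

Definition synt_eq (x y : word Sigma) : Prop := contexts x = contexts y.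

Definition h_substitutable : Prop :=
  forall x y, h x = h y -> contexts x `&` contexts y !=set0 -> synt_eq x y.

Definition theta (x y : word Sigma) : Prop := synt_eq x y /\ h x = h y.

Definition rclass (x : word Sigma) : set (word Sigma) := [set y | theta x y].

Definition is_rclass (X : set (word Sigma)) : Prop := exists x, X = rclass x.

Definition live_word (x : word Sigma) : Prop := contexts x !=set0.

Definition live (X : set (word Sigma)) : Prop :=
  forall x, X x -> live_word x.

Definition unit_separated : Prop := rclass [::] = [set [::]].

Definition rclass_mul (X Y : set (word Sigma)) : set (word Sigma) :=
  [set z | exists x y, [/\ X x, Y y & theta (x ++ y) z]].

(* The relative class $P_1*\cdots*P_k$ (the unit class for $k = 0$). *)
Definition rclass_muls (alpha : seq (set (word Sigma))) : set (word Sigma) :=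
  foldr rclass_mul (rclass [::]) alpha.

Definition relative_prime (P : set (word Sigma)) : Prop :=
  [/\ is_rclass P, live P, P <> rclass [::] &
      forall X Y, is_rclass X -> is_rclass Y -> P = set_cat X Y ->
        X = rclass [::] \/ Y = rclass [::]].

Definition relative_primes : set (set (word Sigma)) := [set P | relative_prime P].

Definition prime_seq (alpha : seq (set (word Sigma))) : Prop :=
  forall P, P \in alpha -> relative_prime P.

Definition correct (P : set (word Sigma)) (alpha : seq (set (word Sigma))) :=
  [/\ relative_prime P, prime_seq alpha, 2 <= size alpha & rclass_muls alpha = P].

Definition valid (P : set (word Sigma)) (alpha : seq (set (word Sigma))) :=
  correct P alpha /\
  forall beta, proper_block beta alpha -> 2 <= size beta ->
    ~ relative_prime (rclass_muls beta).

Definition exact_factorization (X : set (word Sigma))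
    (alpha : seq (set (word Sigma))) : Prop :=
  prime_seq alpha /\ X = set_cats alpha.

Definition PTLD : Prop :=
  let TT := h @` [set x | live_word x] in
  forall m r r' P p, TT m -> TT r -> TT r' -> relative_prime P -> P p ->
    (m * r)%g = h p -> (m * r')%g = h p -> r = r'.

Definition lexically_anchored : Prop :=
  forall P, relative_prime P -> exists a : Sigma, P [:: a].

Definition target_class : Prop :=
  ~ L [::] /\ h_substitutable /\ unit_separated /\ PTLD /\
  finite_set relative_primes /\ lexically_anchored.

Inductive target_rule : rule Sigma -> Prop :=
| target_production P alpha : valid P alpha ->
    target_rule (Some (name P), [seq NT (name A) | A <- alpha])
| target_lexical P a : relative_prime P -> P [:: a] ->
    target_rule (Some (name P), [:: T a])
| target_start X alpha : is_rclass X -> X `<=` L -> exact_factorization X alpha ->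
    target_rule (None, [seq NT (name A) | A <- alpha]).

Definition target_grammar : grammar Sigma :=
  Grammar [set n | n = None \/ exists2 P, relative_prime P & n = Some (name P)]
          target_rule.

End Target.

(** * The learner Relative-ASGOLD *)

Section Learner.
Context {disp : Order.disp_t} {Sigma : finOrderType disp} {M : monoidType}.
Variable h : word Sigma -> M.

(* The choices which the description of the learner leaves to a deterministic
   rule: for a sample [D] and [u] in Sub(D), the pair $(\ell_u, r_u)$; for [D]
   and an observed word [w], the vertices after 0 of a minimum-edge path. *)
Record selector := Selector {
  sel_context : {fset (word Sigma)} -> word Sigma -> word Sigma * word Sigma;
  sel_path : {fset (word Sigma)} -> word Sigma -> seq nat }.

Section Sample.
Variables (sel : selector) (D : {fset (word Sigma)}).

Definition observed : set (word Sigma) :=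
  [set u | u <> [::] /\ exists2 w, w \in D & infix u w].

Inductive W_rule : rule Sigma -> Prop :=
| W_start w : w \in D -> W_rule (None, [:: NT w])
| W_cut u v : observed u -> observed v -> observed (u ++ v) ->
    W_rule (Some (u ++ v), [:: NT u; NT v])
| W_lexical a : observed [:: a] -> W_rule (Some [:: a], [:: T a])
| W_unary u v : observed u -> observed v -> h u = h v ->
    (exists l r, l ++ u ++ r \in D /\ l ++ v ++ r \in D) ->
    W_rule (Some u, [:: NT v]).

Definition W : grammar Sigma :=
  Grammar [set n | n = None \/ exists2 u, observed u & n = Some u] W_rule.

Definition in_context (x z : word Sigma) : word Sigma :=
  (sel_context sel D x).1 ++ z ++ (sel_context sel D x).2.

Definition accepts (x z : word Sigma) : Prop := generated W (in_context x z).

Definition oclass (u : word Sigma) : set (word Sigma) :=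
  [set v | [/\ observed v, h v = h u &
             forall x, observed x -> (accepts x v <-> accepts x u)]].

Definition is_oclass (X : set (word Sigma)) : Prop :=
  exists2 u, observed u & X = oclass u.

Definition class_test (z : word Sigma) (X : set (word Sigma)) : Prop :=
  h z = h (name X) /\ accepts (name X) z.

Definition declared_prime (X : set (word Sigma)) : Prop :=
  is_oclass X /\
  forall u v Y Z, name X = u ++ v -> u <> [::] -> v <> [::] ->
    is_oclass Y -> Y u -> is_oclass Z -> Z v ->
    exists2 x, X x &
      ~ exists x1 x2, [/\ x = x1 ++ x2, class_test x1 Y & class_test x2 Z].

Definition segment (w : word Sigma) (i j : nat) : word Sigma :=
  take (j - i) (drop i w).

Definition edge (w : word Sigma) (i j : nat) : Prop :=
  i < j <= size w /\ exists2 P, declared_prime P & P (segment w i j).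

Definition factor_path (w : word Sigma) (p : seq nat) : Prop :=
  path (fun i j => `[< edge w i j >]) 0 p /\ last 0 p = size w.

Definition min_factor_path (w : word Sigma) (p : seq nat) : Prop :=
  factor_path w p /\ forall q, factor_path w q -> size p <= size q.

Definition path_classes (w : word Sigma) (p : seq nat) : seq (set (word Sigma)) :=
  pairmap (fun i j => oclass (segment w i j)) 0 p.

Definition alpha_of (Q : set (word Sigma)) : seq (set (word Sigma)) :=
  path_classes (name Q) (sel_path sel D (name Q)).

Definition names_cat (gamma : seq (set (word Sigma))) : word Sigma :=
  flatten [seq name A | A <- gamma].

Definition kept (N : set (word Sigma)) (gamma : seq (set (word Sigma))) : Prop :=
  class_test (names_cat gamma) N /\
  forall beta P, proper_block beta gamma -> 2 <= size beta ->
    declared_prime P -> ~ class_test (names_cat beta) P.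

Inductive learned_rule : rule Sigma -> Prop :=
| learned_production N A Q :
    declared_prime N -> declared_prime A -> is_oclass Q ->
    kept N (A :: alpha_of Q) ->
    learned_rule (Some (name N), [seq NT (name B) | B <- A :: alpha_of Q])
| learned_lexical P a : declared_prime P -> P [:: a] ->
    learned_rule (Some (name P), [:: T a])
| learned_start w : w \in D ->
    learned_rule (None, [seq NT (name B) | B <- alpha_of (oclass w)]).

Definition learned_grammar : grammar Sigma :=
  Grammar [set n | n = None \/ exists2 P, declared_prime P & n = Some (name P)]
          learned_rule.

Definition admissible_on : Prop :=
  (forall u, observed u -> in_context u u \in D) /\
  (forall w, observed w -> min_factor_path w (sel_path sel D w)).

End Sample.

Definition admissible (sel : selector) : Prop :=
  forall D : {fset (word Sigma)}, [::] \notin D -> admissible_on sel D.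

End Learner.

(** * A model of computation

  A first-order call-by-value functional language over binary trees: a program
  is a finite table of unary functions, run from function 0. Every evaluation
  step costs 1, and reading a variable or building a pair costs in addition the
  size of the resulting tree. Hence a computation of cost [t] is simulated by a
  Turing machine in time polynomial in [t] and in the size of the input, without
  any sharing of subtrees; conversely Turing machines are simulated with
  polynomial overhead. *)

Inductive tree := Leaf | Pair of tree & tree.

Fixpoint tree_size (v : tree) : nat :=
  if v is Pair a b then (tree_size a + tree_size b).+1 else 1.

(* Variables are de Bruijn indices; [Case e e0 e1] evaluates [e1] with the left
   component of the pair as variable 0 and the right one as variable 1. *)
Inductive expr :=
| Var of nat
| LeafE
| PairE of expr & expr
| Case of expr & expr & expr
| Let of expr & expr
| Call of nat & expr.

Definition program : Type := seq expr.

Inductive eval (prog : program) : seq tree -> expr -> tree -> nat -> Prop :=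
| eval_var env i :
    eval prog env (Var i) (nth Leaf env i) (tree_size (nth Leaf env i)).+1
| eval_leaf env : eval prog env LeafE Leaf 1
| eval_pair env e1 e2 v1 v2 t1 t2 :
    eval prog env e1 v1 t1 -> eval prog env e2 v2 t2 ->
    eval prog env (PairE e1 e2) (Pair v1 v2) (t1 + t2 + tree_size (Pair v1 v2)).+1
| eval_case_leaf env e e0 e1 v t t0 :
    eval prog env e Leaf t -> eval prog env e0 v t0 ->
    eval prog env (Case e e0 e1) v (t + t0).+1
| eval_case_pair env e e0 e1 a b v t t1 :
    eval prog env e (Pair a b) t -> eval prog (a :: b :: env) e1 v t1 ->
    eval prog env (Case e e0 e1) v (t + t1).+1
| eval_let env e1 e2 v1 v2 t1 t2 :
    eval prog env e1 v1 t1 -> eval prog (v1 :: env) e2 v2 t2 ->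
    eval prog env (Let e1 e2) v2 (t1 + t2).+1
| eval_call env f e v1 v t1 t2 :
    eval prog env e v1 t1 -> eval prog [:: v1] (nth LeafE prog f) v t2 ->
    eval prog env (Call f e) v (t1 + t2).+1.

Definition runs (prog : program) (input output : tree) (t : nat) : Prop :=
  eval prog [:: input] (nth LeafE prog 0) output t.

Section Encoding.
Context {disp : Order.disp_t} {Sigma : finOrderType disp}.

Definition enc_nat (n : nat) : tree := iter n (Pair Leaf) Leaf.

Definition enc_seq {A : Type} (enc : A -> tree) (s : seq A) : tree :=
  foldr (fun x t => Pair (enc x) t) Leaf s.

Definition enc_letter (a : Sigma) : tree := enc_nat (enum_rank a).

Definition enc_word (w : word Sigma) : tree := enc_seq enc_letter w.

Definition enc_nonterminal (n : nonterminal Sigma) : tree :=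
  if n is Some w then Pair Leaf (enc_word w) else Leaf.

Definition enc_symbol (s : symbol Sigma) : tree :=
  match s with
  | inl n => Pair Leaf (enc_nonterminal n)
  | inr a => Pair (Pair Leaf Leaf) (enc_letter a)
  end.

Definition enc_rule (r : rule Sigma) : tree :=
  Pair (enc_nonterminal r.1) (enc_seq enc_symbol r.2).

Definition enc_listing (g : listing Sigma) : tree :=
  Pair (enc_seq enc_nonterminal g.1) (enc_seq enc_rule g.2).

(* The sample, a finite set, may be presented to the program in any order, and
   the program may list the components of the output grammar in any order. *)
Definition computes_in_time (prog : program)
    (learner : {fset (word Sigma)} -> grammar Sigma) (bound : nat -> nat) : Prop :=
  forall (D : {fset (word Sigma)}) (s : seq (word Sigma)),
    [::] \notin D -> perm_eq s D ->
    exists g t,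
      [/\ lists (learner D) g,
          runs prog (enc_seq enc_word s) (enc_listing g) t &
          t <= bound (sample_size D)].

End Encoding.

(* Main.v *)
Require Import Defs.
From mathcomp Require Import all_boot all_order all_algebra finmap.
From mathcomp Require Import boolp classical_sets cardinality.
From mathcomp Require Import zify.

Set Implicit Arguments.
Unset Strict Implicit.
Unset Printing Implicit Defensive.

Import Order.TTheory GRing.Theory.

Local Open Scope nat_scope.

(** Every run is finite and uses only comparisons of observed words, so
  polynomial time reduces to two facts. Membership in $L(W)$ for a word $w$ is
  the least fixpoint of a monotone step on the polynomially many pairs
  ($u$, substring of $w$), reached within as many rounds as there are pairs; and a
  minimum-edge path is found by a table filled from right to left. Everything else
  is composed from a class of functions closed under composition, branching
  and folds whose accumulators stay polynomially bounded.

  For convergence, PTLD gives cancellation inside a prime: if $ab$ and $ab'$ lie in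
  one prime then $b\mathrel\theta b'$. With unit separation every prime is therefore a
  prefix code, which forces any inclusion $\overline\alpha\subseteq\overline\beta$
  of prime products to be an equality $\alpha=\beta$ as soon as no block of
  $\alpha$ of length at least 2 has a prime class. So exact factorizations are
  unique, the tail of a valid production $P\to A\alpha'$ is the exact
  factorization of a class determined by $P$ and $A$, and minimum-edge paths read
  off exact factorizations, since a block of prime class could be merged into
  one edge.

  By lexical anchoring each prime is named by a letter and, following a shortest chain
  of valid productions from a start rule, has a context of length at most
  $(|\Sigma|+1)|G^\star|$. The characteristic sample puts the right-hand side of
  every rule, spelled with these letters, into the context of its left-hand
  side. Then $W$ simulates the target grammar, so $L(W)=L$, all the tests of the
  learner are exact, and only the target rules are output. *)

(** * Functions computable in polynomial time *)

(** PTLD cancels on one side only, so the combinatorial arguments run from left to right: two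
    factorizations are compared at their first factor, then what remains is compared again. The
    inclusion $L(W)\subseteq L$ holds for every sample inside $L$: a unary rule joins words with
    equal $h$-value and a shared context, which $h$-substitutability makes congruent, so a
    derivation never leaves its relative class. The converse is what the characteristic sample is
    for. Once $L(W)=L$, one context decides membership in a class, since words with equal $h$-value
    that are both accepted in $(\ell_u,r_u)$ share that context. Convergence therefore holds for
    every admissible choice of contexts and paths, although only one choice is programmed. Because
    names are letters, the size of a rule is its number of symbols; the quadratic bound arises from
    at most $|G^\star|$ words, each a context of length at most $(|\Sigma|+1)|G^\star|$ around one
    right-hand side. *)

Class encodable (A : Type) :=
  Encodable { encode : A -> tree; encode_inj : injective encode }.

Definition code_size {A} {eA : encodable A} (a : A) : nat := tree_size (encode a).

Lemma tree_size_gt0 v : 0 < tree_size v.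
Proof. by case: v. Qed.

Lemma code_size_gt0 {A} {eA : encodable A} (a : A) : 0 < code_size a.
Proof. exact: tree_size_gt0. Qed.

(** The base is at least 2, so one exponent absorbs constants, sums and products, and no
    coefficients have to be carried along. *)
Definition pbounded {A} {eA : encodable A} (T : A -> nat) : Prop :=
  exists k, forall a, T a <= (code_size a + 2) ^ k.

Section PBounded.
Context {A : Type} {eA : encodable A}.
Implicit Types T U : A -> nat.

Lemma pbounded_le T U : (forall a, T a <= U a) -> pbounded U -> pbounded T.
Proof. by move=> TU [k Uk]; exists k => a; apply: leq_trans (TU a) (Uk a). Qed.

Lemma pbounded_cst c : pbounded (fun _ : A => c).
Proof.
exists c => a; apply: (@leq_trans (2 ^ c)); first exact/ltnW/ltn_expl.
by case: c => [|c]; rewrite ?expn0 // leq_exp2r // leq_addl.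
Qed.

Lemma pbounded_size : pbounded (fun a : A => code_size a).
Proof. by exists 1 => a; rewrite expn1 leq_addr. Qed.

Lemma pboundedM T U : pbounded T -> pbounded U -> pbounded (fun a => T a * U a).
Proof. by move=> [k Tk] [l Ul]; exists (k + l) => a; rewrite expnD leq_mul. Qed.

Lemma pboundedD T U : pbounded T -> pbounded U -> pbounded (fun a => T a + U a).
Proof.
move=> bT bU.
(* A sum is at most the product of the successors, and a successor costs one more in the
   exponent. *)
have: pbounded (fun a => 1 * ((T a).+1 * (U a).+1)).
  apply: (pboundedM (pbounded_cst 1)).
  have S V : pbounded V -> pbounded (fun a => (V a).+1).
    move=> [k Vk]; exists k.+1 => a; rewrite expnS.
    have := Vk a; set m := (_ + 2) ^ k; have : 0 < m by rewrite expn_gt0 addn2.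
    by rewrite addn2; nia.
  by apply: pboundedM; apply: S.
by apply: pbounded_le => a; nia.
Qed.

Lemma pboundedS T : pbounded T -> pbounded (fun a => (T a).+1).
Proof.
by move=> /(pboundedD (pbounded_cst 1)); apply: pbounded_le => a; rewrite add1n.
Qed.

Lemma pboundedX T k : pbounded T -> pbounded (fun a => T a ^ k).
Proof.
move=> bT; elim: k => [|k IH]; first exact: pbounded_cst.
by apply: pbounded_le (pboundedM bT IH) => a; rewrite expnS.
Qed.

End PBounded.

Lemma leq_exp_r m n k : m <= n -> m ^ k <= n ^ k.
Proof. by case: k => // k mn; rewrite leq_exp2r. Qed.

Lemma pbounded_comp {A B} {eA : encodable A} {eB : encodable B} (T : B -> nat)
    (f : A -> B) : pbounded (fun a => code_size (f a)) -> pbounded T ->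
  pbounded (fun a => T (f a)).
Proof.
move=> bf [k Tk].
have /(pboundedX k) : pbounded (fun a => code_size (f a) + 2).
  by apply: pboundedD => //; apply: pbounded_cst.
by apply: pbounded_le => a; apply: Tk.
Qed.

(* A program is assembled from fragments: [ext] is appended at offset [n] of the
   function table, whatever surrounds it, so that no call is ever renumbered. *)
Definition ptime {A B} {eA : encodable A} {eB : encodable B} (f : A -> B) : Prop :=
  exists2 T : A -> nat, pbounded T &
    forall n, exists ext e, forall pre suf env a, size pre = n ->
      exists2 t, eval (pre ++ ext ++ suf) (encode a :: env) e (encode (f a)) t &
                 t <= T a.

(** Whatever reads or builds a tree pays for its size, so a time bound also bounds the output. This
    is what makes composition possible. *)
Lemma eval_size prog env e v t : eval prog env e v t -> tree_size v <= t.
Proof. by elim=> //= *; lia. Qed.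

Section PTime.
Context {A B C : Type} {eA : encodable A} {eB : encodable B} {eC : encodable C}.

Lemma ptime_ext (f g : A -> B) : f =1 g -> ptime f -> ptime g.
Proof. by move=> /funext ->. Qed.

Lemma ptime_size (f : A -> B) : ptime f -> pbounded (fun a => code_size (f a)).
Proof.
case=> T bT Pf; apply: pbounded_le bT => a.
have [ext [e]] := Pf 0.
by move=> /(_ [::] [::] [::] a erefl) [t] /eval_size h1 h2; apply: leq_trans h2.
Qed.

Lemma ptime_id : ptime (@id A).
Proof.
exists (fun a => (code_size a).+1); first exact/pboundedS/pbounded_size.
move=> n; exists [::], (Var 0) => pre suf env a _.
by eexists; first exact: (@eval_var _ (encode a :: env) 0).
Qed.

Lemma ptime_comp (f : A -> B) (g : B -> C) :
  ptime g -> ptime f -> ptime (fun a => g (f a)).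
Proof.
move=> [T bT Pg] Pf; have sf := ptime_size Pf; case: Pf => U bU Pf.
exists (fun a => (U a + T (f a)).+1).
  by apply/pboundedS/pboundedD => //; apply: pbounded_comp.
move=> n; have [ext1 [e1 H1]] := Pf n.
have [ext2 [e2 H2]] := Pg (n + size ext1).
exists (ext1 ++ ext2), (Let e1 e2) => pre suf env a szp.
have [t1 ev1 le1] := H1 pre (ext2 ++ suf) env a szp.
have [|t2 ev2 le2] := H2 (pre ++ ext1) suf (encode a :: env) (f a).
  by rewrite size_cat szp.
exists (t1 + t2).+1; last by rewrite ltnS leq_add.
by apply: (@eval_let _ _ _ _ (encode (f a))); rewrite -?catA // in ev2 *.
Qed.

End PTime.

Section Encodable.
Context {A B : Type} {eA : encodable A} {eB : encodable B}.

Definition encode_pair (p : A * B) : tree := Pair (encode p.1) (encode p.2).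

Lemma encode_pair_inj : injective encode_pair.
Proof. by move=> [a b] [c d] /= [] /(@encode_inj A) -> /(@encode_inj B) ->. Qed.

Definition encode_bool (b : bool) : tree := if b then Pair Leaf Leaf else Leaf.

Lemma encode_bool_inj : injective encode_bool.
Proof. by case=> -[]. Qed.

Lemma encode_unit_inj : injective (fun _ : unit => Leaf).
Proof. by move=> [] []. Qed.

Lemma encode_seq_inj : injective (enc_seq (@encode A eA)).
Proof. by elim=> [|a s IH] [|b t] //= [] /(@encode_inj A) -> /IH ->. Qed.

Lemma enc_nat_inj : injective enc_nat.
Proof. by elim=> [|m IH] [|n] //= [] /IH ->. Qed.

Definition encode_option (o : option A) : tree :=
  if o is Some a then Pair Leaf (encode a) else Leaf.

Lemma encode_option_inj : injective encode_option.
Proof. by move=> [a|] [b|] //= [] /(@encode_inj A) ->. Qed.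

Definition encode_sum (o : A + B) : tree :=
  match o with
  | inl a => Pair Leaf (encode a)
  | inr b => Pair (Pair Leaf Leaf) (encode b)
  end.

Lemma encode_sum_inj : injective encode_sum.
Proof. by move=> [a|a] [b|b] //= [] => [/(@encode_inj A)|/(@encode_inj B)] ->. Qed.

End Encodable.

(** These instances agree by conversion with the prescribed encodings of words, symbols, rules and
    listings, so a run on [encode] is already a run on [enc_word] and [enc_listing]. *)
#[export] Instance encodable_prod {A B} {eA : encodable A} {eB : encodable B} :
  encodable (A * B) := Encodable (@encode_pair_inj A B eA eB).
#[export] Instance encodable_bool : encodable bool := Encodable encode_bool_inj.
#[export] Instance encodable_unit : encodable unit := Encodable encode_unit_inj.
#[export] Instance encodable_seq {A} {eA : encodable A} : encodable (seq A) :=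
  Encodable (@encode_seq_inj A eA).
#[export] Instance encodable_nat : encodable nat := Encodable enc_nat_inj.
#[export] Instance encodable_option {A} {eA : encodable A} : encodable (option A) :=
  Encodable (@encode_option_inj A eA).
#[export] Instance encodable_sum {A B} {eA : encodable A} {eB : encodable B} :
  encodable (A + B) := Encodable (@encode_sum_inj A B eA eB).

Section Basic.
Context {E A B C : Type} {eE : encodable E} {eA : encodable A} {eB : encodable B}
  {eC : encodable C}.

Lemma ptime_pair (f : E -> A) (g : E -> B) :
  ptime f -> ptime g -> ptime (fun x => (f x, g x)).
Proof.
move=> Pf Pg; have bf := ptime_size Pf; have bg := ptime_size Pg.
case: Pf Pg => [T bT Pf] [U bU Pg].
exists (fun x => (T x + U x + (code_size (f x) + code_size (g x)).+1).+1).
  by apply/pboundedS/pboundedD; [apply: pboundedD|apply/pboundedS/pboundedD].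
move=> n; have [ext1 [e1 H1]] := Pf n.
have [ext2 [e2 H2]] := Pg (n + size ext1).
exists (ext1 ++ ext2), (PairE e1 e2) => pre suf env a szp.
have [t1 ev1 le1] := H1 pre (ext2 ++ suf) env a szp.
have [|t2 ev2 le2] := H2 (pre ++ ext1) suf env a.
  by rewrite size_cat szp.
eexists; first by apply: eval_pair; rewrite -?catA // in ev1 ev2 *; [exact: ev1|exact: ev2].
by rewrite /= -!/(code_size _) ltnS leq_add ?leq_add.
Qed.

Lemma ptime_fst : ptime (@fst A B).
Proof.
exists (fun p => (code_size p + code_size p).+3).
  by do 3 apply pboundedS; apply: pboundedD; apply pbounded_size.
move=> n; exists [::], (Case (Var 0) LeafE (Var 0)) => pre suf env [a b] _ /=.
eexists; first by apply: (@eval_case_pair _ _ _ _ _ (encode a) (encode b));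
  apply: eval_var.
by rewrite /= /code_size /=; lia.
Qed.

Lemma ptime_snd : ptime (@snd A B).
Proof.
exists (fun p => (code_size p + code_size p).+3).
  by do 3 apply pboundedS; apply: pboundedD; apply pbounded_size.
move=> n; exists [::], (Case (Var 0) LeafE (Var 1)) => pre suf env [a b] _ /=.
eexists; first by apply: (@eval_case_pair _ _ _ _ _ (encode a) (encode b));
  apply: eval_var.
by rewrite /= /code_size /=; lia.
Qed.

Lemma ptime_cst_tree (v : tree) :
  exists e c, forall prog env, exists2 t, eval prog env e v t & t <= c.
Proof.
elim: v => [|v [e [c H]] w [e' [c' H']]].
  by exists LeafE, 1 => prog env; exists 1 => //; apply: eval_leaf.
exists (PairE e e'), (c + c' + tree_size (Pair v w)).+1 => prog env.
have [t ev le] := H prog env; have [t' ev' le'] := H' prog env.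
by eexists; [apply: eval_pair; eassumption|rewrite ltnS leq_add ?leq_add].
Qed.

Lemma ptime_cst (b : B) : ptime (fun _ : A => b).
Proof.
have [e [c H]] := ptime_cst_tree (encode b).
exists (fun _ => c); first exact: pbounded_cst.
by move=> n; exists [::], e => pre suf env a _; apply: H.
Qed.

(* [f] handles the leaf and [g] the two subtrees of the encoding of [p e]; this
   covers booleans, naturals, options and sequences alike. *)
Lemma ptime_case (P : Type) (eP : encodable P) (p : E -> P) (f : E -> C)
    (g : E * (A * B) -> C) (r : E -> C) :
  (forall e, (encode (p e) = Leaf /\ r e = f e) \/
     exists a b, encode (p e) = Pair (encode a) (encode b) /\ r e = g (e, (a, b))) ->
  ptime p -> ptime f -> ptime g -> ptime r.
Proof.
move=> pE Pp; have bp := ptime_size Pp.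
case: Pp => [Tp bTp Pp] [Tf bTf Pf] [Tg [k bTg] Pg].
(* The input [(e, (a, b))] of [g] has the size of [e] and [p e] together plus one, which explains
   the 3 under the power. The linear terms pay for rebuilding this triple. *)
exists (fun e => Tp e + Tf e + (code_size e + code_size (p e) + 3) ^ k
   + (code_size e + code_size (p e)) * 4 + 20).
  apply: pboundedD (pbounded_cst 20).
  apply: pboundedD; last apply: pboundedM (pbounded_cst 4).
    apply: pboundedD; first exact: pboundedD.
    apply: pboundedX; apply: pboundedD (pbounded_cst 3).
    by apply: pboundedD => //; apply pbounded_size.
  by apply: pboundedD => //; apply pbounded_size.
move=> n; have [ext1 [e1 H1]] := Pp n.
have [ext2 [e2 H2]] := Pf (n + size ext1).
have [ext3 [e3 H3]] := Pg (n + size ext1 + size ext2).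
exists (ext1 ++ ext2 ++ ext3),
  (Case e1 e2 (Let (PairE (Var 2) (PairE (Var 0) (Var 1))) e3)).
move=> pre suf env x szp.
have [t1 ev1 le1] := H1 pre (ext2 ++ ext3 ++ suf) env x szp.
case: (pE x) => [[px ->]|[a [b [px ->]]]].
  have [|t2 ev2 le2] := H2 (pre ++ ext1) (ext3 ++ suf) env x.
    by rewrite size_cat szp.
  eexists.
    by apply: eval_case_leaf; rewrite -?catA // in ev1 ev2 *;
      [rewrite px in ev1; exact: ev1|exact: ev2].
  by lia.
have [|t3 ev3 le3] := H3 (pre ++ ext1 ++ ext2) suf
  (encode a :: encode b :: encode x :: env) (x, (a, b)).
  by rewrite !size_cat szp addnA.
have sp : code_size (p x) = (code_size a + code_size b).+1 by rewrite /code_size px.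
have le3' : t3 <= (code_size x + code_size (p x) + 3) ^ k.
  apply: leq_trans le3 (leq_trans (bTg _) _); apply: leq_exp_r.
  by rewrite sp /code_size /= ; lia.
eexists.
  apply: eval_case_pair; rewrite -?catA // in ev1 ev3 *; [by rewrite px in ev1; exact: ev1|].
  apply: eval_let; last exact: ev3.
  apply: eval_pair; first exact: eval_var.
  by apply: eval_pair; exact: eval_var.
rewrite /= -!/(code_size _).
move: le1 le3' sp; set u := _ ^ k; set v := code_size (p x); lia.
Qed.

End Basic.

Section Conditional.
Context {E A B C : Type} {eE : encodable E} {eA : encodable A} {eB : encodable B}
  {eC : encodable C}.

Lemma ptime_if (b : E -> bool) (f g : E -> C) :
  ptime b -> ptime f -> ptime g -> ptime (fun e => if b e then f e else g e).
Proof.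
move=> Pb Pf Pg.
apply: (@ptime_case _ unit unit _ _ _ _ _ _ _ b g (fun q => f q.1)) => //.
  by move=> e; case: (b e); [right; exists tt, tt|left].
by apply: ptime_comp => //; apply: ptime_fst.
Qed.

End Conditional.

Section Fold.
Context {E A B : Type} {eE : encodable E} {eA : encodable A} {eB : encodable B}.
Variables (z : E -> B) (g : E * (A * B) -> B).

Let fold (q : E * seq A) : B := foldr (fun a b => g (q.1, (a, b))) (z q.1) q.2.

(* Bounded recursion in the sense of Cobham: without the bound on the
   intermediate values, iterated polynomial growth would be exponential. *)
Lemma ptime_foldr_pair :
  pbounded (fun q => code_size (fold q)) -> ptime z -> ptime g -> ptime fold.
Proof.
move=> [K bK] [Tz bTz Pz] [Tg [k bTg] Pg].
(* [N] dominates both the input and every intermediate accumulator; [C] is then the cost of a single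
   round. *)
pose (N := fun q : E * seq A => code_size q + (code_size q + 2) ^ K).
have bN : pbounded N.
  apply: pboundedD; first by apply pbounded_size.
  by apply: pboundedX; apply: pboundedD (pbounded_cst 2); apply pbounded_size.
pose (C := fun q : E * seq A => Tz q.1 + (N q + 5) ^ k + 30 * N q + 30).
exists (fun q => code_size q * C q + code_size q + 2).
  apply: pboundedD (pbounded_cst 2); apply: pboundedD; last by apply pbounded_size.
  apply: pboundedM; first by apply pbounded_size.
  apply: pboundedD (pbounded_cst 30); apply: pboundedD; last first.
    by apply: pboundedM => //; apply: pbounded_cst.
  apply: pboundedD.
    by apply: (pbounded_comp (f := fst)) => //; exact: ptime_size (ptime_fst).
  by apply: pboundedX; apply: pboundedD => //; apply: pbounded_cst.
move=> n; have [ext1 [e1 H1]] := Pz n.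
have [ext2 [e2 H2]] := Pg (n + size ext1).
pose m := n + size ext1 + size ext2.
(* The function calls itself at index [m], known beforehand because the fragments in front of it
   have fixed lengths. A function sees only its argument, so the parameter is passed on with each
   call. *)
pose body := Case (Var 0) LeafE (Case (Var 1) (Let (Var 0) e1)
  (Let (PairE (Var 2) (PairE (Var 0) (Call m (PairE (Var 2) (Var 1))))) e2)).
exists (ext1 ++ ext2 ++ [:: body]), (Call m (Var 0)) => pre suf env q szp.
set prog := _ ++ _.
have body_m : nth LeafE prog m = body.
  rewrite /prog -!catA /m -!addnA -szp.
  by do 2 rewrite nth_cat ltnNge leq_addr addKn; rewrite nth_cat ltnn subnn.
(* The cost of a round is stated in terms of [q], not of the current suffix [s], so that the
   induction adds one [C q] per element. *)
have main s : code_size s <= code_size q.2 ->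
    exists2 t, eval prog [:: encode (q.1, s)] body (encode (fold (q.1, s))) t &
               t <= (size s).+1 * C q.
  have szq : code_size q = (code_size q.1 + code_size q.2).+1 by case: (q).
  have CE : C q = Tz q.1 + (N q + 5) ^ k + 30 * N q + 30 by [].
  have NE : code_size q <= N q by apply: leq_addr.
  elim: s => [|a s IH] szs.
    have [t1 ev1 le1] := H1 pre (ext2 ++ [:: body] ++ suf)
      [:: encode q.1; Leaf; encode (q.1, [::] : seq A)] q.1 szp.
    eexists.
      apply: eval_case_pair; first exact: eval_var.
      apply: eval_case_leaf; first exact: (@eval_var _ [:: encode q.1; Leaf; _] 1).
      apply: eval_let; first exact: eval_var.
      by rewrite /prog -!catA; exact: ev1.
    rewrite mul1n CE /= -!/(code_size _).
    have : 0 < code_size q.2 by apply: tree_size_gt0.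
    move: le1 NE szq; set u := _ ^ k; lia.
  have szas : code_size (a :: s) = (code_size a + code_size s).+1 by [].
  have [t3 ev3 le3] := IH ltac:(lia).
  pose b := fold (q.1, s).
  have [|t2 ev2 le2] := H2 (pre ++ ext1) ([:: body] ++ suf)
     [:: encode a; encode s; encode q.1; encode (a :: s); encode (q.1, a :: s)]
     (q.1, (a, b)).
    by rewrite size_cat szp.
  have leb : code_size b <= (code_size q + 2) ^ K.
    apply: leq_trans (bK _) _; apply: leq_exp_r; rewrite leq_add2r szq.
    have -> : code_size (q.1, s) = (code_size q.1 + code_size s).+1 by [].
    lia.
  have le2' : t2 <= (N q + 5) ^ k.
    apply: leq_trans le2 (leq_trans (bTg _) _); apply: leq_exp_r.
    have -> : code_size (q.1, (a, b)) = (code_size q.1 + (code_size a + code_size b).+1).+1 by [].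
    rewrite /N; lia.
  eexists.
    apply: eval_case_pair; first exact: eval_var.
    apply: (@eval_case_pair _ _ _ _ _ (encode a) (encode s)).
      exact: (@eval_var _ [:: encode q.1; encode (a :: s); _] 1).
    apply: eval_let; last by rewrite /prog -!catA; rewrite -!catA in ev2; exact: ev2.
    apply: eval_pair; first exact: eval_var.
    apply: eval_pair; first exact: eval_var.
    apply: eval_call; last by rewrite body_m; exact: ev3.
    by apply: eval_pair; exact: eval_var.
  rewrite [(size _).+1 * _]mulSn /= -!/(code_size _).
  have : code_size b <= N q by rewrite /N; lia.
  move: le2' le3 NE; rewrite CE -/b; set u := _ ^ k; set v := N q.
  have : tree_size (encode b) = code_size b by [].
  have : 0 < code_size q.1 by apply: tree_size_gt0.
  have : 0 < code_size s by apply: tree_size_gt0.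
  move: szas szs szq.
  set cas := code_size (a :: s).
  have -> : tree_size (enc_seq encode s) = code_size s by [].
  by move=> ->; set w := _.+1 * _; clearbody w; lia.
have [t ev le] := main q.2 (leqnn _).
eexists.
  apply: eval_call; first exact: eval_var.
  by rewrite body_m /=; case: (q) ev => e s /= ev; exact: ev.
have : size q.2 < code_size q.
  case: (q) => e s /=; apply: (@leq_trans (code_size s)).
    elim: s => [|a s IH] //=; rewrite /code_size /= -!/(code_size _); rewrite ltnS.
    by apply: leq_trans IH _; apply: leq_addl.
  by rewrite /code_size /=; lia.
move: le; rewrite /= -!/(code_size _).
have -> : (code_size q.1 + tree_size (enc_seq encode q.2)).+1 = code_size q by case: (q).
set v := C q => le sz; have : (size q.2).+1 * v <= code_size q * v by rewrite leq_mul2r sz orbT.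
lia.
Qed.

End Fold.

Section BinaryComposition.
Context {E A B C D : Type} {eE : encodable E} {eA : encodable A} {eB : encodable B}
  {eC : encodable C} {eD : encodable D}.

Lemma ptime_comp2 (F : A -> B -> C) (f : E -> A) (g : E -> B) :
  ptime (fun p => F p.1 p.2) -> ptime f -> ptime g -> ptime (fun e => F (f e) (g e)).
Proof.
move=> PF Pf Pg.
exact: (ptime_comp (f := fun e => (f e, g e)) PF (ptime_pair Pf Pg)).
Qed.

End BinaryComposition.

Section Constructors.
Context {E A B C D : Type} {eE : encodable E} {eA : encodable A} {eB : encodable B}
  {eC : encodable C} {eD : encodable D}.

Lemma ptime_comp3 (F : A -> B -> C -> D) (f : E -> A) (g : E -> B) (h : E -> C) :
  ptime (fun p => F p.1.1 p.1.2 p.2) -> ptime f -> ptime g -> ptime h ->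
  ptime (fun e => F (f e) (g e) (h e)).
Proof.
move=> PF Pf Pg Ph.
exact: (ptime_comp2 (F := fun p c => F p.1 p.2 c) PF (ptime_pair Pf Pg) Ph).
Qed.

(** A cons cell has the same tree as a pair, so the program for pairs serves unchanged; likewise
    below for [Some], the two injections and the successor, with a constant left component. *)
Lemma ptime_cons (f : E -> A) (s : E -> seq A) :
  ptime f -> ptime s -> ptime (fun e => f e :: s e).
Proof.
move=> Pf Ps; have := ptime_pair Pf Ps.
by case=> T bT H; exists T.
Qed.

Lemma ptime_Some (f : E -> A) : ptime f -> ptime (fun e => Some (f e)).
Proof.
move=> Pf; have := ptime_pair (ptime_cst tt) Pf.
by case=> T bT H; exists T.
Qed.

Lemma ptime_inl (f : E -> A) : ptime f -> ptime (fun e => inl (f e) : A + B).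
Proof.
move=> Pf; have := ptime_pair (ptime_cst tt) Pf.
by case=> T bT H; exists T.
Qed.

Lemma ptime_inr (f : E -> B) : ptime f -> ptime (fun e => inr (f e) : A + B).
Proof.
move=> Pf; have := ptime_pair (ptime_cst true) Pf.
by case=> T bT H; exists T.
Qed.

Lemma ptime_succn (f : E -> nat) : ptime f -> ptime (fun e => (f e).+1).
Proof.
move=> Pf; have := ptime_pair (ptime_cst tt) Pf.
by case=> T bT H; exists T.
Qed.

Lemma ptime_predn (f : E -> nat) : ptime f -> ptime (fun e => (f e).-1).
Proof.
move=> Pf.
apply: (@ptime_case E unit nat nat _ _ _ _ nat _ f (fun _ => 0) (fun q => q.2.2)) => //.
- by move=> e; case: (f e) => [|n]; [left|right; exists tt, n].
- exact: ptime_cst.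
- by apply: ptime_comp; [exact: ptime_snd|exact: ptime_snd].
Qed.

Lemma ptime_head (x : E -> A) (s : E -> seq A) :
  ptime x -> ptime s -> ptime (fun e => head (x e) (s e)).
Proof.
move=> Px Ps.
apply: (@ptime_case E A (seq A) A _ _ _ _ (seq A) _ s x (fun q => q.2.1)) => //.
- by move=> e; case: (s e) => [|a t]; [left|right; exists a, t].
- by apply: ptime_comp; [exact: ptime_fst|exact: ptime_snd].
Qed.

Lemma ptime_behead (s : E -> seq A) : ptime s -> ptime (fun e => behead (s e)).
Proof.
move=> Ps.
apply: (@ptime_case E A (seq A) (seq A) _ _ _ _ (seq A) _ s (fun _ => [::]) (fun q => q.2.2)) => //.
- by move=> e; case: (s e) => [|a t]; [left|right; exists a, t].
- exact: ptime_cst.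
- by apply: ptime_comp; [exact: ptime_snd|exact: ptime_snd].
Qed.

Lemma ptime_nilp (s : E -> seq A) : ptime s -> ptime (fun e => nilp (s e)).
Proof.
move=> Ps.
apply: (@ptime_case E A (seq A) bool _ _ _ _ (seq A) _ s (fun _ => true) (fun q => false)) => //.
- by move=> e; case: (s e) => [|a t]; [left|right; exists a, t].
- exact: ptime_cst.
- exact: ptime_cst.
Qed.

Lemma ptime_foldr (z : E -> B) (g : E -> A -> B -> B) (s : E -> seq A) :
  pbounded (fun q : E * seq A => code_size (foldr (g q.1) (z q.1) q.2)) ->
  ptime z -> ptime (fun q : E * (A * B) => g q.1 q.2.1 q.2.2) -> ptime s ->
  ptime (fun e => foldr (g e) (z e) (s e)).
Proof.
move=> bg Pz Pg Ps.
have P := ptime_foldr_pair (z := z) (g := fun q => g q.1 q.2.1 q.2.2) bg Pz Pg.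
exact: (ptime_comp (f := fun e => (e, s e)) P (ptime_pair ptime_id Ps)).
Qed.

End Constructors.

Section Iter.
Context {E B : Type} {eE : encodable E} {eB : encodable B}.

(** A number and a list of that many units have the same tree, so an iteration is a fold over
    units. *)
Lemma ptime_iter (x : E -> B) (f : E -> B -> B) (n : E -> nat) :
  pbounded (fun q : E * nat => code_size (iter q.2 (f q.1) (x q.1))) ->
  ptime x -> ptime (fun q : E * B => f q.1 q.2) -> ptime n ->
  ptime (fun e => iter (n e) (f e) (x e)).
Proof.
move=> [k bf] Px Pf [T bT Pn].
have iterE e m : iter m (f e) (x e) = foldr (fun _ : unit => f e) (x e) (nseq m tt).
  by elim: m => //= m ->.
apply: (ptime_ext (fun e => esym (iterE e _))).
apply: ptime_foldr => //.
- exists k => -[e s] /=.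
  have -> : s = nseq (size s) tt by elim: s => //= -[] s <-.
  rewrite -iterE; apply: leq_trans (bf (e, size s)) _; apply: leq_exp_r.
  rewrite leq_add2r /code_size /= ltnS leq_add2l.
  by elim: s => //= -[] s; rewrite ltnS.
- apply: (ptime_comp (f := fun q : E * (unit * B) => (q.1, q.2.2)) Pf).
  apply: ptime_pair; first exact: ptime_fst.
  by apply: ptime_comp; exact: ptime_snd.
- exists T => // m; have [ext [e H]] := Pn m; exists ext, e => pre suf env a szp.
  have [t ev le] := H pre suf env a szp; exists t => //.
  have nE i : enc_seq (fun _ => Leaf) (nseq i tt) = enc_nat i.
    by elim: i => //= i ->.
  by move: ev; rewrite /= nE.
Qed.

End Iter.

(** * Equality tests *)

Fixpoint tree_eq (x y : tree) : bool :=
  match x, y with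
  | Leaf, Leaf => true
  | Pair a b, Pair c d => tree_eq a c && tree_eq b d
  | _, _ => false
  end.

Lemma tree_eqP x y : reflect (x = y) (tree_eq x y).
Proof.
apply: (iffP idP) => [|<-]; last by elim: x => //= a -> b ->.
by elim: x y => [|a IHa b IHb] [|c d] //= /andP[/IHa -> /IHb ->].
Qed.

(** The second recursive call lies under the two variables bound by the Boolean answer of the first,
    whence the indices 5 and 3 for the right subtrees. *)
Definition tree_eq_body (m : nat) : expr :=
  Case (Var 0) LeafE (Case (Var 0) (Case (Var 1) (PairE LeafE LeafE) LeafE)
    (Case (Var 3) LeafE (Case (Call m (PairE (Var 2) (Var 0))) LeafE
      (Call m (PairE (Var 5) (Var 3)))))).

(** Each node of [x] is visited at most once, and a visit handles trees of total size linear in that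
    of [x] and [y]. *)
Lemma eval_tree_eq (prog : program) m :
  nth LeafE prog m = tree_eq_body m ->
  forall x y, exists2 t,
    eval prog [:: Pair x y] (nth LeafE prog m) (encode (tree_eq x y)) t &
    t <= 30 * tree_size x * (tree_size x + tree_size y).
Proof.
move=> progm; elim=> [|a IHa b IHb] [|c d]; rewrite progm /=.
- eexists.
    apply: eval_case_pair; first exact: (@eval_var _ [:: Pair Leaf Leaf] 0).
    apply: eval_case_leaf; first exact: (@eval_var _ [:: Leaf; Leaf; _] 0).
    apply: eval_case_leaf; first exact: (@eval_var _ [:: Leaf; Leaf; _] 1).
    by apply: eval_pair; exact: eval_leaf.
  by [].
- eexists.
    apply: eval_case_pair; first exact: (@eval_var _ [:: Pair Leaf (Pair c d)] 0).
    apply: eval_case_leaf; first exact: (@eval_var _ [:: Leaf; Pair c d; _] 0).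
    apply: eval_case_pair; first exact: (@eval_var _ [:: Leaf; Pair c d; _] 1).
    exact: eval_leaf.
  by move=> /=; lia.
- eexists.
    apply: eval_case_pair; first exact: (@eval_var _ [:: Pair (Pair a b) Leaf] 0).
    apply: eval_case_pair; first exact: (@eval_var _ [:: Pair a b; Leaf; _] 0).
    apply: eval_case_leaf; first exact: (@eval_var _ [:: a; b; Pair a b; Leaf; _] 3).
    exact: eval_leaf.
  by move=> /=; lia.
have [t1 ev1 le1] := IHa c; have [t2 ev2 le2] := IHb d.
have ga := tree_size_gt0 a; have gb := tree_size_gt0 b.
have gc := tree_size_gt0 c; have gd := tree_size_gt0 d.
case eq_ac: (tree_eq a c) ev1 => /= ev1.
  eexists.
    apply: eval_case_pair; first exact: (@eval_var _ [:: Pair (Pair a b) (Pair c d)] 0).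
    apply: eval_case_pair; first exact: (@eval_var _ [:: Pair a b; Pair c d; _] 0).
    apply: eval_case_pair; first exact: (@eval_var _ [:: a; b; Pair a b; Pair c d; _] 3).
    apply: eval_case_pair.
      by apply: eval_call; [apply: eval_pair; exact: eval_var|exact: ev1].
    apply: eval_call; first by apply: eval_pair; exact: eval_var.
    exact: ev2.
  rewrite /=; nia.
eexists.
  apply: eval_case_pair; first exact: (@eval_var _ [:: Pair (Pair a b) (Pair c d)] 0).
  apply: eval_case_pair; first exact: (@eval_var _ [:: Pair a b; Pair c d; _] 0).
  apply: eval_case_pair; first exact: (@eval_var _ [:: a; b; Pair a b; Pair c d; _] 3).
  apply: eval_case_leaf.
    by apply: eval_call; [apply: eval_pair; exact: eval_var|exact: ev1].
  exact: eval_leaf.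
rewrite /=; nia.
Qed.

(** Injectivity of the encoding reduces equality of values to equality of trees. *)
Lemma ptime_eq_op (A : eqType) (eA : encodable A) :
  ptime (fun p : A * A => p.1 == p.2).
Proof.
exists (fun p => 30 * code_size p * code_size p + code_size p + 2).
  apply: pboundedD (pbounded_cst 2); apply: pboundedD; last by apply pbounded_size.
  apply: pboundedM; last by apply pbounded_size.
  by apply: pboundedM; [exact: pbounded_cst|apply pbounded_size].
move=> m; exists [:: tree_eq_body m], (Call m (Var 0)) => pre suf env [a b] szp.
set prog := _ ++ _.
have [|t ev le] := @eval_tree_eq prog m _ (encode a) (encode b).
  by rewrite /prog nth_cat szp ltnn subnn.
have eqE : tree_eq (encode a) (encode b) = (a == b).
  by apply/tree_eqP/eqP => [/(@encode_inj A)|->].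
eexists; first by apply: eval_call; [exact: eval_var|rewrite -eqE; exact: ev].
move: le; rewrite /= /code_size /=; set u := tree_size _; set v := tree_size _.
nia.
Qed.

Lemma ptime_eq {E : Type} {eE : encodable E} {A : eqType} {eA : encodable A} (f g : E -> A) :
  ptime f -> ptime g -> ptime (fun e => f e == g e).
Proof. exact/ptime_comp2/ptime_eq_op. Qed.

Lemma code_size_cons {A} {eA : encodable A} (a : A) (s : seq A) :
  code_size (a :: s) = (code_size a + code_size s).+1.
Proof. by []. Qed.

Lemma code_size_seq {A} {eA : encodable A} (s : seq A) :
  code_size s = (\sum_(a <- s) (code_size a).+1).+1.
Proof.
elim: s => [|a s IH]; first by rewrite big_nil.
by rewrite big_cons code_size_cons IH addSn addnS.
Qed.

Lemma code_size_nat (n : nat) : code_size n = n.*2.+1.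
Proof.
elim: n => //= n IH.
have -> : code_size n.+1 = (1 + code_size n).+1 by [].
by rewrite IH doubleS.
Qed.

Lemma code_size_pair {A B} {eA : encodable A} {eB : encodable B} (p : A * B) :
  code_size p = (code_size p.1 + code_size p.2).+1.
Proof. by case: p. Qed.

Lemma code_size_bool (b : bool) : code_size b <= 3.
Proof. by case: b. Qed.

Lemma size_le_code {A} {eA : encodable A} (s : seq A) : size s < code_size s.
Proof. by rewrite code_size_seq ltnS -sum1_size leq_sum. Qed.

Lemma code_size_cat {A} {eA : encodable A} (s t : seq A) :
  (code_size (s ++ t)).+1 = code_size s + code_size t.
Proof. rewrite !code_size_seq big_cat /=; lia. Qed.

Lemma code_size_mem {A : eqType} {eA : encodable A} (s : seq A) a :
  a \in s -> code_size a < code_size s.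
Proof.
rewrite code_size_seq => /(big_rem a) /= -> /=; lia.
Qed.

Lemma code_size_sub {A : eqType} {eA : encodable A} (s t : seq A) :
  subseq s t -> code_size s <= code_size t.
Proof.
move=> /subseqP[m _ ->]; rewrite !code_size_seq ltnS.
elim: t m => [|a t IH] [|[] m] //=; rewrite ?big_cons ?big_nil // ?leq_add2l //.
by apply: leq_trans (IH m) (leq_addl _ _).
Qed.

Ltac solve_pbounded := repeat
  lazymatch goal with
  | |- pbounded (fun _ => ?c) => apply pbounded_cst
  | |- pbounded (fun q => @code_size _ _ q) => apply pbounded_size
  | |- pbounded (@code_size _ _) => apply pbounded_size
  | |- pbounded (fun q => (@?f q).+1) => apply pboundedS
  | |- pbounded (fun q => @?f q + @?g q) => apply pboundedD
  | |- pbounded (fun q => @?f q * @?g q) => apply pboundedM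
  | |- pbounded (fun q => @?f q ^ ?k) => apply pboundedX
  | |- _ => assumption
  end.

Section Booleans.
Context {E A B : Type} {eE : encodable E} {eA : encodable A} {eB : encodable B}.

Lemma ptime_and (a b : E -> bool) : ptime a -> ptime b -> ptime (fun e => a e && b e).
Proof.
move=> Pa Pb; apply: (ptime_ext _ (ptime_if Pa Pb (ptime_cst false))) => e.
by case: (a e).
Qed.

Lemma ptime_or (a b : E -> bool) : ptime a -> ptime b -> ptime (fun e => a e || b e).
Proof.
move=> Pa Pb; apply: (ptime_ext _ (ptime_if Pa (ptime_cst true) Pb)) => e.
by case: (a e).
Qed.

Lemma ptime_neg (a : E -> bool) : ptime a -> ptime (fun e => ~~ a e).
Proof.
move=> Pa; apply: (ptime_ext _ (ptime_if Pa (ptime_cst false) (ptime_cst true))) => e.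
by case: (a e).
Qed.

Lemma ptime_foldr_bool (z : E -> bool) (g : E -> A -> bool -> bool) (s : E -> seq A) :
  ptime z -> ptime (fun q : E * (A * bool) => g q.1 q.2.1 q.2.2) -> ptime s ->
  ptime (fun e => foldr (g e) (z e) (s e)).
Proof.
apply: ptime_foldr; apply: pbounded_le (pbounded_cst 3) => q; exact: code_size_bool.
Qed.

End Booleans.

(* Redefined below as closure lemmas become available. *)
Ltac ptime_lib := fail.
Ltac ptime_words := fail.
Ltac ptime_learner := fail.

(** Dispatch is on the head symbol of the body. The last case eta-expands a bare function, so that
    the patterns under a binder apply to it. *)
Ltac ptime_step :=
  cbv beta;
  lazymatch goal with
  | |- ptime (fun _ => ?c) => apply ptime_cst
  | |- ptime (fun e => e) => apply ptime_id
  | |- ptime id => apply ptime_id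
  | |- ptime fst => apply ptime_fst
  | |- ptime snd => apply ptime_snd
  | |- ptime (fun e => (@?p e).1) => apply (ptime_comp ptime_fst)
  | |- ptime (fun e => (@?p e).2) => apply (ptime_comp ptime_snd)
  | |- ptime (fun e => (@?f e, @?g e)) => apply ptime_pair
  | |- ptime (fun e => @?f e && @?g e) => apply ptime_and
  | |- ptime (fun e => @?f e || @?g e) => apply ptime_or
  | |- ptime (fun e => ~~ @?f e) => apply ptime_neg
  | |- ptime (fun e => @?f e == @?g e) => apply ptime_eq
  | |- ptime (fun e => @?f e :: @?g e) => apply ptime_cons
  | |- ptime (fun e => Some (@?f e)) => apply ptime_Some
  | |- ptime (fun e => inl (@?f e)) => apply ptime_inl
  | |- ptime (fun e => inr (@?f e)) => apply ptime_inr
  | |- ptime (fun e => (@?f e).+1) => apply ptime_succn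
  | |- ptime (fun e => (@?f e).-1) => apply ptime_predn
  | |- ptime (fun e => head (@?f e) (@?g e)) => apply ptime_head
  | |- ptime (fun e => behead (@?f e)) => apply ptime_behead
  | |- ptime (fun e => nilp (@?f e)) => apply ptime_nilp
  | |- ptime (fun e => if _ then _ else _) => apply ptime_if
  | |- _ => first
      [ assumption | ptime_lib | ptime_words | ptime_learner
      | match goal with
        | Pf : ptime ?f |- ptime (fun e => ?f (@?g e)) => apply (ptime_comp (f := g) Pf)
        | |- ptime ?f =>
            lazymatch f with
            | (fun _ => _) => fail
            | _ => change (ptime (fun e => f e))
            end
        end ]
  end.

Ltac ptime := repeat ptime_step.

(** * Operations on sequences *)

Section ListIterators.
Context {E A B : Type} {eE : encodable E} {eA : encodable A} {eB : encodable B}.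

Lemma ptime_has (p : E -> A -> bool) (s : E -> seq A) :
  ptime (fun q : E * A => p q.1 q.2) -> ptime s -> ptime (fun e => has (p e) (s e)).
Proof.
move=> Pp Ps.
have hasE e : foldr (fun a b => p e a || b) false (s e) = has (p e) (s e).
  by elim: (s e) => //= a t ->.
apply: (ptime_ext hasE); apply: ptime_foldr_bool => //; ptime.
by apply: (ptime_comp2 (F := p)); ptime.
Qed.

Lemma ptime_all (p : E -> A -> bool) (s : E -> seq A) :
  ptime (fun q : E * A => p q.1 q.2) -> ptime s -> ptime (fun e => all (p e) (s e)).
Proof.
move=> Pp Ps.
have allE e : foldr (fun a b => p e a && b) true (s e) = all (p e) (s e).
  by elim: (s e) => //= a t ->.
apply: (ptime_ext allE); apply: ptime_foldr_bool => //; ptime.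
by apply: (ptime_comp2 (F := p)); ptime.
Qed.

Lemma ptime_filter (p : E -> A -> bool) (s : E -> seq A) :
  ptime (fun q : E * A => p q.1 q.2) -> ptime s ->
  ptime (fun e => [seq a <- s e | p e a]).
Proof.
move=> Pp Ps.
have fE e t : foldr (fun a r => if p e a then a :: r else r) [::] t = filter (p e) t.
  by elim: t => //= a t ->.
apply: (ptime_ext (fun e => fE e (s e))); apply: ptime_foldr => //; ptime.
  apply: pbounded_le (pbounded_size) => q; rewrite fE code_size_pair.
  rewrite leqW // (leq_trans _ (leq_addl _ _)) // !code_size_seq ltnS.
  by rewrite big_filter [leqRHS](bigID (p q.1)) /= leq_addr.
by apply: (ptime_comp2 (F := p)); ptime.
Qed.

Lemma ptime_map (f : E -> A -> B) (s : E -> seq A) :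
  ptime (fun q : E * A => f q.1 q.2) -> ptime s ->
  ptime (fun e => [seq f e a | a <- s e]).
Proof.
move=> Pf Ps.
have fE e t : foldr (fun a r => f e a :: r) [::] t = map (f e) t by [].
apply: (ptime_ext (fun e => fE e (s e))); apply: ptime_foldr => //; ptime; last first.
  by apply: (ptime_comp2 (F := f)); ptime.
have [k bf] := ptime_size Pf.
have : pbounded (fun q : E * seq A => (code_size q) * ((code_size q + 2) ^ k).+1 + 1).
  by solve_pbounded.
apply: pbounded_le => -[e t]; rewrite fE code_size_seq addn1 ltnS big_map /=.
have st : size t <= code_size (e, t).
  rewrite code_size_pair /= leqW // (leq_trans _ (leq_addl _ _)) //.
  by apply/ltnW/size_le_code.
apply: (@leq_trans (size t * ((code_size (e, t) + 2) ^ k).+1)); last first.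
  by rewrite leq_mul2r st orbT.
have: code_size e + code_size t < code_size (e, t) by rewrite code_size_pair.
move: (code_size (e, t)) => N.
elim: t {st} => [|a t IH]; rewrite ?big_nil // code_size_cons /= => tN.
rewrite big_cons mulSn leq_add //; last by apply: IH; lia.
rewrite ltnS; apply: leq_trans (bf (e, a)) _; apply: leq_exp_r.
rewrite code_size_pair /=; lia.
Qed.

Lemma ptime_cat (s t : E -> seq A) : ptime s -> ptime t -> ptime (fun e => s e ++ t e).
Proof.
move=> Ps Pt.
have P : ptime (fun p : seq A * seq A => foldr cons p.1 p.2).
  apply: (ptime_foldr (z := fst) (g := fun _ => cons) (s := snd)); ptime.
  apply: pbounded_le pbounded_size => q.
  have -> : foldr cons q.1.1 q.2 = q.2 ++ q.1.1 by elim: q.2 => //= a r ->.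
  rewrite !code_size_pair -ltnS code_size_cat; lia.
have Q := ptime_comp P (ptime_pair Pt Ps).
by apply: ptime_ext Q => e /=; elim: (s e) => //= a r ->.
Qed.

End ListIterators.

Section ListOperations.
Context {E A : Type} {eE : encodable E} {eA : encodable A}.

Lemma ptime_rev (s : E -> seq A) : ptime s -> ptime (fun e => rev (s e)).
Proof.
move=> Ps.
have revE (t : seq A) : foldr (fun a r => r ++ [:: a]) [::] t = rev t.
  by elim: t => //= a t ->; rewrite rev_cons cats1.
apply: (ptime_ext (fun e => revE (s e))).
apply: (ptime_foldr (z := fun _ => [::]) (g := fun _ a r => r ++ [:: a])) => //; ptime.
  apply: pbounded_le pbounded_size => q; rewrite revE code_size_pair !code_size_seq.
  rewrite leqW // (leq_trans _ (leq_addl _ _)) // ltnS.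
  elim: q.2 => // a t IH; rewrite rev_cons -cats1 big_cat big_seq1 big_cons /=; lia.
by apply: ptime_cat; ptime.
Qed.

Lemma ptime_flatten (s : E -> seq (seq A)) : ptime s -> ptime (fun e => flatten (s e)).
Proof.
move=> Ps; apply: (ptime_foldr (z := fun _ => [::]) (g := fun _ => cat)) => //; ptime.
  apply: pbounded_le pbounded_size => -[e t] /=; rewrite code_size_pair /=.
  rewrite leqW // (leq_trans _ (leq_addl _ _)) //.
  elim: t => //= a t IH; rewrite -ltnS code_size_cat code_size_cons; lia.
by apply: ptime_cat; ptime.
Qed.

Lemma ptime_length (s : E -> seq A) : ptime s -> ptime (fun e => size (s e)).
Proof.
move=> Ps.
have sE (t : seq A) : foldr (fun _ => S) 0 t = size t by elim: t => //= a t ->.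
apply: (ptime_ext (fun e => sE (s e))).
apply: (ptime_foldr (z := fun _ => 0) (g := fun _ _ => S)) => //; ptime.
have : pbounded (fun q : E * seq A => 2 * code_size q) by solve_pbounded.
apply: pbounded_le => q; rewrite sE code_size_nat code_size_pair.
have : size q.2 < code_size q.2 by apply: size_le_code.
lia.
Qed.

Lemma ptime_drop (n : E -> nat) (s : E -> seq A) :
  ptime n -> ptime s -> ptime (fun e => drop (n e) (s e)).
Proof.
move=> Pn Ps.
have dE m (t : seq A) : iter m behead t = drop m t.
  elim: m t => [|m IH] t; first by rewrite drop0.
  by rewrite iterSr IH; case: t.
apply: (ptime_ext (fun e => dE (n e) (s e))).
have: ptime (fun q : nat * seq A => iter q.1 behead q.2).
  apply: (ptime_iter (x := snd) (f := fun _ => behead) (n := fst)) => //; ptime.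
  apply: pbounded_le pbounded_size => q; rewrite dE.
  rewrite !code_size_pair !code_size_seq -{2}(cat_take_drop q.2 q.1.2) big_cat /=.
  lia.
by move=> P; apply: (ptime_comp P (ptime_pair Pn Ps)).
Qed.

Lemma ptime_subn (m n : E -> nat) : ptime m -> ptime n -> ptime (fun e => m e - n e).
Proof.
move=> Pm Pn.
have sE (i j : nat) : iter i predn j = j - i.
  by elim: i => [|i /= ->]; rewrite ?subn0 // subnS.
apply: (ptime_ext (fun e => sE (n e) (m e))).
have: ptime (fun q : nat * nat => iter q.1 predn q.2).
  apply: (ptime_iter (x := snd) (f := fun _ => predn) (n := fst)) => //; ptime.
  apply: pbounded_le pbounded_size => q; rewrite sE !code_size_pair !code_size_nat; lia.
by move=> P; apply: (ptime_comp P (ptime_pair Pn Pm)).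
Qed.

End ListOperations.

Section ListAccess.
Context {E A : Type} {eE : encodable E} {eA : encodable A}.

Lemma ptime_leq (m n : E -> nat) : ptime m -> ptime n -> ptime (fun e => m e <= n e).
Proof.
move=> Pm Pn; apply: ptime_eq; last exact: ptime_cst.
exact: ptime_subn.
Qed.

Lemma ptime_take (n : E -> nat) (s : E -> seq A) :
  ptime n -> ptime s -> ptime (fun e => take (n e) (s e)).
Proof.
move=> Pn Ps.
have tE m (t : seq A) : rev (drop (size t - m) (rev t)) = take m t.
  by rewrite -{3}(revK t) take_rev size_rev.
apply: (ptime_ext (fun e => tE (n e) (s e))).
apply: ptime_rev; apply: ptime_drop; last exact: ptime_rev.
by apply: ptime_subn => //; apply: ptime_length.
Qed.

Lemma ptime_nth (x : E -> A) (s : E -> seq A) (n : E -> nat) :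
  ptime x -> ptime s -> ptime n -> ptime (fun e => nth (x e) (s e) (n e)).
Proof.
move=> Px Ps Pn.
have nE a (t : seq A) m : head a (drop m t) = nth a t m.
  by rewrite -nth0 nth_drop addn0.
apply: (ptime_ext (fun e => nE (x e) (s e) (n e))).
by apply: ptime_head => //; apply: ptime_drop.
Qed.

(** An iteration does not see its index, so every round shifts the list and puts 0 in front. *)
Lemma ptime_iota0 (n : E -> nat) : ptime n -> ptime (fun e => iota 0 (n e)).
Proof.
move=> Pn.
have iE m : iter m (fun s => 0 :: map S s) [::] = iota 0 m.
  by elim: m => //= m ->; rewrite (iotaDl 1 0).
apply: (ptime_ext (fun e => iE (n e))).
apply: (ptime_iter (x := fun _ => [::]) (f := fun _ s => 0 :: map S s)) => //; ptime.
  have : pbounded (fun q : E * nat => 2 * (code_size q * code_size q) + 1).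
    by solve_pbounded.
  apply: pbounded_le => q; rewrite iE code_size_seq addn1 ltnS.
  have : code_size q.2 <= code_size q by rewrite code_size_pair; lia.
  rewrite code_size_nat; move: (code_size q) => N qN.
  apply: (@leq_trans (\sum_(i <- iota 0 q.2) N)).
    rewrite big_seq [leqRHS]big_seq leq_sum // => i; rewrite mem_iota code_size_nat.
    lia.
  rewrite big_const_seq count_predT size_iota iter_addn_0; nia.
by apply: ptime_map; ptime.
Qed.

End ListAccess.

Section ListMembership.
Context {E : Type} {A : eqType} {eE : encodable E} {eA : encodable A}.

Lemma ptime_mem (x : E -> A) (s : E -> seq A) :
  ptime x -> ptime s -> ptime (fun e => x e \in s e).
Proof.
move=> Px Ps.
have mE a (t : seq A) : has (fun b => a == b) t = (a \in t).
  by elim: t => //= b t ->; rewrite inE.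
apply: (ptime_ext (fun e => mE (x e) (s e))).
by apply ptime_has; ptime.
Qed.

End ListMembership.

Section ListUndup.
Context {E : Type} {A : eqType} {eE : encodable E} {eA : encodable A}.

Lemma ptime_undup (s : E -> seq A) : ptime s -> ptime (fun e => undup (s e)).
Proof.
move=> Ps.
have uE (t : seq A) : foldr (fun a r => if a \in r then r else a :: r) [::] t = undup t.
  by elim: t => //= a t ->; rewrite mem_undup.
apply: (ptime_ext (fun e => uE (s e))).
apply: (ptime_foldr (z := fun _ => [::])
  (g := fun _ a r => if a \in r then r else a :: r)) => //; ptime.
  apply: pbounded_le pbounded_size => q; rewrite uE code_size_pair.
  by rewrite leqW // (leq_trans _ (leq_addl _ _)) // code_size_sub // undup_subseq.
by apply: ptime_mem; ptime.
Qed.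

End ListUndup.

Ltac ptime_lib ::=
  lazymatch goal with
  | |- ptime (fun e => has _ _) => apply ptime_has
  | |- ptime (fun e => all _ _) => apply ptime_all
  | |- ptime (fun e => filter _ _) => apply ptime_filter
  | |- ptime (fun e => map _ _) => apply ptime_map
  | |- ptime (fun e => _ ++ _) => apply ptime_cat
  | |- ptime (fun e => rev _) => apply ptime_rev
  | |- ptime (fun e => flatten _) => apply ptime_flatten
  | |- ptime (fun e => size _) => apply ptime_length
  | |- ptime (fun e => drop _ _) => apply ptime_drop
  | |- ptime (fun e => take _ _) => apply ptime_take
  | |- ptime (fun e => nth _ _ _) => apply ptime_nth
  | |- ptime (fun e => iota 0 _) => apply ptime_iota0
  | |- ptime (fun e => _ - _) => apply ptime_subn
  | |- ptime (fun e => _ <= _) => apply ptime_leq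
  | |- ptime (fun e => _ \in _) => apply ptime_mem
  | |- ptime (fun e => undup _) => apply ptime_undup
  end.

(** * Words and derivations *)

Section Seqs.
Context {A : eqType}.
Implicit Types (s t u : seq A).

Definition infixes {T : Type} (s : seq T) : seq (seq T) :=
  flatten [seq [seq take j (drop i s) | j <- iota 0 (size s).+1] | i <- iota 0 (size s).+1].

Definition splits {T : Type} (s : seq T) : seq (seq T * seq T) :=
  [seq (take i s, drop i s) | i <- iota 0 (size s).+1].

Lemma mem_infixes s u : (u \in infixes s) = infix u s.
Proof.
apply/flatten_mapP/infixP => [[i _ /mapP[j _ ->]]|[l [r ->]]].
  exists (take i s), (drop j (drop i s)).
  by rewrite !cat_take_drop.
exists (size l); first by rewrite mem_iota !size_cat; lia.
apply/mapP; exists (size u); first by rewrite mem_iota !size_cat; lia.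
by rewrite drop_size_cat // take_size_cat.
Qed.

Lemma mem_splits s p : (p \in splits s) = (p.1 ++ p.2 == s).
Proof.
apply/mapP/eqP => [[i _ ->] /=|<-]; first exact: cat_take_drop.
exists (size p.1); first by rewrite mem_iota size_cat; lia.
by rewrite take_size_cat // drop_size_cat //; case: p.
Qed.

End Seqs.

Section PtimeSeqs.
Context {E A B : Type} {eE : encodable E} {eA : encodable A} {eB : encodable B}.

Lemma ptime_infixes (s : E -> seq A) : ptime s -> ptime (fun e => infixes (s e)).
Proof.
have P : ptime (fun s : seq A => infixes s).
by rewrite /infixes; ptime.
by move=> Ps; apply: (ptime_comp P Ps).
Qed.

Lemma ptime_splits (s : E -> seq A) : ptime s -> ptime (fun e => splits (s e)).
Proof.
have P : ptime (fun s : seq A => splits s) by rewrite /splits; ptime.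
by move=> Ps; apply: (ptime_comp P Ps).
Qed.

Lemma ptime_zip (s : E -> seq A) (t : E -> seq B) :
  ptime s -> ptime t -> ptime (fun e => zip (s e) (t e)).
Proof.
(* A fold consumes one list only, so the pairs are collected by index; [take 1 (drop i _)] holds the
   entry at [i] or nothing, which avoids default values. *)
pose F (s : seq A) (t : seq B) i := flatten [seq [seq (a, b) | b <- take 1 (drop i t)] |
   a <- take 1 (drop i s)].
have zipE s' t' : flatten [seq F s' t' i | i <- iota 0 (size s')] = zip s' t'.
  elim: s' t' => [|a s' IH] [|b t'] //=.
    have F0 i : F (a :: s') [::] i = [::] by rewrite /F /=; elim: (take _ _).
    rewrite F0 /=; by elim: (iota 1 _) => //= i r ->; rewrite F0.
  by rewrite /F /= !take0 /= (iotaDl 1 0) -map_comp; congr cons; apply: IH.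
move=> Ps Pt; apply: (ptime_ext (fun e => zipE (s e) (t e))).
apply: (ptime_comp2 (F := fun s t => flatten [seq F s t i | i <- iota 0 (size s)])) => //.
by rewrite /F; ptime.
Qed.

End PtimeSeqs.

Section PtimeFinite.
Context {A : eqType} {B : Type} {eA : encodable A} {eB : encodable B}.

(** A finite function is a table searched by successive equality tests. The end of the table needs
    some value of [f]; if there is no argument, any program will do. *)
Lemma ptime_finite (s : seq A) (f : A -> B) : (forall a, a \in s) -> ptime f.
Proof.
move=> sA; have [g Pg fg] : exists2 g, ptime g & {in s, g =1 f}.
  elim: {sA} s => [|x s [g Pg fg]].
    have [[a _]|nA] := pselect (exists a : A, True).
      by exists (fun _ => f a) => //; apply ptime_cst.
    exists f => //; exists (fun=> 0); first by apply pbounded_cst.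
    by move=> n; exists [::], LeafE => pre suf env a; case: nA; exists a.
  exists (fun a => if a == x then f x else g a); first by ptime.
  by move=> a; rewrite inE; case: eqP => [->|_ /fg].
by apply: ptime_ext Pg => a; apply: fg.
Qed.

End PtimeFinite.

(** * The shortlex order *)

Section Shortlex.
Context {disp : Order.disp_t} {Sigma : finOrderType disp}.
Implicit Types (u v w : seq Sigma).

Lemma enc_letter_inj : injective (@enc_letter _ Sigma).
Proof. by move=> a b /enc_nat_inj/val_inj/enum_rank_inj. Qed.

(** The low priority leaves types with an encoding of their own, such as booleans, to that
    encoding. *)
#[export] Instance encodable_letter : encodable Sigma | 100 := Encodable enc_letter_inj.

Lemma shortlex_le_total : total (@shortlex_le _ Sigma).
Proof.
move=> u v; rewrite /shortlex_le [size v == _]eq_sym.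
by case: ltngtP => //= _; apply: le_total.
Qed.

Lemma shortlex_le_refl : reflexive (@shortlex_le _ Sigma).
Proof. by move=> u; have := shortlex_le_total u u; rewrite orbb. Qed.

Lemma shortlex_le_trans : transitive (@shortlex_le _ Sigma).
Proof.
move=> v u w; rewrite /shortlex_le => /orP[uv|/andP[/eqP uv le_uv]] /orP[vw|/andP[/eqP vw le_vw]].
- by rewrite (ltn_trans uv vw).
- by rewrite -vw uv.
- by rewrite uv vw.
- by rewrite uv vw eqxx (le_trans le_uv le_vw) orbT.
Qed.

Lemma shortlex_le_anti : antisymmetric (@shortlex_le _ Sigma).
Proof.
move=> u v; rewrite /shortlex_le [size v == _]eq_sym.
by case: ltngtP => //= _; apply: le_anti.
Qed.

Lemma shortlex_le_size u v : shortlex_le u v -> size u <= size v.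
Proof. by case/orP => [/ltnW//|/andP[/eqP ->]]. Qed.

Lemma nameP (X : set (seq Sigma)) u : shortlex_least X u -> name X = u.
Proof.
move=> [Xu u_le]; rewrite /name; case: xgetP => [v _ [Xv v_le]|/(_ u)[]] //.
by apply: shortlex_le_anti; rewrite v_le ?u_le.
Qed.

Lemma ptime_shortlex_le {E : Type} {eE : encodable E} (u v : E -> seq Sigma) :
  ptime u -> ptime v -> ptime (fun e => shortlex_le (u e) (v e)).
Proof.
(* On words of equal length the lexicographic order is a fold over the paired letters, and the
   length test ensures that it matters only there. *)
pose lexi u v := foldr (fun (p : Sigma * Sigma) (b : bool) =>
  (p.1 < p.2)%O || (p.1 == p.2) && b) true (zip u v).
have lexiE u' v' : size u' = size v' -> lexi u' v' = ((u' : seqlexi Sigma) <= v')%O.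
  elim: u' v' => [|a u' IH] [|b v'] //= [/IH]; rewrite lexi_cons /lexi /= => ->.
  by case: ltgtP.
have sE e : (size (u e) < size (v e)) || (size (u e) == size (v e)) && lexi (u e) (v e)
    = shortlex_le (u e) (v e).
  by rewrite /shortlex_le; case: eqP => // /lexiE ->.
move=> Pu Pv; apply: (ptime_ext sE); ptime.
apply: (ptime_foldr_bool (z := fun=> true)
  (g := fun _ (p : Sigma * Sigma) b => (p.1 < p.2)%O || (p.1 == p.2) && b)); ptime.
  apply: (ptime_comp2 (F := fun a b : Sigma => (a < b)%O)); ptime.
  by apply: (ptime_finite (s := enum {: Sigma * Sigma})) => p; rewrite mem_enum.
exact: ptime_zip.
Qed.

(** The order is total, transitive and antisymmetric, so a sorted list is determined by its
    multiset. Insertion sort, being a fold, thus computes the same list as [sort]. *)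
Lemma ptime_sort_shortlex {E : Type} {eE : encodable E} (s : E -> seq (seq Sigma)) :
  ptime s -> ptime (fun e => sort shortlex_le (s e)).
Proof.
pose insert u t := [seq v <- t | shortlex_le v u] ++ u :: [seq v <- t | ~~ shortlex_le v u].
have perm_insert u t : perm_eq (insert u t) (u :: t).
  by rewrite /insert -cat1s perm_catCA /= perm_cons (perm_filterC (fun v => shortlex_le v u)).
have sorted_insert u t : pairwise shortlex_le t -> pairwise shortlex_le (insert u t).
  move=> pt; rewrite pairwise_cat pairwise_cons !pairwise_filter // !andbT.
  apply/andP; split.
    apply/allrelP => v w; rewrite mem_filter inE => /andP[vu _] /predU1P[->//|].
    rewrite mem_filter => /andP[wu _]; apply: (shortlex_le_trans vu).
    by have := shortlex_le_total u w; rewrite (negbTE wu) orbF.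
  apply/allP => w; rewrite mem_filter => /andP[wu _].
  by have := shortlex_le_total u w; rewrite (negbTE wu) orbF.
have sortE t : foldr insert [::] t = sort shortlex_le t.
  apply: (sorted_eq shortlex_le_trans shortlex_le_anti).
  - rewrite (sorted_pairwise shortlex_le_trans); elim: t => //= u t; exact: sorted_insert.
  - exact: (sort_sorted shortlex_le_total).
  - rewrite perm_sym perm_sort perm_sym; elim: t => //= u t IH.
    by apply: (perm_trans (perm_insert _ _)); rewrite perm_cons.
move=> Ps; apply: (ptime_ext (fun e => sortE (s e))).
apply: (ptime_foldr (z := fun=> [::]) (g := fun=> insert)) => //; ptime.
  apply: pbounded_le pbounded_size => q; rewrite sortE code_size_pair.
  rewrite leqW // (leq_trans _ (leq_addl _ _)) // !code_size_seq.
  by rewrite (perm_big q.2) // perm_sort.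
by rewrite /insert; ptime; apply ptime_shortlex_le; ptime.
Qed.

End Shortlex.

Ltac ptime_words ::=
  lazymatch goal with
  | |- ptime (fun e => infixes _) => apply ptime_infixes
  | |- ptime (fun e => splits _) => apply ptime_splits
  | |- ptime (fun e => zip _ _) => apply ptime_zip
  | |- ptime (fun e => sort shortlex_le _) => apply ptime_sort_shortlex
  end.

(* Keeps [simpl] from enumerating these lists. *)
Opaque infixes splits.

Section ShortlexLeast.
Context {disp : Order.disp_t} {Sigma : finOrderType disp}.

(** Only finitely many words share the minimal length in [X]; sorting them yields the least one. *)
Lemma name_least (X : set (seq Sigma)) u : X u -> shortlex_least X (name X).
Proof.
have [n] := ubnP (size u); elim: n u => // n IH u; rewrite ltnS => un Xu.
have [[v [Xv vu]]|nlt] := pselect (exists v, X v /\ size v < size u).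
  by apply: (IH v) => //; apply: leq_trans un.
pose vs := sort shortlex_le
  [seq tval t | t <- [seq t <- enum {: (size u).-tuple Sigma} | `[< X (tval t) >]]].
have mem_vs v : (v \in vs) = (size v == size u) && `[< X v >].
  rewrite mem_sort; apply/mapP/andP => [[t]|[/eqP sv Xv]].
    by rewrite mem_filter => /andP[Xt _] ->; rewrite size_tuple eqxx.
  by exists (tcast sv (in_tuple v)); [rewrite mem_filter mem_enum val_tcast Xv|rewrite val_tcast].
have : u \in vs by rewrite mem_vs eqxx; apply/asboolP.
have : sorted shortlex_le vs := sort_sorted (@shortlex_le_total _ Sigma) _.
case E: vs => [|v s] //= vs_sorted _.
have /andP[/eqP sv /asboolP Xv] : (size v == size u) && `[< X v >].
  by rewrite -mem_vs E mem_head.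
have least_v : shortlex_least X v.
  split=> // w Xw; have [wu|uw] := leqP (size w) (size u); last first.
    by rewrite /shortlex_le sv uw.
  have : w \in vs.
    rewrite mem_vs; apply/andP; split; last exact/asboolP.
    rewrite eqn_leq wu leqNgt; apply/negP => uw; apply: nlt; by exists w.
  rewrite E inE => /predU1P[->|ws]; first exact: shortlex_le_refl.
  by have /allP := order_path_min (@shortlex_le_trans _ _) vs_sorted; apply.
by rewrite (nameP least_v).
Qed.

End ShortlexLeast.

Section Derivations.
Context {disp : Order.disp_t} {Sigma : finOrderType disp}.
Implicit Types (R : set (rule Sigma)) (s t : seq (symbol Sigma)).

Lemma derives_trans R s t u : derives R s t -> derives R t u -> derives R s u.
Proof. by move=> st tu; elim: tu st => // t' l n a r _ IH Ra /IH su; apply: derives_step Ra. Qed.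

Lemma derives_cat R l s t r : derives R s t -> derives R (l ++ s ++ r) (l ++ t ++ r).
Proof.
elim=> [u|u l' n a r' _ IH Ra]; first exact: derives_refl.
have -> : l ++ (l' ++ a ++ r') ++ r = (l ++ l') ++ a ++ (r' ++ r) by rewrite !catA.
by apply: derives_step Ra; rewrite -!catA cat_cons -?catA in IH *.
Qed.

Lemma derives_rule R n a : R (n, a) -> derives R [:: inl n] a.
Proof.
move=> Ra; have := @derives_step _ _ R [:: inl n] [::] n a [::].
by rewrite cats0; apply => //; apply: derives_refl.
Qed.

Lemma derives_cat2 R s t s' t' :
  derives R s t -> derives R s' t' -> derives R (s ++ s') (t ++ t').
Proof.
move=> /(derives_cat [::] s') st /(derives_cat t [::]).
by rewrite !cats0; apply: derives_trans.
Qed.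

End Derivations.

(** * Parse trees of $W$ *)

Section WGrammar.
Context {disp : Order.disp_t} {Sigma : finOrderType disp} {M : monoidType}.
Variables (h : seq Sigma -> M) (D : {fset (seq Sigma)}).
Implicit Types (u v w x y : seq Sigma) (s t : seq (symbol Sigma)).

(** Parse trees below $\langle u\rangle$: they allow induction on subtrees, which the step-by-step
    relation [derives] does not. *)
Inductive yields : seq Sigma -> seq Sigma -> Prop :=
| yields_letter a : observed D [:: a] -> yields [:: a] [:: a]
| yields_cut u v x y : observed D u -> observed D v -> observed D (u ++ v) ->
    yields u x -> yields v y -> yields (u ++ v) (x ++ y)
| yields_unary u v x : observed D u -> observed D v -> h u = h v ->
    (exists l r, l ++ u ++ r \in D /\ l ++ v ++ r \in D) ->
    yields v x -> yields u x.

Lemma yields_observed u x : yields u x -> observed D u.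
Proof. by case. Qed.

(** Parse forests over a sentential form; a step of [derives], read backwards, grafts one tree at
    the rewritten symbol. *)
Fixpoint spells s w : Prop :=
  match s with
  | [::] => w = [::]
  | inr a :: s' => exists w', w = a :: w' /\ spells s' w'
  | inl n :: s' => exists x y, [/\ w = x ++ y,
      (if n is Some u then yields u x else exists2 d, d \in D & yields d x) &
      spells s' y]
  end.

Lemma spells_cat s t w :
  spells (s ++ t) w <-> exists x y, [/\ w = x ++ y, spells s x & spells t y].
Proof.
elim: s w => [|[n|a] s IH] w /=.
- split=> [tw|[x [y [-> -> //]]]]; by exists [::], w.
- split=> [[x [y [-> nx /IH[y1 [y2 [-> sy ty]]]]]]|[x [y [-> [x1 [x2 [-> nx sx]]] ty]]]].
    by exists (x ++ y1), y2; rewrite catA; split=> //; exists x, y1.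
  exists x1, (x2 ++ y); rewrite catA; split=> //.
  by apply/IH; exists x2, y.
- split=> [[w' [-> /IH[y1 [y2 [-> sy ty]]]]]|[x [y [-> [x' [-> sx]] ty]]]].
    by exists (a :: y1), y2; split=> //; exists y1.
  by exists (x' ++ y); split=> //; apply/IH; exists x', y.
Qed.

Lemma spells_derives s t w : derives (W_rule h D) s t -> spells t w -> spells s w.
Proof.
move=> st; elim: st w => // t' l n a r _ IH Wa w /spells_cat[x [y [-> lx]]].
move=> /spells_cat[y1 [y2 [-> ay ry]]]; apply: IH; apply/spells_cat.
exists x, (y1 ++ y2); split=> //=; exists y1, y2; split=> //.
inversion Wa as [d dD|u v ou ov ouv|b ob|u v ou ov hu luv]; subst => /=.
- by case: ay => /= x1 [x2 [-> dx ->]]; exists d; rewrite ?cats0.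
- case: ay => x1 [z [-> ux]] [x2 [e [-> vx ->]]]; rewrite cats0.
  exact: yields_cut.
- by case: ay => z [-> ->]; apply: yields_letter.
- case: ay => x1 [z [-> vx ->]]; rewrite cats0.
  exact: yields_unary luv vx.
Qed.

Lemma yields_derives u x : yields u x -> derives (W_rule h D) [:: NT u] (map T x).
Proof.
elim=> {u x} [a oa|u v x y ou ov ouv _ ux _ vy|u v x ou ov hu luv _ vx].
- by apply: derives_rule; apply: W_lexical.
- apply: (derives_trans (t := [:: NT u] ++ [:: NT v])).
    by apply: derives_rule; apply: W_cut.
  by rewrite map_cat; apply: derives_cat2.
- by apply: derives_trans vx; apply: derives_rule; apply: W_unary.
Qed.

Lemma generated_W w : generated (W h D) w <-> exists2 d, d \in D & yields d w.
Proof.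
split=> [/spells_derives wW|[d dD /yields_derives dw]].
  have : spells (map T w) w by elim: w {wW} => //= a w IH; exists w.
  by move=> /wW[x [y [-> dx ->]]]; rewrite cats0.
by apply: derives_trans dw; apply: derives_rule; apply: W_start.
Qed.

End WGrammar.

(** * The learner as a program *)

(* The iterates grow, and a strict growth at every round would exceed [size C]. *)
Lemma iter_filter_fixpoint (T : eqType) (C : seq T) (f : seq T -> pred T) :
  (forall F G : seq T, {subset F <= G} -> subpred (f F) (f G)) ->
  let F := iter (size C).+1 (fun F => [seq c <- C | f F c]) [::] in
  [seq c <- C | f F c] = F.
Proof.
move=> f_mono; pose F k := iter k (fun F => [seq c <- C | f F c]) [::].
have F_sub k : subseq (F k) (F k.+1).
  have f_sub i : {subset F i <= F i.+1}.
    elim: i => // i IH c; rewrite /= !mem_filter => /andP[fc ->].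
    by rewrite (f_mono _ _ IH).
  case: k => [|k]; first exact: sub0seq.
  have -> : F k.+1 = [seq c <- F k.+2 | f (F k) c].
    rewrite /= -filter_predI; apply: eq_filter => c /=.
    by case fc: (f _ c) => //=; rewrite (f_mono _ _ (f_sub k)).
  exact: filter_subseq.
have [k kC Fk] : exists2 k, k <= size C & F k.+1 = F k.
  have [[k [kC /eqP]]|noF] := pselect (exists k, k <= size C /\ F k == F k.+1).
    by exists k.
  have F_size k : k <= (size C).+1 -> k <= size (F k).
    elim: k => // k IH kC; apply: leq_ltn_trans (IH (ltnW kC)) _.
    have [le eq] := size_subseq_leqif (F_sub k).
    rewrite ltn_neqAle le andbT eq; apply/negP => Fk; case: noF; by exists k.
  have := F_size _ (leqnn _); rewrite leqNgt ltnS.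
  by rewrite (size_subseq (filter_subseq _ _)).
have F_stable n : F (n + k) = F k by elim: n => //= n IH; rewrite -/(F _) IH.
have -> : iter (size C).+1 (fun F => [seq c <- C | f F c]) [::] = F k.
  by rewrite -/(F _) -(subnK (leqW kC)) F_stable.
exact: Fk.
Qed.

Section Program.
Context {disp : Order.disp_t} {Sigma : finOrderType disp} {M : monoidType}.
Variable h : seq Sigma -> M.
Implicit Types (ds : seq (seq Sigma)) (u v w x y z : seq Sigma).

(** Sorting makes the head of any filtered sublist its shortlex-least member; [rep] relies on it. *)
Definition substrings ds : seq (seq Sigma) :=
  sort shortlex_le (undup [seq u <- flatten [seq infixes w | w <- ds] | ~~ nilp u]).

Definition contexts_in ds u : seq (seq Sigma * seq Sigma) :=
  flatten [seq flatten [seq [seq (p.1, q.2) | q <- splits p.2 & q.1 == u]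
                       | p <- splits w] | w <- ds].

Definition first_context ds u : seq Sigma * seq Sigma :=
  head ([::], [::]) (contexts_in ds u).

Definition unary ds u v : bool :=
  (h u == h v) && has (fun c => c.1 ++ v ++ c.2 \in ds) (contexts_in ds u).

(** One application of the constructors of [yields] to the facts in [F]. That [c.1] is observed
    comes from filtering [candidates]. *)
Definition fact_step ds (F : seq (seq Sigma * seq Sigma)) c : bool :=
  [|| (size c.1 == 1) && (c.2 == c.1),
      has (fun v => unary ds c.1 v && ((v, c.2) \in F)) (substrings ds) |
      has (fun p => [&& ~~ nilp p.1, ~~ nilp p.2 &
        has (fun q => ((p.1, q.1) \in F) && ((p.2, q.2) \in F)) (splits c.2)])
        (splits c.1)].

Definition candidates ds w : seq (seq Sigma * seq Sigma) :=
  flatten [seq [seq (u, x) | x <- infixes w] | u <- substrings ds].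

Definition facts ds w : seq (seq Sigma * seq Sigma) :=
  iter (size (candidates ds w)).+1
    (fun F => [seq c <- candidates ds w | fact_step ds F c]) [::].

Definition in_W ds w : bool := has (fun d : seq Sigma => (d, w) \in facts ds w) ds.

Definition acceptsb ds x z : bool :=
  in_W ds ((first_context ds x).1 ++ z ++ (first_context ds x).2).

Definition same_class ds u v : bool :=
  (h v == h u) &&
  all (fun x => acceptsb ds x v == acceptsb ds x u) (substrings ds).

Definition class_members ds u : seq (seq Sigma) :=
  [seq v <- substrings ds | same_class ds u v].

Definition rep ds u : seq Sigma := head [::] (class_members ds u).

Definition class_testb ds z u : bool :=
  (h z == h (rep ds u)) && acceptsb ds (rep ds u) z.

Definition primeb ds u : bool :=
  all (fun p => [|| nilp p.1, nilp p.2 |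
         has (fun x => ~~ has (fun q => class_testb ds q.1 p.1 && class_testb ds q.2 p.2)
                              (splits x)) (class_members ds u)])
      (splits (rep ds u)).

Definition edgeb ds w i j : bool :=
  [&& i < j, j <= size w & primeb ds (segment w i j)].

Definition shorter (p q : seq nat) : seq nat := if size p <= size q then p else q.

Definition shortest (ps : seq (seq nat)) : seq nat := foldr shorter (head [::] ps) ps.

(* [T] lists a shortest path to the end from each of the vertices after [i]. *)
Definition best_path ds w i (T : seq (seq nat)) : seq nat :=
  shortest [seq j :: nth [::] T (j - i.+1) | j <- [seq j <- iota 0 (size w).+1 | edgeb ds w i j]].

Definition path_table ds w : seq (seq nat) :=
  foldr (fun i T => best_path ds w i T :: T) [:: [::]] (iota 0 (size w)).

Definition shortest_path ds w : seq nat := head [::] (path_table ds w).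

Definition factor_words ds u : seq (seq Sigma) :=
  pairmap (segment (rep ds u)) 0 (shortest_path ds (rep ds u)).

Definition primes_list ds : seq (seq Sigma) :=
  [seq u <- substrings ds | (rep ds u == u) && primeb ds u].

Definition keptb ds N (g : seq (seq Sigma)) : bool :=
  class_testb ds (flatten g) N &&
  all (fun b => [|| size b < 2, size g <= size b |
         all (fun P => ~~ class_testb ds (flatten b) P) (primes_list ds)]) (infixes g).

Definition rhs ds u : seq (seq Sigma) := [seq rep ds v | v <- factor_words ds u].

Definition nts (us : seq (seq Sigma)) : seq (option (seq Sigma) + Sigma) :=
  [seq inl (Some u) | u <- us].

Definition productions_list ds : seq (option (seq Sigma) * seq (option (seq Sigma) + Sigma)) :=
  flatten [seq flatten [seq [seq (Some N, nts (A :: rhs ds Q)) |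
      Q <- substrings ds & keptb ds N (A :: rhs ds Q)]
    | A <- primes_list ds] | N <- primes_list ds].

(** Mapping over the letters of a one-letter word extracts its letter without a default, which an
    empty alphabet could not supply. *)
Definition lexical_list ds : seq (option (seq Sigma) * seq (option (seq Sigma) + Sigma)) :=
  flatten [seq [seq (Some (rep ds u), [:: inr a]) | a <- u]
    | u <- substrings ds & (size u == 1) && primeb ds u].

Definition start_list ds : seq (option (seq Sigma) * seq (option (seq Sigma) + Sigma)) :=
  [seq (None, nts (rhs ds w)) | w <- ds].

Definition learner ds :
    seq (option (seq Sigma)) * seq (option (seq Sigma) * seq (option (seq Sigma) + Sigma)) :=
  (None :: [seq Some u | u <- primes_list ds],
   undup (productions_list ds ++ lexical_list ds ++ start_list ds)).

(* Sorting makes the choices independent of the order of presentation. *)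
Definition canonical_selector : @selector disp Sigma :=
  Selector (fun D => first_context (sort shortlex_le D))
           (fun D => shortest_path (sort shortlex_le D)).

End Program.

Lemma block_map (A B : Type) (f : A -> B) b s : block b (map f s) ->
  exists2 b', b = map f b' & block b' s.
Proof.
move=> [l [r sE]]; exists (take (size b) (drop (size l) s)).
  by rewrite map_take map_drop sE drop_size_cat // take_size_cat.
exists (take (size l) s), (drop (size b) (drop (size l) s)).
by rewrite !cat_take_drop.
Qed.

Lemma map_block (A B : Type) (f : A -> B) b s : block b s -> block (map f b) (map f s).
Proof. by move=> [l [r ->]]; exists (map f l), (map f r); rewrite !map_cat. Qed.

(** * Correctness of the program *)

Section ObservedClasses.
Context {disp : Order.disp_t} {Sigma : finOrderType disp} {M : monoidType}.
Variables (h : seq Sigma -> M) (sel : @selector disp Sigma) (D : {fset (seq Sigma)}).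
Implicit Types (u v w x y z : seq Sigma).

Lemma observed_infix u v : observed D v -> infix u v -> u <> [::] -> observed D u.
Proof.
move=> [_ [w wD vw]] uv u0; split=> //; exists w => //; exact: infix_trans uv vw.
Qed.

Lemma observed_catl u v : observed D (u ++ v) -> u <> [::] -> observed D u.
Proof. move=> o; apply: observed_infix o _; exact: prefix_infix. Qed.

Lemma observed_catr u v : observed D (u ++ v) -> v <> [::] -> observed D v.
Proof. move=> o; apply: observed_infix o _; exact: suffix_infix. Qed.

Lemma segment_infix w i j : infix (segment w i j) w.
Proof. exact: infix_trans (prefixW (prefix_take _ _)) (suffixW (suffix_drop _ _)). Qed.

Lemma size_segment w i j : j <= size w -> size (segment w i j) = j - i.
Proof. by move=> jw; rewrite size_take size_drop; case: ltnP; lia. Qed.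

Lemma observed_segment w i j : observed D w -> i < j -> j <= size w ->
  observed D (segment w i j).
Proof.
move=> ow ij jw; apply: observed_infix ow (segment_infix w i j) _ => s0.
have := size_segment i jw; rewrite s0 /=; lia.
Qed.

Lemma oclass_refl u : observed D u -> oclass h sel D u u.
Proof. by []. Qed.

Lemma oclass_eq u v : oclass h sel D u v -> oclass h sel D v = oclass h sel D u.
Proof.
move=> [_ hvu acc_vu]; apply/predeqP => x; split=> -[ox hx acc_x]; split=> //.
- by rewrite hx.
- by move=> y oy; rewrite (acc_x y oy) (acc_vu y oy).
- by rewrite hx hvu.
- by move=> y oy; rewrite (acc_x y oy) (acc_vu y oy).
Qed.

Lemma is_oclass_eq X u : is_oclass h sel D X -> X u -> X = oclass h sel D u.
Proof. by move=> [v ov ->] /oclass_eq. Qed.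

Lemma is_oclass_oclass u : observed D u -> is_oclass h sel D (oclass h sel D u).
Proof. by exists u. Qed.

End ObservedClasses.

Section ProgramSpec.
Context {disp : Order.disp_t} {Sigma : finOrderType disp} {M : monoidType}.
Variables (h : seq Sigma -> M).
Variables (D : {fset (seq Sigma)}).
Let ds := sort shortlex_le D.
Let sel := canonical_selector h.
Implicit Types (u v w x y z : seq Sigma).

Let oclass := oclass h sel D.

Lemma mem_ds w : (w \in ds) = (w \in D).
Proof. by rewrite mem_sort. Qed.

Lemma mem_substrings u : u \in substrings ds <-> observed D u.
Proof.
rewrite mem_sort mem_undup mem_filter; split.
  case/andP => /nilP u0 /flatten_mapP[w]; rewrite mem_ds mem_infixes => wD uw.
  by split=> //; exists w.
move=> [/nilP -> [w wD uw]] /=; apply/flatten_mapP; exists w; rewrite ?mem_ds //.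
by rewrite mem_infixes.
Qed.

Lemma mem_contexts_in u l r : ((l, r) \in contexts_in ds u) = (l ++ u ++ r \in D).
Proof.
apply/flatten_mapP/idP => [[w]|lur].
  rewrite mem_ds => wD /flatten_mapP[p]; rewrite mem_splits => /eqP pw.
  move=> /mapP[q]; rewrite mem_filter mem_splits => /andP[/eqP qu /eqP qp] [-> ->].
  by rewrite -qu qp pw.
exists (l ++ u ++ r); first by rewrite mem_ds.
apply/flatten_mapP; exists (l, u ++ r); first by rewrite mem_splits.
by apply/mapP; exists (u, r) => //; rewrite mem_filter mem_splits /= !eqxx.
Qed.

Lemma unaryP u v :
  unary h ds u v <-> h u = h v /\ exists l r, l ++ u ++ r \in D /\ l ++ v ++ r \in D.
Proof.
rewrite /unary; split.
  case/andP => /eqP -> /hasP[[l r]]; rewrite mem_contexts_in mem_ds /= => lur lvr.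
  by split=> //; exists l, r.
move=> [-> [l [r [lur lvr]]]]; rewrite eqxx; apply/hasP; exists (l, r).
  by rewrite mem_contexts_in.
by rewrite mem_ds.
Qed.

Lemma mem_candidates w c : c \in candidates ds w <-> observed D c.1 /\ infix c.2 w.
Proof.
split=> [/flatten_mapP[u /mem_substrings ou /mapP[x]]|[o i]].
  by rewrite mem_infixes => xw ->.
apply/flatten_mapP; exists c.1; first exact/mem_substrings.
by apply/mapP; exists c.2; rewrite ?mem_infixes //; case: (c).
Qed.

(** Restricting to substrings of [w] loses nothing: in a parse tree of a substring, every subtree
    again yields a substring. A set of facts closed under the rules therefore contains the whole
    tree. *)
Lemma factsP w u x : (u, x) \in facts h ds w <-> yields h D u x /\ infix x w.
Proof.
split.
  rewrite /facts; elim: _.+1 u x => // k IH u x; rewrite /= mem_filter.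
  move=> /andP[step /mem_candidates[/= ou xw]]; split=> //.
  case/or3P: step => [/andP[/eqP u1 /eqP /= ->]|/hasP[v /mem_substrings ov]|/hasP[p]].
  - by case: u ou u1 => [|a []] //= oa _; apply: yields_letter.
  - move=> /andP[/unaryP[huv luv] /IH[vx _]]; exact: yields_unary luv vx.
  - rewrite mem_splits => /eqP pu.
    case/and3P => /nilP p10 /nilP p20 /hasP[q].
    rewrite mem_splits => /eqP qx /andP[/IH[y1 _] /IH[y2 _]].
    rewrite -(pu : _ = u) -(qx : _ = x).
    by apply: yields_cut (yields_observed y1) (yields_observed y2) _ y1 y2; rewrite pu.
move=> [ux xw].
have closed c : fact_step h ds (facts h ds w) c -> c \in candidates ds w ->
    c \in facts h ds w.
  move=> step cC; rewrite /facts -[X in _ \in X]iter_filter_fixpoint.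
    by rewrite mem_filter step cC.
  move=> F G FG c' /or3P[s|/hasP[v ov]|/hasP[p pc /and3P[p1 p2 /hasP[q qc]]]].
  - by rewrite /fact_step s.
  - move=> /andP[uv /FG vF]; apply/or3P/Or32; apply/hasP; exists v => //.
    by rewrite uv.
  - move=> /andP[/FG F1 /FG F2]; apply/or3P/Or33; apply/hasP; exists p => //.
    rewrite p1 p2; apply/hasP; exists q => //; by rewrite F1.
have cand u' x' : yields h D u' x' -> infix x' w -> (u', x') \in candidates ds w.
  by move=> /yields_observed o i; apply/mem_candidates.
elim: {u x} ux xw => [a oa|u v x y ou ov ouv ux IHu vy IHv|u v x ou ov hu luv vx IH] xw.
- apply: closed; last exact: cand (yields_letter _ _) _.
  by rewrite /fact_step /= eqxx.
- have xw' := catr_infix xw; have yw' := catl_infix xw.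
  apply: closed; last exact: cand (yields_cut _ _ _ _ _) xw.
  apply/or3P/Or33/hasP; exists (u, v); first by rewrite mem_splits.
  have [/nilP -> _] := ou; have [/nilP -> _] := ov; apply/hasP.
  by exists (x, y); rewrite ?mem_splits //= IHu ?IHv.
- apply: closed; last exact: cand (yields_unary _ _ hu luv vx) xw.
  apply/or3P/Or32/hasP; exists v; first exact/mem_substrings.
  by rewrite IH // andbT; apply/unaryP.
Qed.

Lemma in_WP w : in_W h ds w <-> generated (W h D) w.
Proof.
rewrite generated_W; split=> [/hasP[d]|[d dD dw]].
  by rewrite mem_ds => dD /factsP[dw _]; exists d.
by apply/hasP; exists d; rewrite ?mem_ds //; apply/factsP; split=> //; apply: infix_refl.
Qed.

Lemma acceptsbP x z : acceptsb h ds x z <-> accepts h sel D x z.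
Proof. exact: in_WP. Qed.

Lemma mem_class_members u v : v \in class_members h ds u <-> oclass u v.
Proof.
rewrite mem_filter; split.
  case/andP => /andP[/eqP hvu /allP acc] /mem_substrings ov; split=> // x /mem_substrings ox.
  by rewrite -!acceptsbP (eqP (acc x ox)).
move=> [/mem_substrings -> hvu acc]; rewrite /same_class hvu eqxx andbT /=.
apply/allP => x /mem_substrings/acc; rewrite -!acceptsbP => a.
by apply/eqP; apply/idP/idP => /a.
Qed.

Lemma rep_least u : observed D u -> shortlex_least (oclass u) (rep h ds u).
Proof.
move=> ou; have: u \in class_members h ds u by apply/mem_class_members; apply: oclass_refl.
have: sorted shortlex_le (class_members h ds u).
  by apply: sorted_filter; [exact: shortlex_le_trans|exact/sort_sorted/shortlex_le_total].
rewrite /rep; case E: (class_members h ds u) => [|v s] //= vs _; split.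
  by apply/mem_class_members; rewrite E mem_head.
move=> w /mem_class_members; rewrite E inE => /predU1P[->|ws].
  exact: shortlex_le_refl.
by have /allP := order_path_min (@shortlex_le_trans _ _) vs; apply.
Qed.

Lemma repE u : observed D u -> rep h ds u = name (oclass u).
Proof. by move=> /rep_least/nameP. Qed.

Lemma oclass_rep u : observed D u -> oclass u (rep h ds u).
Proof. by move=> /rep_least[]. Qed.

Lemma observed_rep u : observed D u -> observed D (rep h ds u).
Proof. by move=> /oclass_rep[]. Qed.

Lemma class_testbP z u : observed D u ->
  class_testb h ds z u <-> class_test h sel D z (oclass u).
Proof.
move=> ou; rewrite /class_testb /class_test (repE ou) -acceptsbP; split.
  by case/andP => /eqP.
by case=> -> ->; rewrite eqxx.
Qed.

Lemma primebP u : observed D u -> primeb h ds u <-> declared_prime h sel D (oclass u).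
Proof.
move=> ou; rewrite /primeb /declared_prime (repE ou); split.
  move=> /allP pr; split; first exact: is_oclass_oclass.
  move=> y z Y Z yz y0 z0 cY Yy cZ Zz.
  have := pr (y, z); rewrite mem_splits yz => /(_ (eqxx _)) /=.
  have orep : observed D (y ++ z) by rewrite -yz -repE //; exact: observed_rep.
  have oy := observed_catl orep y0; have oz := observed_catr orep z0.
  move/nilP/negbTE: y0 => ->; move/nilP/negbTE: z0 => ->; case/hasP => x.
  move=> /mem_class_members ux /hasPn no; exists x => // -[x1 [x2 [xE t1 t2]]].
  have := no (x1, x2); rewrite mem_splits xE => /(_ (eqxx _)) /=; rewrite negb_and.
  rewrite (is_oclass_eq cY Yy) in t1; rewrite (is_oclass_eq cZ Zz) in t2.
  by move/class_testbP: t1 => -> //; move/class_testbP: t2 => -> //.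
move=> [_ pr]; apply/allP => -[y z]; rewrite mem_splits => /eqP /= yz.
apply/or3P; case y0: (nilp y); first exact: Or31.
case z0: (nilp z); first exact: Or32.
move/nilP: y0 => y0; move/nilP: z0 => z0.
have orep : observed D (y ++ z) by rewrite yz -repE //; exact: observed_rep.
have oy := observed_catl orep y0; have oz := observed_catr orep z0.
have [x ux no] := pr y z _ _ (esym yz) y0 z0 (is_oclass_oclass h sel oy)
  (oclass_refl h sel oy) (is_oclass_oclass h sel oz) (oclass_refl h sel oz).
apply: Or33; apply/hasP; exists x; first exact/mem_class_members.
apply/hasPn => -[x1 x2]; rewrite mem_splits => /eqP /= xE.
apply/negP => /andP[/class_testbP t1 /class_testbP t2]; apply: no.
by exists x1, x2; split; [rewrite xE|exact: t1|exact: t2].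
Qed.

Lemma edgebP w i j : observed D w -> edgeb h ds w i j <-> edge h sel D w i j.
Proof.
move=> ow; rewrite /edgeb /edge; split.
  case/and3P => ij jw; have os := observed_segment ow ij jw.
  move=> /(primebP os) pr; split; first by rewrite ij.
  by exists (oclass (segment w i j)); last exact: oclass_refl.
case=> /andP[ij jw] [P pr Ps]; rewrite ij jw /=.
apply/primebP; first exact: observed_segment.
by rewrite /oclass -(is_oclass_eq (proj1 pr) Ps).
Qed.

(** The representative has length at most one and admits no cut into nonempty parts. Hence single
    letters are always edges, and every observed word has a factor path. *)
Lemma primeb_letter a : observed D [:: a] -> primeb h ds [:: a].
Proof.
move=> oa; have [_ /(_ _ (oclass_refl h sel oa)) /shortlex_le_size] := rep_least oa.
rewrite /primeb => le1; apply/allP => -[y z]; rewrite mem_splits => /eqP /= yz.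
move: le1; rewrite -yz size_cat; case: y {yz} => // b y; case: z => //= c z; lia.
Qed.

Lemma edgeb_succ w i : observed D w -> i < size w -> edgeb h ds w i i.+1.
Proof.
move=> ow iw; have os := observed_segment ow (ltnSn i) iw.
rewrite /edgeb ltnSn iw /=; have := size_segment i iw; rewrite subSnn.
by case: (segment w i i.+1) os => [|a []] // /primeb_letter.
Qed.

Lemma size_shortest (ps : seq (seq nat)) p : p \in ps -> size (shortest ps) <= size p.
Proof.
have size_shorter q r : size (shorter q r) = minn (size q) (size r).
  by rewrite /shorter /minn; case: ltngtP => // ->.
rewrite /shortest; elim: ps (head _ _) => //= q ps IH x.
rewrite inE size_shorter geq_min => /predU1P[->|/(IH x) ->]; rewrite ?leqnn //.
exact: orbT.
Qed.

Lemma shortest_mem (ps : seq (seq nat)) : ps != [::] -> shortest ps \in ps.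
Proof.
case: ps => // p ps _; rewrite /shortest /=.
have: foldr shorter p ps \in p :: ps.
  elim: ps => [|q ps IH] /=; first exact: mem_head.
  rewrite /shorter; case: ifP => _; rewrite !inE ?eqxx ?orbT //.
  by move: IH; rewrite inE => /orP[->//|->]; rewrite !orbT.
by rewrite /shorter; case: ifP => _ //; rewrite mem_head.
Qed.

(** A shortest path from [i] is an edge to some [j] followed by a shortest path from [j], already in
    the table; the edge to [i.+1] guarantees that a candidate exists. *)
Lemma path_tableP w (n : nat) : observed D w -> n <= size w ->
  let T := foldr (fun i T => best_path h ds w i T :: T) [:: [::]]
             (iota (size w - n) n) in
  forall k, k <= n -> let i := size w - n + k in
    [/\ path (edgeb h ds w) i (nth [::] T k), last i (nth [::] T k) = size w &
        forall q, path (edgeb h ds w) i q -> last i q = size w ->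
          size (nth [::] T k) <= size q].
Proof.
move=> ow; elim: n => [|n IH] nw /= k.
  rewrite leqn0 => /eqP -> /=; rewrite subn0 addn0; split=> // q; by case: q.
have succE : (size w - n.+1).+1 = size w - n by lia.
rewrite succE; set T := foldr _ _ _ => kn.
have {}IH := IH (ltnW nw).
case: k kn => [_|k]; last first.
  rewrite ltnS => /IH; rewrite -/T /= -addSnnS succE; exact.
rewrite addn0 /=; set i := size w - n.+1.
set js := [seq j <- iota 0 (size w).+1 | edgeb h ds w i j].
have js_path j : j \in js ->
    [/\ edgeb h ds w i j, path (edgeb h ds w) j (nth [::] T (j - i.+1)),
        last j (nth [::] T (j - i.+1)) = size w &
        forall q, path (edgeb h ds w) j q -> last j q = size w ->
          size (nth [::] T (j - i.+1)) <= size q].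
  rewrite mem_filter => /andP[e _]; have /and3P[ij jw _] := e.
  have [|p1 p2 p3] := IH (j - i.+1); first by rewrite /i; lia.
  have jE : size w - n + (j - i.+1) = j by rewrite /i; lia.
  by rewrite jE in p1 p2 p3.
have js_mem j : edgeb h ds w i j -> j \in js.
  move=> e; rewrite mem_filter e mem_iota; case/and3P: e; lia.
have [j jjs best] : exists2 j, j \in js & best_path h ds w i T = j :: nth [::] T (j - i.+1).
  apply/mapP; apply: shortest_mem; rewrite -size_eq0 size_map size_eq0 -/js.
  have /js_mem : edgeb h ds w i i.+1 by apply: edgeb_succ => //; rewrite /i; lia.
  by apply: contraTneq => ->.
have [e p1 p2 p3] := js_path j jjs.
split; rewrite ?best /= ?e //.
case=> [|j' q] /=; first by rewrite /i; lia.
case/andP=> e' p' l'; have [_ _ _ /(_ q p' l') p3'] := js_path j' (js_mem _ e').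
have: size (best_path h ds w i T) <= size (j' :: nth [::] T (j' - i.+1)).
  by apply: size_shortest; apply/mapP; exists j' => //; apply: js_mem.
by rewrite best /= => le; apply: leq_trans le _.
Qed.

Lemma shortest_path_min w : observed D w ->
  min_factor_path h sel D w (shortest_path h ds w).
Proof.
move=> ow; have [//|] := @path_tableP w (size w) ow (leqnn _) 0.
rewrite subnn addn0 nth0 -/(path_table h ds w) -/(shortest_path h ds w) => p1 p2 p3.
have pathE p : path (edgeb h ds w) 0 p = path (fun i j => `[< edge h sel D w i j >]) 0 p.
  by apply: eq_path => i j; apply/idP/asboolP => /(edgebP _ _ ow).
split; first by split; rewrite -?pathE.
by move=> q []; rewrite -pathE; apply: p3.
Qed.

Lemma canonical_selector_admissible_on : admissible_on h sel D.
Proof.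
split; last exact: shortest_path_min.
move=> u [u0 [w wD /infixP[l [r wE]]]].
have : (l, r) \in contexts_in ds u by rewrite mem_contexts_in -wE.
rewrite /in_context /= /first_context; case E: (contexts_in _ _) => [|[l' r'] cs] // _.
by rewrite /= -mem_contexts_in E mem_head.
Qed.

Lemma factor_words_observed u : observed D u ->
  forall v, v \in factor_words h ds u -> observed D v.
Proof.
move=> ou; have orep := observed_rep ou.
have [[+ _] _] := shortest_path_min orep; rewrite /factor_words.
elim: (shortest_path _ _ _) {ou} 0 => //= j p IH i /andP[/asboolP[/andP[ij jw] _] pj] v.
by rewrite inE => /predU1P[->|/(IH _ pj)//]; apply: observed_segment.
Qed.

Lemma factor_wordsE u : observed D u ->
  alpha_of h sel D (oclass u) = [seq oclass v | v <- factor_words h ds u].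
Proof.
move=> ou; rewrite /alpha_of /path_classes -repE //= /factor_words.
by elim: (shortest_path _ _ _) 0 => //= j p IH i; rewrite IH.
Qed.

Lemma rhsE u : observed D u ->
  [seq name B | B <- alpha_of h sel D (oclass u)] = rhs h ds u.
Proof.
move=> ou; rewrite factor_wordsE // -map_comp.
by apply/eq_in_map => v /(factor_words_observed ou) /repE /= ->.
Qed.

Lemma mem_primes_list u : u \in primes_list h ds <->
  [/\ observed D u, declared_prime h sel D (oclass u) & name (oclass u) = u].
Proof.
rewrite mem_filter; split.
  case/andP => /andP[/eqP ru pu] /mem_substrings ou.
  by split=> //; [exact/primebP|rewrite -repE].
case=> ou /(primebP ou) -> nu; rewrite repE // nu eqxx /=; exact/mem_substrings.
Qed.

Lemma name_prime P : declared_prime h sel D P ->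
  [/\ observed D (name P), P = oclass (name P) & name P \in primes_list h ds].
Proof.
move=> pP; have [[u ou PE] _] := pP.
have Pn : P (name P) by rewrite PE -/(oclass u) -repE //; exact: oclass_rep.
have on : observed D (name P) by move: Pn; rewrite PE => -[].
have Pn' : P = oclass (name P) := is_oclass_eq (proj1 pP) Pn.
by split=> //; apply/mem_primes_list; rewrite -Pn'.
Qed.

Lemma keptbP P gamma : declared_prime h sel D P ->
  keptb h ds (name P) [seq name B | B <- gamma] <-> kept h sel D P gamma.
Proof.
move=> pP; have [on PE _] := name_prime pP.
rewrite /keptb /kept {2}PE /names_cat -class_testbP //; split.
  case/andP => -> /allP blocks; split=> // beta Q [[l [r gE]] szb] sz2 pQ.
  have [oQ QE Qin] := name_prime pQ.
  rewrite {1}QE; move/class_testbP => /(_ oQ); apply/negP.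
  have /blocks : [seq name B | B <- beta] \in infixes [seq name B | B <- gamma].
    by rewrite mem_infixes; apply/infixP/map_block; exists l, r.
  by rewrite !size_map ltnNge sz2 leqNgt szb => /allP/(_ _ Qin).
case=> -> blocks; apply/allP => b; rewrite mem_infixes => /infixP/block_map[beta -> bg].
rewrite !size_map; apply/or3P; case: ltnP => [_|sz2]; first exact: Or31.
case: leqP => [_|szb]; first exact: Or32.
apply/Or33/allP => Q /mem_primes_list[oQ pQ _]; apply/negP => /(class_testbP _ oQ).
by apply: blocks.
Qed.

Hypothesis D_eps : [::] \notin D.

Lemma observed_sample w : w \in D -> observed D w.
Proof.
move=> wD; split; first by move=> w0; rewrite w0 (negbTE D_eps) in wD.
by exists w => //; apply: infix_refl.
Qed.

Lemma learnerP r : r \in (learner h ds).2 <-> learned_rule h sel D r.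
Proof.
rewrite mem_undup !mem_cat; split.
  case/or3P.
  - move=> /flatten_mapP[N /mem_primes_list[oN pN nN] /flatten_mapP[A]].
    move=> /mem_primes_list[oA pA nA] /mapP[Q]; rewrite mem_filter => /andP[kQ].
    move=> /mem_substrings oQ ->.
    have -> : nts (A :: rhs h ds Q) =
        [seq NT (name B) | B <- oclass A :: alpha_of h sel D (oclass Q)].
      by rewrite /= nA /nts /= -(rhsE oQ) -map_comp.
    rewrite -{1}nN; apply: learned_production => //; first exact: is_oclass_oclass.
    by apply/keptbP => //; rewrite /= nA nN rhsE.
  - move=> /flatten_mapP[u]; rewrite mem_filter => /andP[/andP[sz1 pu]].
    move=> /mem_substrings ou /mapP[a au ->].
    have uE : u = [:: a] by case: u sz1 au {pu ou} => [|b []] //= _; rewrite inE => /eqP ->.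
    rewrite repE //; apply: learned_lexical; first exact/primebP.
    by rewrite -uE; apply: oclass_refl.
  - move=> /mapP[w]; rewrite mem_ds => wD ->.
    have ow := observed_sample wD.
    have -> : nts (rhs h ds w) = [seq NT (name B) | B <- alpha_of h sel D (oclass w)].
      by rewrite /nts -(rhsE ow) -map_comp.
    exact: learned_start.
case=> {r} [N A Q pN pA cQ kQ|P a pP Pa|w wD].
- apply/or3P/Or31; have [oN NE Nin] := name_prime pN; have [oA AE Ain] := name_prime pA.
  have [Q' oQ QE] := cQ.
  apply/flatten_mapP; exists (name N) => //; apply/flatten_mapP; exists (name A) => //.
  apply/mapP; exists Q'.
    rewrite mem_filter; apply/andP; split; last exact/mem_substrings.
    by rewrite -rhsE // /oclass -QE; apply/(keptbP (A :: _) pN).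
  by rewrite -rhsE // /oclass -QE /nts /= -map_comp.
- apply/or3P/Or32; have := is_oclass_eq (proj1 pP) Pa => PE.
  have oa : observed D [:: a] by move: Pa; rewrite PE => -[].
  apply/flatten_mapP; exists [:: a].
    rewrite mem_filter /=; apply/andP; split; last exact/mem_substrings.
    by apply/primebP => //; rewrite /oclass -PE.
  by rewrite /= repE // /oclass -PE mem_head.
- apply/or3P/Or33/mapP; exists w; first by rewrite mem_ds.
  by rewrite /nts -(rhsE (observed_sample wD)) -map_comp.
Qed.

Lemma learner_lists : lists (learned_grammar h sel D) (learner h ds).
Proof.
have uniq_primes : uniq (primes_list h ds) by rewrite filter_uniq // sort_uniq undup_uniq.
split; rewrite ?undup_uniq //=.
- rewrite map_inj_uniq ?uniq_primes ?andbT; last by move=> ? ? [].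
  by apply/mapP => -[].
- move=> n; rewrite inE; split.
    case/predU1P => [->|/mapP[u /mem_primes_list[ou pu nu] ->]]; first by left.
    by right; exists (oclass u); rewrite ?nu.
  case=> [->//|[P /name_prime[_ _ Pin] ->]]; apply/orP; right.
  by apply/mapP; exists (name P).
- exact: learnerP.
Qed.

End ProgramSpec.

(** * Running time of the program *)

Lemma pairmapE (A B : Type) (f : A -> A -> B) x s :
  pairmap f x s = [seq f p.1 p.2 | p <- zip (x :: s) s].
Proof. by elim: s x => //= y s IH x; rewrite IH. Qed.

Create HintDb ptime_learner discriminated.
#[global] Hint Constants Opaque : ptime_learner.

(* Retyping [f] replaces the codomain [Equality.sort _] left by [ptime_mem] by
   the type that the hints are stated with. *)
Ltac ptime_learner ::=
  lazymatch goal with |- ptime ?f => let g := constr:(ptime f) in change g end;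
  first
  [ match goal with |- ptime (fun e => ?F (@?a e) (@?b e) (@?c e)) =>
      apply (ptime_comp3 (F := F) (f := a) (g := b) (h := c));
        [solve [auto with nocore ptime_learner]|..] end
  | match goal with |- ptime (fun e => ?F (@?a e) (@?b e)) =>
      apply (ptime_comp2 (F := F) (f := a) (g := b));
        [solve [auto with nocore ptime_learner]|..] end
  | match goal with |- ptime (fun e => ?F (@?a e)) =>
      apply (ptime_comp (g := F) (f := a));
        [solve [auto with nocore ptime_learner]|..] end ].

Section ProgramTime.
Context {disp : Order.disp_t} {Sigma : finOrderType disp} {M : monoidType}.
Variables (h : seq Sigma -> M) (sM : seq M).
Hypothesis h1 : h [::] = 1%g.
Hypothesis hmul : forall u v, h (u ++ v) = (h u * h v)%g.
Hypothesis sM_full : forall m, m \in sM.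

(** The monoid is known through a list of its elements only, so an element is encoded by its
    position there. *)
Lemma encode_monoid_inj : injective (fun m : M => enc_nat (index m sM)).
Proof.
move=> m m' /enc_nat_inj eq_i.
by rewrite -(nth_index 1%g (sM_full m)) eq_i nth_index.
Qed.

Instance encodable_monoid : encodable M := Encodable encode_monoid_inj.

Lemma code_size_monoid (m : M) : code_size m <= (size sM).*2.+1.
Proof.
have -> : code_size m = code_size (index m sM) by [].
by rewrite code_size_nat ltnS leq_double index_size.
Qed.

(** Evaluated letter by letter: the accumulators range over a finite set, and multiplication by the
    value of a letter is a finite table. *)
Lemma ptime_h : ptime h.
Proof.
have hE u : foldr (fun a m => (h [:: a] * m)%g) 1%g u = h u.
  by elim: u => //= a u ->; rewrite -hmul.
apply: (ptime_ext hE).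
apply (ptime_foldr (z := fun=> 1%g) (g := fun (_ : seq Sigma) a m => (h [:: a] * m)%g)).
- by apply: pbounded_le (pbounded_cst _) => q; apply: code_size_monoid.
- by ptime.
- apply (ptime_comp2 (F := fun a m => (h [:: a] * m)%g)); ptime.
  apply: (ptime_finite (s := [seq (a, m) | a <- enum Sigma, m <- sM])) => -[a m].
  by apply/allpairsP; exists (a, m); rewrite mem_enum.
- by ptime.
Qed.
Hint Resolve ptime_h : ptime_learner.

Lemma ptime_substrings : ptime (@substrings disp Sigma).
Proof. by change (ptime (fun ds => @substrings disp Sigma ds)); rewrite /substrings; ptime. Qed.
Hint Resolve ptime_substrings : ptime_learner.

Lemma ptime_contexts_in : ptime (fun p => @contexts_in disp Sigma p.1 p.2).
Proof. by rewrite /contexts_in; ptime. Qed.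
Hint Resolve ptime_contexts_in : ptime_learner.

Lemma ptime_first_context : ptime (fun p => @first_context disp Sigma p.1 p.2).
Proof. by rewrite /first_context; ptime. Qed.
Hint Resolve ptime_first_context : ptime_learner.

Lemma ptime_unary : ptime (fun p => unary h p.1.1 p.1.2 p.2).
Proof. by rewrite /unary; ptime. Qed.
Hint Resolve ptime_unary : ptime_learner.

Lemma ptime_fact_step : ptime (fun p => fact_step h p.1.1 p.1.2 p.2).
Proof. by rewrite /fact_step; ptime. Qed.
Hint Resolve ptime_fact_step : ptime_learner.

Lemma ptime_candidates : ptime (fun p => @candidates disp Sigma p.1 p.2).
Proof. by rewrite /candidates; ptime. Qed.
Hint Resolve ptime_candidates : ptime_learner.

Lemma ptime_facts : ptime (fun p => facts h p.1 p.2).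
Proof.
rewrite /facts; apply (ptime_iter (x := fun=> [::])
  (f := fun p F => [seq c <- candidates p.1 p.2 | fact_step h p.1 F c])); ptime.
(* Every iterate after the first is a sublist of the candidates, so the accumulators stay
   bounded. *)
have := pbounded_comp (ptime_size ptime_fst) (ptime_size ptime_candidates).
move=> bC; apply: pbounded_le (bC nat _) => -[p k] /=.
case: k => [|k]; first exact: code_size_gt0.
by rewrite code_size_sub //= filter_subseq.
Qed.
Hint Resolve ptime_facts : ptime_learner.

Lemma ptime_in_W : ptime (fun p => in_W h p.1 p.2).
Proof. by rewrite /in_W; ptime. Qed.
Hint Resolve ptime_in_W : ptime_learner.

Lemma ptime_acceptsb : ptime (fun p => acceptsb h p.1.1 p.1.2 p.2).
Proof. by rewrite /acceptsb; ptime. Qed.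
Hint Resolve ptime_acceptsb : ptime_learner.

Lemma ptime_same_class : ptime (fun p => same_class h p.1.1 p.1.2 p.2).
Proof. by rewrite /same_class; ptime. Qed.
Hint Resolve ptime_same_class : ptime_learner.

Lemma ptime_class_members : ptime (fun p => class_members h p.1 p.2).
Proof. by rewrite /class_members; ptime. Qed.
Hint Resolve ptime_class_members : ptime_learner.

Lemma ptime_rep : ptime (fun p => rep h p.1 p.2).
Proof. by rewrite /rep; ptime. Qed.
Hint Resolve ptime_rep : ptime_learner.

Lemma ptime_class_testb : ptime (fun p => class_testb h p.1.1 p.1.2 p.2).
Proof. by rewrite /class_testb; ptime. Qed.
Hint Resolve ptime_class_testb : ptime_learner.

Lemma ptime_primeb : ptime (fun p => primeb h p.1 p.2).
Proof. by rewrite /primeb; ptime. Qed.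
Hint Resolve ptime_primeb : ptime_learner.

Lemma ptime_segment : ptime (fun p => @segment disp Sigma p.1.1 p.1.2 p.2).
Proof. by rewrite /segment; ptime. Qed.
Hint Resolve ptime_segment : ptime_learner.

Lemma ptime_edgeb : ptime (fun p => edgeb h p.1.1 p.1.2 p.2.1 p.2.2).
Proof. by rewrite /edgeb; ptime. Qed.

Lemma shortest_sub (ps : seq (seq nat)) : shortest ps \in [::] :: ps.
Proof.
case: ps => [|p ps]; first exact: mem_head.
by rewrite inE shortest_mem ?orbT.
Qed.

Lemma ptime_shortest : ptime shortest.
Proof.
apply (ptime_foldr (z := head [::]) (g := fun=> shorter) (s := id)).
- have H : ptime (fun q : seq (seq nat) * seq (seq nat) => head [::] q.1 :: q.2) by ptime.
  apply: pbounded_le (ptime_size H) => -[ps qs] /=.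
  apply: ltnW; apply: code_size_mem; elim: qs => [|q qs IH]; first exact: mem_head.
  rewrite /= {1}/shorter; case: ifP => _; first by rewrite !inE eqxx orbT.
  by move: IH; rewrite !inE => /orP[->//|->]; rewrite !orbT.
- by ptime.
- by rewrite /shorter; ptime.
- by ptime.
Qed.
Hint Resolve ptime_shortest : ptime_learner.

Lemma ptime_best_path : ptime (fun p => best_path h p.1.1 p.1.2 p.2.1 p.2.2).
Proof.
rewrite /best_path; ptime.
apply (ptime_comp (g := fun p => edgeb h p.1.1 p.1.2 p.2.1 p.2.2)
  (f := fun e => (e.1.1.1, e.1.1.2, (e.1.2.1, e.2)))); first exact: ptime_edgeb.
by ptime.
Qed.

Lemma code_size_nats n k (p : seq nat) : {in p, forall i, i <= n} -> size p <= k ->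
  code_size p <= k * (n.*2.+2) + 1.
Proof.
move=> pn pk; rewrite code_size_seq addn1 ltnS.
apply: (@leq_trans (\sum_(i <- p) n.*2.+2)).
  rewrite big_seq [leqRHS]big_seq leq_sum // => i /pn; rewrite code_size_nat; lia.
by rewrite big_const_seq count_predT iter_addn_0 mulnC leq_mul2r pk orbT.
Qed.

(** The fold rule asks for a bound at every list [s], not only at lists of positions of [w], so the
    estimate uses neither validity nor minimality of the paths. *)
Lemma path_table_bound ds w s :
  let T := foldr (fun i T => best_path h ds w i T :: T) [:: [::]] s in
  size T = (size s).+1 /\
  {in T, forall p, size p <= size s /\ {in p, forall j, j <= size w}}.
Proof.
elim: s => [|i s [szT IH]] /=; first by split=> // p; rewrite inE => /eqP ->.
set T := foldr _ _ _ in szT IH *; split; first by rewrite szT.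
move=> p; rewrite inE => /predU1P[->|/IH[ps pw]]; last by split=> //; apply: leqW.
have := shortest_sub [seq j :: nth [::] T (j - i.+1) |
  j <- [seq j <- iota 0 (size w).+1 | edgeb h ds w i j]].
rewrite -/(best_path h ds w i T) inE => /predU1P[->//|/mapP[j]].
rewrite mem_filter mem_iota => /andP[_ jw] ->.
have [ps pw] : size (nth [::] T (j - i.+1)) <= size s /\
    {in nth [::] T (j - i.+1), forall j', j' <= size w}.
  have [jT|jT] := ltnP (j - i.+1) (size T); first exact/IH/mem_nth.
  by rewrite nth_default.
split=> // j'; rewrite inE => /predU1P[->|/pw//].
by move: jw; rewrite add0n ltnS.
Qed.

Lemma ptime_path_table : ptime (fun p => path_table h p.1 p.2).
Proof.
rewrite /path_table; apply (ptime_foldr (z := fun=> [:: [::]])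
  (g := fun p i T => best_path h p.1 p.2 i T :: T)); last by ptime.
- have : pbounded (fun q : seq (seq Sigma) * seq Sigma * seq nat =>
      (code_size q + 1) * (code_size q * (2 * code_size q + 2) + 2) + 1).
    by solve_pbounded.
  apply: pbounded_le => -[[ds w] s] /=.
  have [] := path_table_bound ds w s; set T := foldr _ _ _ => szT Tp.
  have sn : size s <= code_size (ds, w, s).
    rewrite code_size_pair /=; apply: leqW; apply: (leq_trans _ (leq_addl _ _)).
    by apply/ltnW; apply size_le_code.
  have wn : size w <= code_size (ds, w, s).
    rewrite !code_size_pair /=; have : size w <= code_size w by apply/ltnW; apply size_le_code.
    lia.
  move: (code_size (ds, w, s)) sn wn => n sn wn.
  rewrite code_size_seq addn1 ltnS.
  apply: (@leq_trans (\sum_(p <- T) (n * (2 * n + 2) + 2))).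
    rewrite big_seq [leqRHS]big_seq leq_sum // => p /Tp[ps pw].
    have := code_size_nats pw ps => le; rewrite addn2 ltnS; apply: leq_trans le _.
    rewrite addn1 ltnS -mul2n; apply: leq_mul => //; lia.
  rewrite big_const_seq count_predT iter_addn_0 mulnC leq_mul2r szT; lia.
- by ptime.
- ptime; apply (ptime_comp (g := fun p => best_path h p.1.1 p.1.2 p.2.1 p.2.2)
    (f := fun e => (e.1.1, e.1.2, (e.2.1, e.2.2)))); first exact: ptime_best_path.
  by ptime.
Qed.
Hint Resolve ptime_path_table : ptime_learner.

Lemma ptime_shortest_path : ptime (fun p => shortest_path h p.1 p.2).
Proof. by rewrite /shortest_path; ptime. Qed.
Hint Resolve ptime_shortest_path : ptime_learner.

Lemma ptime_factor_words : ptime (fun p => factor_words h p.1 p.2).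
Proof.
apply: (ptime_ext (fun p => esym (pairmapE (segment (rep h p.1 p.2)) 0
  (shortest_path h p.1 (rep h p.1 p.2))))).
by ptime.
Qed.
Hint Resolve ptime_factor_words : ptime_learner.

Lemma ptime_primes_list : ptime (fun ds => primes_list h ds).
Proof. by rewrite /primes_list; ptime. Qed.
Hint Resolve ptime_primes_list : ptime_learner.

Lemma ptime_keptb : ptime (fun p => keptb h p.1.1 p.1.2 p.2).
Proof. by rewrite /keptb; ptime. Qed.
Hint Resolve ptime_keptb : ptime_learner.

Lemma ptime_rhs : ptime (fun p => rhs h p.1 p.2).
Proof. by rewrite /rhs; ptime. Qed.
Hint Resolve ptime_rhs : ptime_learner.

Lemma ptime_nts : ptime (fun us => @nts disp Sigma us).
Proof. by rewrite /nts; ptime. Qed.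
Hint Resolve ptime_nts : ptime_learner.

Lemma ptime_productions_list : ptime (fun ds => productions_list h ds).
Proof. by rewrite /productions_list; ptime. Qed.
Hint Resolve ptime_productions_list : ptime_learner.

Lemma ptime_lexical_list : ptime (fun ds => lexical_list h ds).
Proof. by rewrite /lexical_list; ptime. Qed.
Hint Resolve ptime_lexical_list : ptime_learner.

Lemma ptime_start_list : ptime (fun ds => start_list h ds).
Proof. by rewrite /start_list; ptime. Qed.
Hint Resolve ptime_start_list : ptime_learner.

Lemma ptime_learner_sort : ptime (fun s => learner h (sort shortlex_le s)).
Proof. by rewrite /learner; ptime. Qed.

End ProgramTime.

Lemma ptime_program (A B : Type) (eA : encodable A) (eB : encodable B) (f : A -> B) :
  ptime f -> exists prog k, forall a, exists2 t,
    runs prog (encode a) (encode (f a)) t & t <= (code_size a + 2) ^ k.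
Proof.
(* The entry expression becomes function 0, so the remaining table starts at offset 1. *)
case=> T [k Tk] /(_ 1) [ext [e H]]; exists (e :: ext), k => a.
have [t ev tT] := H [:: e] [::] [::] a erefl.
by exists t; [rewrite /runs /= -[ext]cats0|apply: leq_trans tT (Tk a)].
Qed.

(** Letters are unary numbers below $|\Sigma|$; since no word is empty, the fixed overhead of a word
    can be charged to its letters. *)
Lemma code_size_sample (disp : Order.disp_t) (Sigma : finOrderType disp)
    (D : {fset (seq Sigma)}) (s : seq (seq Sigma)) :
  [::] \notin D -> perm_eq s D -> code_size s <= (2 * #|Sigma| + 4) * sample_size D + 1.
Proof.
move=> D0 sD; rewrite code_size_seq addn1 ltnS (perm_big _ sD) /= /sample_size.
rewrite big_distrr /= big_seq [leqRHS]big_seq leq_sum // => w wD.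
have w_gt0 : 0 < size w by case: w wD => // /(negP D0).
have : code_size w <= (2 * #|Sigma| + 2) * size w + 1.
  rewrite code_size_seq addn1 ltnS -sum1_size big_distrr /= leq_sum // => a _.
  have -> : code_size a = code_size (enum_rank a : nat) by [].
  have key (r n : nat) : r < n -> r.*2.+1 < (2 * n + 2) * 1 by lia.
  by rewrite code_size_nat; exact/key/ltn_ord.
have key (c n k : nat) : 0 < k -> c <= (2 * n + 2) * k + 1 -> c < (2 * n + 4) * k.
  by nia.
exact: key.
Qed.

Section LearnerTime.
Local Open Scope ring_scope.

Lemma learner_ptime (disp : Order.disp_t) (Sigma : finOrderType disp) (M : monoidType)
    (hM : finite_set [set: M]) (h : seq Sigma -> M) (h1 : h [::] = 1%g)
    (hmul : forall u v, h (u ++ v) = (h u * h v)%g) :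
  exists p : {poly nat}, exists (sel : selector) (prog : program),
    admissible h sel /\ computes_in_time prog (learned_grammar h sel) (fun n => p.[n]).
Proof.
pose sM : seq M := fset_set [set: M].
have sM_full m : m \in sM by rewrite in_fset_set // inE.
have [prog [k run]] := ptime_program (ptime_learner_sort h1 hmul sM_full).
(* The bound of [code_size_sample], plus the 2 in the base of [pbounded]. *)
exists (((2 * #|Sigma| + 4)%N%:P * 'X + 3%N%:P) ^+ k), (canonical_selector h), prog; split.
  by move=> D D0; exact: canonical_selector_admissible_on.
move=> D s D0 sD; have [t rt tk] := run s.
exists (learner h (sort shortlex_le s)), t; split=> //.
  have -> : sort shortlex_le s = sort shortlex_le D.
    by apply/perm_sortP => //; [exact: shortlex_le_total|exact: shortlex_le_trans|
      exact: shortlex_le_anti].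
  exact: learner_lists.
apply: leq_trans tk _; rewrite horner_exp !hornerE.
have := code_size_sample D0 sD; set c := code_size s; set n := sample_size D.
move=> le; apply: leq_exp_r; move: le; lia.
Qed.

End LearnerTime.

(** * Exact factorizations into relative primes *)

(** Levi's lemma. *)
Lemma cat_eq_cat (T : Type) (x y z w : seq T) : x ++ y = z ++ w ->
  (exists u, x = z ++ u /\ w = u ++ y) \/ (exists u, z = x ++ u /\ y = u ++ w).
Proof.
elim: x z => [|a x IH] [|b z] /=.
- by move=> ->; left; exists [::].
- by move=> ->; right; exists (b :: z).
- by move=> <-; left; exists (a :: x).
- move=> [-> /IH[[u [-> ->]]|[u [-> ->]]]]; [left|right]; by exists u.
Qed.

Section SetCats.
Context {disp : Order.disp_t} {Sigma : finOrderType disp}.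
Local Open Scope classical_set_scope.
Implicit Types (x y z w : seq Sigma) (P : set (seq Sigma)) (alpha beta : seq (set (seq Sigma))).

Lemma set_cats_cons P alpha w :
  set_cats (P :: alpha) w <-> exists x y, [/\ w = x ++ y, P x & set_cats alpha y].
Proof.
split=> [[x Px [y ay <-]]|[x [y [-> Px ay]]]]; first by exists x, y.
by exists x => //; exists y.
Qed.

Lemma set_cats_cat alpha beta w :
  set_cats (alpha ++ beta) w <->
  exists x y, [/\ w = x ++ y, set_cats alpha x & set_cats beta y].
Proof.
elim: alpha w => [|P alpha IH] w.
  by split=> [bw|[x [y [-> -> //]]]]; exists [::], w.
rewrite cat_cons set_cats_cons; split.
  move=> [x [y [-> Px /IH[y1 [y2 [-> ay by2]]]]]]; exists (x ++ y1), y2.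
  by rewrite catA; split=> //; apply/set_cats_cons; exists x, y1.
move=> [x [y [-> /set_cats_cons[x1 [x2 [-> Px ax]]] byy]]].
exists x1, (x2 ++ y); rewrite catA; split=> //; apply/IH; by exists x2, y.
Qed.

Lemma set_cats1 P : set_cats [:: P] = P.
Proof.
apply/predeqP => w; rewrite set_cats_cons; split=> [[x [y [-> Px ->]]]|Pw].
  by rewrite cats0.
by exists w, [::]; rewrite cats0.
Qed.

(* Where a prefix [x] of a word of $\overline\alpha$ ends: at a boundary
   between two factors, or strictly inside a factor [R]. *)
Lemma set_cats_split alpha x y : set_cats alpha (x ++ y) ->
  (exists a1 a2, [/\ alpha = a1 ++ a2, set_cats a1 x & set_cats a2 y]) \/
  (exists a1 R a2 c s t d, [/\ alpha = a1 ++ R :: a2, set_cats a1 c, R (s ++ t),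
     set_cats a2 d & [/\ s <> [::], t <> [::], x = c ++ s & y = t ++ d]]).
Proof.
elim: alpha x y => [|P alpha IH] x y.
  by case: x => //= y0; left; exists [::], [::]; split.
move=> /set_cats_cons[p [a [/cat_eq_cat[[u [xE aE]]|[u [pE yE]]] Pp aa]]].
  rewrite aE in aa; case: (IH _ _ aa) => [[a1 [a2 [-> ua1 ya2]]]|].
    left; exists (P :: a1), a2; split=> //.
    by apply/set_cats_cons; exists p, u.
  move=> [a1 [R [a2 [c [s [t [d [-> a1c Rst a2d [s0 t0 uE ->]]]]]]]]].
  right; exists (P :: a1), R, a2, (p ++ c), s, t, d; split=> //.
    by apply/set_cats_cons; exists p, c.
  by split=> //; rewrite xE uE catA.
have [u0|/eqP u0] := eqVneq u [::].
  left; exists [:: P], alpha; rewrite set_cats1; move: Pp; rewrite pE yE u0 cats0.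
  by split.
have [x0|/eqP x0] := eqVneq x [::].
  left; exists [::], (P :: alpha); split=> //; apply/set_cats_cons.
  by exists p, a; split=> //; rewrite pE yE x0.
right; exists [::], P, alpha, [::], x, u, a; split=> //; first by rewrite -pE.
Qed.

(** Follows one marked letter into the factor that contains it, as needed to descend a parse. *)
Lemma set_cats_letter alpha l a r : set_cats alpha (l ++ a :: r) ->
  exists a1 Q a2 l' r' x y, [/\ alpha = a1 ++ Q :: a2, Q (l' ++ a :: r'),
    set_cats a1 x, set_cats a2 y & l ++ a :: r = x ++ (l' ++ a :: r') ++ y].
Proof.
elim: alpha l => [|P alpha IH] l; first by case: l.
move=> /set_cats_cons[p [q [/cat_eq_cat[[u [lE qE]]|[u [pE arE]]] Pp aq]]].
  rewrite qE in aq; have [a1 [Q [a2 [l' [r' [x [y [-> Qa ax ay eq]]]]]]]] := IH _ aq.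
  exists (P :: a1), Q, a2, l', r', (p ++ x), y; split=> //.
    by apply/set_cats_cons; exists p, x.
  by rewrite lE -!catA; congr cat; rewrite eq -!catA.
case: u pE arE => [|b u] pE arE.
  rewrite cats0 in pE; rewrite -[q]cat0s /= in arE.
  have [|a1 [Q [a2 [l' [r' [x [y [-> Qa ax ay eq]]]]]]]] := IH [::].
    by rewrite /= arE.
  exists (P :: a1), Q, a2, l', r', (p ++ x), y; split=> //.
    by apply/set_cats_cons; exists p, x.
  by rewrite -pE -catA; congr cat.
case: arE => ab rE; subst b.
by exists [::], P, alpha, l, u, [::], q; split=> //; rewrite -?pE // pE rE -catA.
Qed.

End SetCats.

(** * The relative congruence and cancellation in primes *)

Section Theory.
Context {disp : Order.disp_t} {Sigma : finOrderType disp} {M : monoidType}.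
Variables (h : seq Sigma -> M) (L : set (seq Sigma)).
Hypothesis hmul : forall u v, h (u ++ v) = (h u * h v)%g.
Local Open Scope classical_set_scope.
Implicit Types (x y z w : seq Sigma) (P Q R X Y : set (seq Sigma)).
Implicit Types (alpha beta : seq (set (seq Sigma))).

Notation theta := (theta h L).
Notation rclass := (rclass h L).
Notation rclass_muls := (rclass_muls h L).
Notation is_rclass := (is_rclass h L).
Notation prime := (relative_prime h L).
Notation prime_seq := (prime_seq h L).
Notation live := (live_word L).

Lemma theta_refl x : theta x x. Proof. by []. Qed.

Lemma theta_sym x y : theta x y -> theta y x.
Proof. by case=> *; split. Qed.

Lemma theta_trans y x z : theta x y -> theta y z -> theta x z.
Proof. by move=> [xy hxy] [yz hyz]; split; [rewrite /synt_eq xy|rewrite hxy]. Qed.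

Lemma theta_L x y l r : theta x y -> L (l ++ x ++ r) -> L (l ++ y ++ r).
Proof.
by move=> [xy _] lxr; have: contexts L x (l, r) by []; rewrite xy.
Qed.

Lemma theta_cat x x' y y' : theta x x' -> theta y y' -> theta (x ++ y) (x' ++ y').
Proof.
move=> xx yy; split; last by rewrite !hmul xx.2 yy.2.
apply/predeqP => -[l r]; rewrite /contexts /= -!catA; split.
  move/(theta_L xx); rewrite !catA -(catA _ y) => /(theta_L yy); by rewrite !catA.
move/(theta_L (theta_sym xx)).
rewrite !catA -(catA _ y') => /(theta_L (theta_sym yy)); by rewrite !catA.
Qed.

Lemma rclass_eq x y : theta x y -> rclass x = rclass y.
Proof.
move=> xy; apply/predeqP => z; split; last exact: theta_trans xy.
exact: theta_trans (theta_sym xy).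
Qed.

Lemma mem_rclass X x : is_rclass X -> X x -> X = rclass x.
Proof. by move=> [y ->] /rclass_eq. Qed.

Lemma is_rclass_rclass x : is_rclass (rclass x). Proof. by exists x. Qed.

Lemma rclass_theta X x y : is_rclass X -> X x -> theta x y -> X y.
Proof. by move=> cX Xx xy; rewrite (mem_rclass cX Xx). Qed.

Lemma live_theta x y : theta x y -> live x -> live y.
Proof. by move=> [xy _]; rewrite /live_word xy. Qed.

Lemma live_catl x y : live (x ++ y) -> live x.
Proof.
by case=> -[l r] /= lxyr; exists (l, y ++ r); move: lxyr; rewrite /contexts /= -catA.
Qed.

Lemma live_catr x y : live (x ++ y) -> live y.
Proof.
by case=> -[l r] /= lxyr; exists (l ++ x, r); move: lxyr; rewrite /contexts /= -!catA.
Qed.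

Lemma rclass_mulE x y : rclass_mul h L (rclass x) (rclass y) = rclass (x ++ y).
Proof.
apply/predeqP => z; split=> [[x' [y' [xx yy]]]|xyz]; last by exists x, y.
by apply: theta_trans; apply: theta_cat.
Qed.

Lemma prime_rclass P p : prime P -> P p -> P = rclass p.
Proof. by case=> cP _ _ _; apply: mem_rclass. Qed.

Lemma prime_theta P x y : prime P -> P x -> theta x y -> P y.
Proof. by case=> cP _ _ _; apply: rclass_theta. Qed.

Lemma prime_theta2 P x y : prime P -> P x -> P y -> theta x y.
Proof. by move=> pP Px; rewrite (prime_rclass pP Px). Qed.

Lemma prime_live P p : prime P -> P p -> live p.
Proof. by case=> _ lP _ _; apply: lP. Qed.

(** The set product can be smaller than the class product, but any one of its words determines the
    latter. *)
Lemma rclass_muls_mem alpha w : prime_seq alpha -> set_cats alpha w ->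
  rclass_muls alpha = rclass w.
Proof.
elim: alpha w => [|P alpha IH] w pa; first by move=> ->.
move=> /set_cats_cons[x [y [-> Px ay]]].
have pP : prime P by apply: pa; rewrite mem_head.
rewrite /= (IH y) // ?(prime_rclass pP Px) ?rclass_mulE //.
by move=> Q Qa; apply: pa; rewrite inE Qa orbT.
Qed.

Lemma prime_seq_cat alpha beta : prime_seq (alpha ++ beta) <-> prime_seq alpha /\ prime_seq beta.
Proof.
split=> [p|[pa pb] P]; last by rewrite mem_cat => /orP[/pa|/pb].
by split=> P Pa; apply: p; rewrite mem_cat Pa ?orbT.
Qed.

Lemma prime_seq_cons P alpha : prime_seq (P :: alpha) <-> prime P /\ prime_seq alpha.
Proof.
rewrite -cat1s prime_seq_cat; split=> -[pP pa]; split=> //.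
  by apply: pP; rewrite mem_head.
by move=> Q; rewrite inE => /eqP ->.
Qed.

Lemma prime_nonempty P : prime P -> exists p, P p.
Proof. by case=> -[x ->] *; exists x. Qed.

Lemma set_cats_nonempty alpha : prime_seq alpha -> exists w, set_cats alpha w.
Proof.
elim: alpha => [|P alpha IH]; first by exists [::].
case/prime_seq_cons => /prime_nonempty[p Pp] /IH[w aw].
by exists (p ++ w); apply/set_cats_cons; exists p, w.
Qed.

Hypothesis hsub : h_substitutable h L.
Hypothesis hunit : unit_separated h L.

Lemma theta_nil x : theta [::] x -> x = [::].
Proof. by move=> t; have : rclass [::] x by []; rewrite hunit. Qed.

Lemma rclass_nil x : rclass x = rclass [::] -> x = [::].
Proof. by move=> e; apply: theta_nil; rewrite -[theta _ _]/(rclass [::] x) -e. Qed.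

Lemma prime_nil P : prime P -> ~ P [::].
Proof. by move=> pP P0; case: (pP) => _ _; rewrite (prime_rclass pP P0). Qed.

Lemma substitute x y l r : h x = h y -> L (l ++ x ++ r) -> L (l ++ y ++ r) -> theta x y.
Proof. by move=> hxy lx ly; split=> //; apply: hsub => //; exists (l, r). Qed.

Lemma set_cats_size alpha w : prime_seq alpha -> set_cats alpha w -> size alpha <= size w.
Proof.
elim: alpha w => // P alpha IH w /prime_seq_cons[pP pa].
move=> /set_cats_cons[[|a x] [y [-> Px ay]]]; first by case: (prime_nil pP Px).
by rewrite /= ltnS size_cat (leq_trans (IH _ pa ay)) ?leq_addl.
Qed.

Hypothesis hptld : PTLD h L.

(** PTLD gives [b] and [b'] the same $h$-value. A context of [a ++ b] also accepts [a ++ b']; moving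
    [a] into its left part gives a context shared by [b] and [b'], so substitutability applies. *)
Lemma prime_cancel P a b b' : prime P -> P (a ++ b) -> P (a ++ b') -> theta b b'.
Proof.
move=> pP Pb Pb'; have lb := prime_live pP Pb; have lb' := prime_live pP Pb'.
have t := prime_theta2 pP Pb Pb'.
have hbb : h b = h b'.
  apply: (hptld (m := h a) (P := P) (p := a ++ b)) => //.
  - by exists a => //; apply: live_catl lb.
  - by exists b => //; apply: live_catr lb.
  - by exists b' => //; apply: live_catr lb'.
  - by rewrite t.2.
have [[l r] /= lr] := lb; have lr' := theta_L t lr.
by apply: (substitute (l := l ++ a) (r := r)) => //; rewrite -catA (catA a).
Qed.

Lemma prime_prefix_code P q u : prime P -> P q -> P (q ++ u) -> u = [::].
Proof.
move=> pP Pq Pqu; apply: theta_nil; apply: (prime_cancel pP _ Pqu).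
by rewrite cats0.
Qed.

Lemma prime_prefix_eq P x y x' y' : prime P -> P x -> P x' -> x ++ y = x' ++ y' -> x = x'.
Proof.
move=> pP Px Px' /cat_eq_cat[[u [xE _]]|[u [xE _]]].
  by move: Px; rewrite xE => /(prime_prefix_code pP Px') ->; rewrite cats0.
by move: Px'; rewrite xE => /(prime_prefix_code pP Px) ->; rewrite cats0.
Qed.

(** A concatenation of prefix codes is a prefix code. *)
Lemma set_cats_prefix_eq alpha x y x' y' : prime_seq alpha ->
  set_cats alpha x -> set_cats alpha x' -> x ++ y = x' ++ y' -> x = x'.
Proof.
elim: alpha x x' => [|P alpha IH] x x'; first by move=> _ -> ->.
move=> /prime_seq_cons[pP pa] /set_cats_cons[p [q [-> Pp aq]]].
move=> /set_cats_cons[p' [q' [-> Pp' aq']]]; rewrite -!catA => eq.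
have pE := prime_prefix_eq pP Pp Pp' eq; rewrite pE in eq *.
by congr cat; apply: IH aq aq' _ => //; move/eqP: eq; rewrite eqseq_cat // => /andP[_ /eqP].
Qed.

Definition no_prime_block alpha : Prop :=
  forall beta, block beta alpha -> 2 <= size beta -> ~ prime (rclass_muls beta).

Lemma rclass_factors R s t : R = set_cat (rclass s) (rclass t) ->
  prime R -> s <> [::] -> t <> [::] -> False.
Proof.
move=> RE pR s0 t0; case: pR => _ _ _ /(_ _ _ (is_rclass_rclass s) (is_rclass_rclass t) RE).
by case=> /rclass_nil.
Qed.

(** A word of $\overline\alpha$ begins with some [q] in the first factor [Q] of [beta]. If [q] ended
    strictly inside a factor [R] of [alpha], cutting there would factor [R] exactly. So [q] ends at
    a boundary; it spans one factor, since a longer block would have the prime class [Q], and this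
    factor is [Q]. The rest follows by induction. *)
Lemma set_cats_sub_eq alpha beta : prime_seq alpha -> prime_seq beta ->
  set_cats alpha `<=` set_cats beta -> no_prime_block alpha -> alpha = beta.
Proof.
elim: beta alpha => [|Q beta IH] alpha pa pb ab nb.
  have [w aw] := set_cats_nonempty pa.
  have := set_cats_size pa aw; rewrite (ab _ aw); by case: (alpha).
have [pQ pb'] := (prime_seq_cons _ _).1 pb.
have [w aw] := set_cats_nonempty pa.
have /set_cats_cons[q [b [wE Qq bb]]] := ab _ aw; rewrite wE in aw.
case: (set_cats_split aw) => [[a1 [a2 [aE a1q a2b]]]|]; last first.
  move=> [a1 [R [a2 [c [s [t [d [aE a1c Rst a2d [s0 t0 qE bE]]]]]]]]].
  have pR : prime R by apply: pa; rewrite aE mem_cat mem_head orbT.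
  exfalso; apply: (@rclass_factors R s t) => //.
  apply/predeqP => r; split; last first.
    move=> [x sx [y ty <-]]; apply: (prime_theta pR Rst); exact: theta_cat.
  move=> Rr; have : set_cats alpha ((c ++ r) ++ d).
    rewrite aE; apply/set_cats_cat; exists c, (r ++ d); rewrite catA; split=> //.
    by apply/set_cats_cons; exists r, d.
  (* An arbitrary [r] in [R] replaces [s ++ t]; the new word begins with some [q2] in [Q], which
     ends inside [c], inside [r], or beyond [r]. *)
  move=> /ab/set_cats_cons[q2 [b2 [/cat_eq_cat[[u [+ _]]|[u [q2E _]]] Qq2 bb2]]].
    move=> /cat_eq_cat[[v [cE uE]]|[v [q2E rE]]].
      have := prime_prefix_code pQ Qq2 (u := v ++ s).
      by rewrite catA -cE -qE => /(_ Qq); case: (v) s0 => // s0 /=.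
    (* Inside [r = v ++ u]: cancelling [c] in [Q] gives [v] the class of [s], then cancelling [s] in
       [R] gives [u] the class of [t]. *)
    have Qcs : Q (c ++ s) by rewrite -qE.
    have sv : theta s v by apply: (prime_cancel pQ Qcs); rewrite -q2E.
    move: Rr; rewrite rE => Rr; exists v => //; exists u => //.
    apply: (prime_cancel pR Rst); apply: (prime_theta pR Rr).
    by apply: theta_cat => //; apply: theta_sym.
  (* Beyond [r]: putting [s ++ t] back for [r] turns [q2] into a proper extension of [q] in [Q]. *)
  have := prime_prefix_code pQ Qq (u := t ++ u); rewrite qE => -H.
  suff /H : Q ((c ++ s) ++ t ++ u) by case: (t) t0.
  apply: (prime_theta pQ Qq2); rewrite q2E -!catA; apply: theta_cat => //.
  by rewrite catA; apply: theta_cat => //; apply: prime_theta2 pR _ _.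
have pa12 : prime_seq a1 /\ prime_seq a2 by apply/prime_seq_cat; rewrite -aE.
case: pa12 => pa1 pa2.
case: a1 aE a1q pa1 => [|P [|P' a1]] aE a1q pa1.
- by rewrite (_ : q = [::]) // in Qq; case: (prime_nil pQ).
- have [pP _] := (prime_seq_cons _ _).1 pa1; rewrite set_cats1 in a1q.
  have PQ : P = Q by rewrite (prime_rclass pP a1q) (prime_rclass pQ Qq).
  rewrite aE PQ; congr cons; apply: IH => //.
    move=> y a2y; have : set_cats alpha (q ++ y) by rewrite aE; apply/set_cats_cons; exists q, y.
    move=> /ab/set_cats_cons[q' [y' [eq Qq' by']]].
    have qE := prime_prefix_eq pQ Qq Qq' eq.
    by move/eqP: eq; rewrite -qE eqseq_cat // => /andP[_ /eqP ->].
  move=> c [l [r a2E]]; apply: nb; exists (P :: l), r; by rewrite aE a2E.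
- exfalso; apply: (nb (P :: P' :: a1)) => //; first by exists [::], a2.
  by rewrite (rclass_muls_mem pa1 a1q) -(prime_rclass pQ Qq).
Qed.

(* A block [beta] whose class [R] is prime satisfies $\overline\beta\subsetneq R$;
   replacing it by a word of the difference stays in [X], against prefix-freeness. *)
Lemma exact_no_prime_block alpha X : is_rclass X -> exact_factorization h L X alpha ->
  no_prime_block alpha.
Proof.
move=> cX [pa XE] beta [l [r aE]] sz2 pR; set R := rclass_muls beta in pR.
have [pl [pb pr]] : prime_seq l /\ prime_seq beta /\ prime_seq r.
  by rewrite -!prime_seq_cat -aE.
have bR : set_cats beta `<=` R.
  by move=> w bw; rewrite /R (rclass_muls_mem pb bw).
(* If $\overline\beta$ were all of [R], its first factor and the class of the rest would factor the
   prime [R]. *)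
have [Rb|] := pselect (R `<=` set_cats beta).
  case: beta sz2 @R pR aE pb bR Rb => // P beta sz2 R pR _ pb bR Rb.
  have [pP pbeta] := (prime_seq_cons _ _).1 pb.
  have [p Pp] := prime_nonempty pP; have [y bY] := set_cats_nonempty pbeta.
  apply: (@rclass_factors R p y) => //.
  - apply/predeqP => w; split=> [/Rb/set_cats_cons[x [z [-> Px bz]]]|].
      exists x; first exact: prime_theta2 pP Pp Px.
      exists z => //; rewrite -(rclass_muls_mem pbeta bY) (rclass_muls_mem pbeta bz).
      exact: theta_refl.
    move=> [x px [z yz <-]]; have : set_cats (P :: beta) (p ++ y).
      by apply/set_cats_cons; exists p, y.
    by move=> /bR Rpy; apply: (prime_theta pR Rpy); apply: theta_cat.
  - by move=> p0; rewrite p0 in Pp; case: (prime_nil pP).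
  - move=> y0; have := set_cats_size pbeta bY; rewrite y0 leqn0 size_eq0 => /eqP b0.
    by rewrite b0 in sz2.
apply=> r0 Rr0; have [b0 bb0] := set_cats_nonempty pb.
have [g lg] := set_cats_nonempty pl; have [d rd] := set_cats_nonempty pr.
have Xgbd : X (g ++ b0 ++ d).
  rewrite XE aE; apply/set_cats_cat; exists g, (b0 ++ d); split=> //.
  by apply/set_cats_cat; exists b0, d.
have : X (g ++ r0 ++ d).
  apply: (rclass_theta cX Xgbd); apply: theta_cat => //; apply: theta_cat => //.
  exact: prime_theta2 pR (bR _ bb0) Rr0.
(* Prefix-freeness of the product of [l] fixes where the middle part begins, and that of [R] where
   it ends; so the middle part is [r0] itself. *)
rewrite XE aE => /set_cats_cat[g2 [e [eq lg2 /set_cats_cat[b2 [d2 [eE bb2 _]]]]]].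
have gE := set_cats_prefix_eq pl lg lg2 eq.
move/eqP: eq; rewrite -gE eqseq_cat // eqxx eE /= => /eqP eq.
by rewrite (prime_prefix_eq pR Rr0 (bR _ bb2) eq).
Qed.

Lemma exact_unique X alpha beta : is_rclass X -> exact_factorization h L X alpha ->
  exact_factorization h L X beta -> alpha = beta.
Proof.
move=> cX ea eb; apply: set_cats_sub_eq; [exact: ea.1|exact: eb.1| |].
  by rewrite -ea.2 -eb.2.
exact: exact_no_prime_block ea.
Qed.

(** If the class of [x] is not prime, it is an exact product of two non-unit classes; [x] splits
    accordingly into two shorter live words. *)
Lemma exact_exists x : live x -> x <> [::] ->
  exists alpha, exact_factorization h L (rclass x) alpha.
Proof.
have [n] := ubnP (size x); elim: n x => // n IH x; rewrite ltnS => xn lx x0.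
have [pX|npX] := pselect (prime (rclass x)).
  exists [:: rclass x]; split; last by rewrite set_cats1.
  by move=> P; rewrite inE => /eqP ->.
have [Y [Z [cY cZ XE [Y0 Z0]]]] : exists Y Z, [/\ is_rclass Y, is_rclass Z,
    rclass x = set_cat Y Z & Y <> rclass [::] /\ Z <> rclass [::]].
  apply: contrapT => no; apply: npX; split; first exact: is_rclass_rclass.
  - by move=> y /live_theta; apply.
  - by move/rclass_nil.
  move=> Y Z cY cZ XE; apply: contrapT => /not_orP[Y0 Z0]; apply: no.
  by exists Y, Z.
have: rclass x x by [].
rewrite {1}XE => -[y Yy [z Zz xE]].
rewrite (mem_rclass cY Yy) in XE Y0; rewrite (mem_rclass cZ Zz) in XE Z0.
have y0 : y <> [::] by move=> y0; apply: Y0; rewrite y0.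
have z0 : z <> [::] by move=> z0; apply: Z0; rewrite z0.
rewrite -xE in lx xn; move: xn; rewrite size_cat => xn.
have sy : 0 < size y by case: (y) y0.
have sz : 0 < size z by case: (z) z0.
have [|a [pa aE]] := IH y _ (live_catl lx) y0; first by lia.
have [|b [pb bE]] := IH z _ (live_catr lx) z0; first by lia.
exists (a ++ b); split; first exact/prime_seq_cat.
rewrite XE aE bE; apply/predeqP => w; rewrite set_cats_cat; split.
  by move=> [u au [v bv <-]]; exists u, v.
by move=> [u [v [-> au bv]]]; exists u => //; exists v.
Qed.

(** $\overline\alpha$ is only known to lie inside the class of [w]; comparing it with an exact
    factorization [beta] of that class forces equality. *)
Lemma no_prime_block_exact alpha w : prime_seq alpha -> no_prime_block alpha ->
  set_cats alpha w -> live w -> w <> [::] -> exact_factorization h L (rclass w) alpha.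
Proof.
move=> pa nb aw lw w0; have [beta eb] := exact_exists lw w0.
rewrite (@set_cats_sub_eq alpha beta) //; first exact: eb.1.
by rewrite -eb.2 => v av; rewrite -(rclass_muls_mem pa aw) (rclass_muls_mem pa av).
Qed.

Lemma block_cons P alpha beta : block beta alpha -> block beta (P :: alpha).
Proof. by move=> [l [r ->]]; exists (P :: l), r. Qed.

Lemma valid_tail P A alpha y : valid h L P (A :: alpha) -> set_cats alpha y ->
  exact_factorization h L (rclass y) alpha.
Proof.
move=> [[pP /prime_seq_cons[pA pa] sz PE] nb] ay.
have [a Aa] := prime_nonempty pA.
have Pay : P (a ++ y).
  rewrite -PE (@rclass_muls_mem _ (a ++ y)) //; first exact/prime_seq_cons.
  by apply/set_cats_cons; exists a, y.
apply: no_prime_block_exact => //.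
(* Every block of the tail, the whole tail included, is a proper block of the right-hand side. *)
- move=> beta b sz2; apply: nb => //; split; first exact: block_cons.
  by case: b => l [r ->]; rewrite /= !size_cat ltnS; lia.
- exact: live_catr (prime_live pP Pay).
- move=> y0; have := set_cats_size pa ay; rewrite y0.
  by move: sz; rewrite /=; lia.
Qed.

Lemma valid_unique P A alpha beta : valid h L P (A :: alpha) -> valid h L P (A :: beta) ->
  alpha = beta.
Proof.
move=> va vb; have [[pP /prime_seq_cons[pA pa] _ PaE] _] := va.
have [[_ /prime_seq_cons[_ pb] _ PbE] _] := vb.
have [a Aa] := prime_nonempty pA.
have [y ay] := set_cats_nonempty pa; have [z bz] := set_cats_nonempty pb.
have Pmem g x : prime_seq g -> rclass_muls (A :: g) = P -> set_cats g x -> P (a ++ x).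
  move=> pg <- gx; rewrite (@rclass_muls_mem _ (a ++ x)) //; first exact/prime_seq_cons.
  by apply/set_cats_cons; exists a, x.
have yz : theta y z by apply: prime_cancel pP (Pmem _ _ pa PaE ay) (Pmem _ _ pb PbE bz).
apply: exact_unique (is_rclass_rclass y) (valid_tail va ay) _.
by rewrite (rclass_eq yz); apply: valid_tail vb bz.
Qed.

Lemma letter_prime a : live [:: a] -> prime (rclass [:: a]).
Proof.
move=> la; split; first exact: is_rclass_rclass.
- by move=> y /live_theta; apply.
- by move/rclass_nil.
move=> Y Z cY cZ XE; have: rclass [:: a] [:: a] by [].
rewrite {1}XE => -[[|b y] Yy [[|c z] Zz //= yz]].
- by left; apply: mem_rclass.
- by right; apply: mem_rclass.
- by case: yz; case: (y).
Qed.

Lemma set_cats_letters x : live x -> set_cats [seq rclass [:: a] | a <- x] x.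
Proof.
elim: x => // a x IH lx; apply/set_cats_cons; exists [:: a], x; split=> //.
by apply: IH; apply: live_catr (lx : live ([:: a] ++ x)).
Qed.

Lemma prime_seq_letters x : live x -> prime_seq [seq rclass [:: a] | a <- x].
Proof.
elim: x => // a x IH lx; apply/prime_seq_cons.
have lax : live ([:: a] ++ x) by [].
split; first exact: letter_prime (live_catl lax).
exact: IH (live_catr lax).
Qed.

(** A shortest prime sequence of length at least 2 for [x] is valid: a proper block of prime class
    could be merged, leaving at least two factors. The letters of [x] supply a first such
    sequence. *)
Lemma valid_parse N x : prime N -> N x -> 2 <= size x ->
  exists2 alpha, valid h L N alpha & set_cats alpha x.
Proof.
move=> pN Nx sz2; have lx := prime_live pN Nx.
pose p n := `[< exists alpha, [/\ size alpha = n, 2 <= n, prime_seq alpha & set_cats alpha x] >].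
have ex_p : exists n, p n.
  exists (size x); apply/asboolP; exists [seq rclass [:: a] | a <- x]; rewrite size_map.
  by split=> //; [exact: prime_seq_letters|exact: set_cats_letters].
have [n /asboolP[alpha [<- sza pa ax]] n_min] := ex_minnP ex_p.
exists alpha => //; split.
  by split=> //; rewrite (rclass_muls_mem pa ax) -(prime_rclass pN Nx).
move=> beta [[l [r aE]] szb] szb2 pR.
have [pl [pb pr]] : prime_seq l /\ prime_seq beta /\ prime_seq r.
  by rewrite -!prime_seq_cat -aE.
have : p (size (l ++ rclass_muls beta :: r)).
  apply/asboolP; exists (l ++ rclass_muls beta :: r); split=> //.
  - by move: szb; rewrite aE !size_cat /=; lia.
  - by apply/prime_seq_cat; split=> //; apply/prime_seq_cons.
  - move: ax; rewrite aE => /set_cats_cat[g [e [-> lg /set_cats_cat[b [d [-> bb rd]]]]]].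
    apply/set_cats_cat; exists g, (b ++ d); split=> //; apply/set_cats_cons.
    by exists b, d; split=> //; rewrite (rclass_muls_mem pb bb).
by move=> /n_min; rewrite aE !size_cat /=; lia.
Qed.

(** * The characteristic sample *)

Hypothesis hM : finite_set [set: M].
Hypothesis hL0 : ~ L [::].
Hypothesis hfin : finite_set (relative_primes h L).
Hypothesis hlex : lexically_anchored h L.

Lemma prime_name P : prime P -> exists2 a, name P = [:: a] & P [:: a].
Proof.
move=> pP; have [a Pa] := hlex pP; have [Pn /(_ _ Pa)/shortlex_le_size] := name_least Pa.
move: Pn; case: (name P) => [|b [|c n]] // Pn _; first by case: (prime_nil pP Pn).
by exists b.
Qed.

Lemma mem_name P : prime P -> P (name P).
Proof. by case/prime_name => a ->. Qed.

Lemma names_cat_mem alpha : prime_seq alpha -> set_cats alpha (names_cat alpha).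
Proof.
elim: alpha => // P alpha IH /prime_seq_cons[pP /IH pa].
by apply/set_cats_cons; exists (name P), (names_cat alpha); split=> //; apply: mem_name.
Qed.

Lemma size_names_cat alpha : prime_seq alpha -> size (names_cat alpha) = size alpha.
Proof.
elim: alpha => // P alpha IH /prime_seq_cons[pP /IH pa].
by have [a na _] := prime_name pP; rewrite /names_cat /= na /= -pa.
Qed.

(** A production is determined by its left-hand side and first symbol. A start rule is determined by
    the $h$-value of its class: words of [L] share the empty context, so equal $h$-values make them
    congruent. *)
Lemma target_rules_finite : finite_set (target_rule h L).
Proof.
pose tail PA := xget [::] [set alpha | valid h L PA.1 (PA.2 :: alpha)].
pose prod PA : rule Sigma := (Some (name PA.1), [seq NT (name B) | B <- PA.2 :: tail PA]).
pose lex Pa : rule Sigma := (Some (name Pa.1), [:: T Pa.2]).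
pose start (x : seq Sigma) : rule Sigma :=
  (None, [seq NT (name B) | B <- xget [::] [set alpha | exact_factorization h L (rclass x) alpha]]).
pose wit m := xget [::] [set x | L x /\ h x = m].
have fin : finite_set (prod @` (relative_primes h L `*` relative_primes h L) `|`
    lex @` (relative_primes h L `*` [set: Sigma]) `|` (start \o wit) @` [set: M]).
  rewrite !finite_setU; split; [split|].
  - by apply: finite_image; apply: finite_setX.
  - by apply: finite_image; apply: finite_setX => //; exact: finite_finset.
  - exact: finite_image.
apply: sub_finite_set fin => r [P alpha va|P a pP Pa|X alpha cX XL ea].
- left; left; case: alpha va => [|A alpha] va; first by case: va => -[].
  have [[pP /prime_seq_cons[pA _] _ _] _] := va.
  exists (P, A); first by split.
  rewrite /prod /tail /=; case: xgetP => [beta _ vb|/(_ alpha)] //=.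
  by rewrite (valid_unique va vb).
- by left; right; exists (P, a).
- right; have [x Xx] : X !=set0 by case: cX => x ->; exists x.
  have Lx := XL _ Xx; exists (h x) => //.
  rewrite /= /start; have [Lw hw] : L (wit (h x)) /\ h (wit (h x)) = h x.
    by rewrite /wit; case: xgetP => [y _ //|/(_ x)[]].
  have xw : theta x (wit (h x)).
    by apply: (substitute (l := [::]) (r := [::])); rewrite ?cats0 //.
  rewrite -(rclass_eq xw) -(mem_rclass cX Xx).
  case: xgetP => [beta _ eb|/(_ alpha)//].
  by rewrite (exact_unique cX ea eb).
Qed.

(** Primes are replaced by their letters, so that reachability becomes a question about paths in a
    graph on [Sigma]. *)
Definition linked : rel Sigma := fun a b => `[< exists P alpha Q,
  [/\ valid h L P alpha, Q \in alpha, name P = [:: a] & name Q = [:: b]] >].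

Definition start_letter (a : Sigma) : Prop := exists X alpha Q,
  [/\ is_rclass X, X `<=` L, exact_factorization h L X alpha, Q \in alpha & name Q = [:: a]].

Lemma valid_names P alpha : valid h L P alpha -> P (names_cat alpha).
Proof.
by move=> [[pP pa _ <-] _]; rewrite (rclass_muls_mem pa (names_cat_mem pa)).
Qed.

(** The letter of [P] is followed down through valid parses. The factor holding it gets strictly
    shorter, since a parse has at least two nonempty factors; at length one it is [P]. *)
Lemma linked_letter P a l r Q b : prime P -> name P = [:: a] -> prime Q -> name Q = [:: b] ->
  Q (l ++ a :: r) -> connect linked b a.
Proof.
move=> pP nP; have [n] := ubnP (size (l ++ a :: r)).
elim: n l r Q b => // n IH l r Q b; rewrite ltnS => szn pQ nQ Qlar.
have [sz2|sz1] := leqP 2 (size (l ++ a :: r)); last first.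
  have [l0 r0] : l = [::] /\ r = [::].
    by move: sz1; rewrite size_cat /=; case: (l) => [|? ?]; case: (r) => [|? ?] //=; lia.
  have Pa : P [:: a] by rewrite -nP; apply: mem_name.
  rewrite l0 r0 /= in Qlar; have PQ : P = Q by rewrite (prime_rclass pP Pa) (prime_rclass pQ Qlar).
  by move: nP; rewrite PQ nQ => -[->]; apply: connect0.
have [alpha va aw] := valid_parse pQ Qlar sz2.
have [a1 [R [a2 [l' [r' [x [y [aE Rw a1x a2y wE]]]]]]]] := set_cats_letter aw.
have [[_ pa sza _] _] := va.
have [pa1 /prime_seq_cons[pR pa2]] : prime_seq a1 /\ prime_seq (R :: a2).
  by apply/prime_seq_cat; rewrite -aE.
have [c nR _] := prime_name pR.
apply: (@connect_trans _ _ c).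
  apply: connect1; apply/asboolP; exists Q, alpha, R; split=> //.
  by rewrite aE mem_cat mem_head orbT.
apply: (IH l' r' R) => //; move: szn; rewrite wE !size_cat.
have := set_cats_size pa1 a1x; have := set_cats_size pa2 a2y.
by move: sza; rewrite aE size_cat /=; lia.
Qed.

Lemma prime_reachable P a : prime P -> name P = [:: a] ->
  exists2 b, start_letter b & connect linked b a.
Proof.
move=> pP nP; have Pa : P [:: a] by rewrite -nP; apply: mem_name.
have [[l r] /= Llar] := prime_live pP Pa; rewrite /contexts /= in Llar.
have lw : live (l ++ a :: r) by exists ([::], [::]); rewrite /contexts /= cats0.
have [alpha ea] := exact_exists lw ltac:(by case: (l)).
have /set_cats_letter : set_cats alpha (l ++ a :: r) by rewrite -ea.2.
move=> [a1 [R [a2 [l' [r' [x [y [aE Rw _ _ _]]]]]]]].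
have pR : prime R by apply: ea.1; rewrite aE mem_cat mem_head orbT.
have [b nR _] := prime_name pR; exists b; last exact: linked_letter pP nP pR nR Rw.
exists (rclass (l ++ a :: r)), alpha, R; split=> //; first exact: is_rclass_rclass.
  move=> w lw'; have := theta_L (l := [::]) (r := [::]) lw'.
  by rewrite !cats0; apply.
by rewrite aE mem_cat mem_head orbT.
Qed.

Definition has_context (k : nat) (a : Sigma) : Prop :=
  exists l r, L (l ++ a :: r) /\ size l + size r <= k.

Lemma listing_exists : exists g, lists (target_grammar h L) g.
Proof.
pose N : set (nonterminal Sigma) := nonterminals (target_grammar h L).
have Nfin : finite_set N.
  have fin : finite_set ([set None] `|` (fun P => Some (name P)) @` relative_primes h L).
    by rewrite finite_setU; split; [exact: finite_set1|exact: finite_image].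
  by apply: sub_finite_set fin => n [->|[P pP ->]]; [left|right; exists P].
exists ((fset_set N : seq _), (fset_set (target_rule h L) : seq _)); split; rewrite ?fset_uniq //=.
  by move=> n; rewrite in_fset_set //; split; rewrite inE.
by move=> r; rewrite in_fset_set ?inE; [split|exact: target_rules_finite].
Qed.

Section Listing.
Variable g : listing Sigma.
Hypothesis g_lists : lists (target_grammar h L) g.

Lemma rule_size_names n alpha : prime_seq alpha ->
  rule_size (n, [seq NT (name A) | A <- alpha]) = nonterminal_size n + size alpha.
Proof.
move=> pa; rewrite /rule_size /=; congr addn; rewrite -(size_names_cat pa).
by rewrite /names_cat size_flatten sumnE !big_map.
Qed.

Lemma rule_size_le r : r \in g.2 -> rule_size r <= listing_size g.
Proof.
move=> rg; rewrite /listing_size (big_rem r rg) /=; apply: leq_trans (leq_addl _ _).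
exact: leq_addr.
Qed.

Lemma names_context alpha Q a : prime_seq alpha -> Q \in alpha -> name Q = [:: a] ->
  exists l r, names_cat alpha = l ++ a :: r /\ size l + size r < size alpha.
Proof.
move=> pa Qa nQ; case/splitPr: Qa pa => a1 a2 pa.
exists (names_cat a1), (names_cat a2).
have nE : names_cat (a1 ++ Q :: a2) = names_cat a1 ++ a :: names_cat a2.
  by rewrite /names_cat map_cat flatten_cat /= nQ.
split=> //; rewrite -(size_names_cat pa) nE size_cat /=; lia.
Qed.

Lemma valid_size P alpha : valid h L P alpha -> size alpha <= listing_size g.
Proof.
move=> va; have [[pP pa _ _] _] := va; have [_ _ _ mem_g] := g_lists.
have /mem_g/rule_size_le : target_rule h L (Some (name P), [seq NT (name A) | A <- alpha]).
  exact: target_production.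
by rewrite (rule_size_names _ pa); lia.
Qed.

Lemma start_size X alpha : is_rclass X -> X `<=` L -> exact_factorization h L X alpha ->
  size alpha <= listing_size g.
Proof.
move=> cX XL ea; have [pa _] := ea; have [_ _ _ mem_g] := g_lists.
have /mem_g/rule_size_le : target_rule h L (None, [seq NT (name A) | A <- alpha]).
  exact: target_start ea.
by rewrite (rule_size_names _ pa); lia.
Qed.

Lemma start_letter_context a : start_letter a -> has_context (listing_size g) a.
Proof.
move=> [X [alpha [Q [cX XL ea Qa nQ]]]]; have [pa XE] := ea.
have [l [r [nE sz]]] := names_context pa Qa nQ.
exists l, r; split; last by have := start_size cX XL ea; lia.
by rewrite -nE; apply: XL; rewrite XE; apply: names_cat_mem.
Qed.

(** The letter [a] is replaced in its context by a congruent right-hand side; the context of the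
    next letter grows by the other symbols of that side. *)
Lemma path_context p a k : has_context k a -> path linked a p ->
  has_context (k + size p * listing_size g) (last a p).
Proof.
elim: p a k => [|b p IH] a k ca /=; first by rewrite addn0.
case/andP => /asboolP[P [alpha [Q [va Qa nP nQ]]]] pp.
rewrite mulSn addnA; apply: IH => //.
have [[pP pa _ _] _] := va; have [l [r [nE sz]]] := names_context pa Qa nQ.
have [l' [r' [Lar sz']]] := ca.
exists (l' ++ l), (r ++ r'); split; last first.
  by have := valid_size va; rewrite !size_cat; lia.
have Pa : P [:: a] by rewrite -nP; apply: mem_name.
have := theta_L (l := l') (r := r') (prime_theta2 pP Pa (valid_names va)).
by rewrite nE -!catA /=; apply.
Qed.

Lemma prime_context P a : prime P -> name P = [:: a] ->
  has_context (#|Sigma|.+1 * listing_size g) a.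
Proof.
move=> pP nP; have [b sb /connectP[p pp aE]] := prime_reachable pP nP.
(* On a path without repetition the number of edges is at most $|\Sigma|$; the start rule accounts
   for one more summand. *)
move: aE; case: (shortenP pp) => p' pp' up' _ ->.
have [l [r [Lar sz]]] := path_context (start_letter_context sb) pp'.
exists l, r; split=> //; apply: leq_trans sz _; rewrite -mulSn leq_mul2r.
have := max_card (mem (b :: p')); rewrite (card_uniqP up') /= => /ltnW sz'.
by rewrite ltnS sz' orbT.
Qed.

(** Chosen so that every right-hand side, placed in the context of its left-hand side, is a word of
    [L]; for the start symbol this context is empty. *)
Definition context_of (n : nonterminal Sigma) : seq Sigma * seq Sigma :=
  if n is Some [:: a] then
    xget ([::], [::]) [set c | L (c.1 ++ a :: c.2) /\
      size c.1 + size c.2 <= #|Sigma|.+1 * listing_size g]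
  else ([::], [::]).

Definition word_of_rhs (s : seq (symbol Sigma)) : seq Sigma :=
  flatten [seq match c with inl (Some w) => w | inl None => [::] | inr a => [:: a] end | c <- s].

Definition rule_word (r : rule Sigma) : seq Sigma :=
  (context_of r.1).1 ++ word_of_rhs r.2 ++ (context_of r.1).2.

Definition charset : {fset (seq Sigma)} := [fset x in [seq rule_word r | r <- g.2]]%fset.

Lemma context_ofP P : prime P ->
  L ((context_of (Some (name P))).1 ++ name P ++ (context_of (Some (name P))).2).
Proof.
move=> pP; have [a nP _] := prime_name pP; rewrite nP /=.
have [l [r [Lar sz]]] := prime_context pP nP.
by case: xgetP => [c _ []//|/(_ (l, r))[]].
Qed.

Lemma context_of_size n :
  size (context_of n).1 + size (context_of n).2 <= #|Sigma|.+1 * listing_size g.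
Proof.
case: n => [[|a [|b w]]|] //=; by case: xgetP => [c _ []|].
Qed.

Lemma word_of_names alpha : word_of_rhs [seq NT (name A) | A <- alpha] = names_cat alpha.
Proof. by rewrite /word_of_rhs -map_comp. Qed.

Lemma charset_rule r : target_rule h L r -> rule_word r \in charset.
Proof.
have [_ _ _ mem_g] := g_lists; move=> /mem_g rg.
by rewrite in_fset; apply/mapP; exists r.
Qed.

Lemma prime_in_context P w : prime P -> P w ->
  L ((context_of (Some (name P))).1 ++ w ++ (context_of (Some (name P))).2).
Proof.
move=> pP Pw; apply: theta_L (context_ofP pP).
exact: prime_theta2 pP (mem_name pP) Pw.
Qed.

Lemma charset_sub w : w \in charset -> L w.
Proof.
have [_ _ _ mem_g] := g_lists.
rewrite in_fset => /mapP[r /mem_g tr ->].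
case: tr => [P alpha va|P a pP Pa|X alpha cX XL [pa XE]]; rewrite /rule_word /= ?word_of_names.
- have [[pP _ _ _] _] := va; exact: prime_in_context (valid_names va).
- exact: prime_in_context Pa.
- by rewrite cats0; apply: XL; rewrite XE; apply: names_cat_mem.
Qed.

Lemma size_charset :
  sample_size charset <= listing_size g * (#|Sigma|.+1 * listing_size g) + listing_size g.
Proof.
have le_word (r : rule Sigma) : r \in g.2 ->
    size (rule_word r) <= #|Sigma|.+1 * listing_size g + rule_size r.
  move=> rg; rewrite /rule_word !size_cat; have := context_of_size r.1.
  move: (#|Sigma|.+1 * _) => K.
  suff : size (word_of_rhs r.2) <= rule_size r by lia.
  rewrite /rule_size /word_of_rhs size_flatten sumnE !big_map.
  apply: leq_trans (leq_addl _ _); apply: leq_sum => s _; by case: s => [[w|]|a].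
(* Rules have positive size, so their number is at most the size of the listing. *)
have rule_gt0 (r : rule Sigma) : r \in g.2 -> 0 < rule_size r.
  have [_ _ _ mem_g] := g_lists; move=> /mem_g tr; rewrite /rule_size addn_gt0.
  case: tr => [P alpha [[pP _ _ _] _]|P a pP _|X alpha _ _ _] //=.
    by have [a -> _] := prime_name pP.
  by have [b -> _] := prime_name pP.
have size_g : size g.2 <= listing_size g.
  rewrite /listing_size; apply: leq_trans (leq_addl _ _).
  rewrite -sum1_size big_seq [leqRHS]big_seq; exact: leq_sum.
apply: (@leq_trans (\sum_(r <- g.2) size (rule_word r))).
  rewrite /sample_size -(big_map rule_word predT size).
  (* Different rules may spell the same word, so the sample is no larger than the sum over the
     rules. *)
  have cs_perm : perm_eq charset (undup [seq rule_word r | r <- g.2]).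
    by apply: uniq_perm => [||w]; rewrite ?undup_uniq ?fset_uniq ?mem_undup ?in_fset.
  rewrite (perm_big _ cs_perm) /=.
  elim: [seq _ | _ <- _] => //= w s IH; rewrite big_cons.
  by case: ifP => _; rewrite ?big_cons ?leq_add2l ?(leq_trans IH) ?leq_addl.
apply: (@leq_trans (\sum_(r <- g.2) (#|Sigma|.+1 * listing_size g + rule_size r))).
  by rewrite big_seq [leqRHS]big_seq; apply: leq_sum.
rewrite big_split /= leq_add //; last exact: leq_addl.
by rewrite big_const_seq count_predT iter_addn_0 mulnC leq_mul2r size_g orbT.
Qed.

(** * Convergence of the learner *)

Variables (sel : @selector disp Sigma) (D : {fset (seq Sigma)}).
Hypothesis D_sel : admissible_on h sel D.
Hypothesis D_charset : forall w, w \in charset -> w \in D.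
Hypothesis D_L : forall w, w \in D -> L w.

Notation observed := (observed D).
Notation oclass := (oclass h sel D).
Notation is_oclass := (is_oclass h sel D).
Notation declared := (declared_prime h sel D).

Lemma yields_theta u x : yields h D u x -> theta u x.
Proof.
elim=> {u x} [a _|u v x y _ _ _ _ ux _ vy|u v x _ _ huv [l [r [lur lvr]]] _ vx].
- exact: theta_refl.
- exact: theta_cat.
- apply: theta_trans vx; exact: substitute huv (D_L lur) (D_L lvr).
Qed.

Lemma observed_live u : observed u -> live u.
Proof. by move=> [_ [w wD /infixP[l [r wE]]]]; exists (l, r); move: (D_L wD); rewrite wE. Qed.

Lemma observed_nil u : observed u -> u <> [::]. Proof. by case. Qed.

Lemma observed_in l u r : l ++ u ++ r \in D -> u <> [::] -> observed u.
Proof. by move=> lur u0; split=> //; exists (l ++ u ++ r) => //; apply: infix_infix. Qed.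

(** All suffixes of the spelled sequence are observed, so cuts of [W] separate its names one by one.
    The size condition records that each other factor takes at least one letter: with two or more
    factors, each [y] is shorter than [x]. *)
Lemma yields_names alpha x : prime_seq alpha -> alpha <> [::] -> observed (names_cat alpha) ->
  set_cats alpha x ->
  (forall B y, B \in alpha -> B y -> size y + size alpha <= (size x).+1 -> yields h D (name B) y) ->
  yields h D (names_cat alpha) x.
Proof.
elim: alpha x => [//|B [|C alpha] IH] x /prime_seq_cons[pB pa] _ oa.
  rewrite set_cats1 => Bx yB; rewrite /names_cat /= cats0; apply: yB => //.
    exact: mem_head.
  by rewrite addn1.
move=> /set_cats_cons[y [z [xE By az]]] yB.
have szz := set_cats_size pa az.
have szy : 0 < size y by case: (y) By => // /(prime_nil pB).
have oa' : observed (name B ++ names_cat (C :: alpha)) by [].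
have ob : observed (name B).
  by apply: observed_catl oa' _ => n0; case: (prime_nil pB); rewrite -n0; exact: mem_name.
have oc : observed (names_cat (C :: alpha)).
  apply: observed_catr oa' _ => n0; have := set_cats_size pa (names_cat_mem pa).
  by rewrite n0.
rewrite -[names_cat _]/(name B ++ names_cat (C :: alpha)) xE; apply: yields_cut => //.
  apply: yB => //; first exact: mem_head.
  by rewrite xE size_cat /=; move: szz; rewrite /=; lia.
apply: IH => // B' y' B'a B'y' sz; apply: yB => //; first by rewrite inE B'a orbT.
by rewrite xE size_cat /=; move: sz; rewrite /=; lia.
Qed.

Lemma letter_in_D P b : prime P -> P [:: b] ->
  (context_of (Some (name P))).1 ++ [:: b] ++ (context_of (Some (name P))).2 \in D.
Proof.
by move=> pP Pb; apply: D_charset; apply: (charset_rule (target_lexical pP Pb)).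
Qed.

Lemma letter_observed P b : prime P -> P [:: b] -> observed [:: b].
Proof. by move=> pP /(letter_in_D pP)/observed_in; apply. Qed.

Lemma name_observed P : prime P -> observed (name P).
Proof. by move=> pP; have [a -> Pa] := prime_name pP; exact: letter_observed pP Pa. Qed.

(** The lexical rules place all letters of [P] in one common context of the sample. *)
Lemma letter_yields P b : prime P -> P [:: b] -> yields h D (name P) [:: b].
Proof.
move=> pP Pb; have [a nP Pa] := prime_name pP; have ob := letter_observed pP Pb.
rewrite nP; apply: yields_unary (letter_observed pP Pa) ob _ _ (yields_letter h ob).
  by have [] := prime_theta2 pP Pa Pb.
exists (context_of (Some (name P))).1, (context_of (Some (name P))).2.
by split; exact: letter_in_D.
Qed.

Lemma valid_in_D P alpha : valid h L P alpha ->
  (context_of (Some (name P))).1 ++ names_cat alpha ++ (context_of (Some (name P))).2 \in D.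
Proof.
move=> va; apply: D_charset; rewrite -word_of_names.
exact: (charset_rule (target_production va)).
Qed.

Lemma names_cat_nil alpha : prime_seq alpha -> names_cat alpha = [::] -> alpha = [::].
Proof.
move=> pa n0; have := set_cats_size pa (names_cat_mem pa); rewrite n0.
by case: (alpha).
Qed.

Lemma valid_observed P alpha : valid h L P alpha -> observed (names_cat alpha).
Proof.
move=> va; have [[_ pa sza _] _] := va; apply: observed_in (valid_in_D va) _.
by move=> /(names_cat_nil pa) a0; rewrite a0 in sza.
Qed.

(** A valid parse is simulated: the sample has the name of [N] and the spelled right-hand side in
    the same context, so a unary rule leads from one to the other. Its factors are shorter than [x],
    and induction applies. *)
Lemma prime_yields N x : prime N -> N x -> yields h D (name N) x.
Proof.
have [n] := ubnP (size x); elim: n N x => // n IH N x; rewrite ltnS => szx pN Nx.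
have [sz2|sz1] := leqP 2 (size x); last first.
  case: x Nx sz1 {szx} => [/(prime_nil pN)//|b [|c x]] // Nb _.
  exact: letter_yields.
have [alpha va ax] := valid_parse pN Nx sz2.
have [[_ pa sza _] _] := va; have a0 : alpha <> [::] by move=> a0; rewrite a0 in sza.
have oa := valid_observed va.
have ya : yields h D (names_cat alpha) x.
  apply: yields_names => // B y Ba By sz; apply: IH => //; last exact: pa.
  lia.
have [b nN Nb] := prime_name pN.
apply: yields_unary (name_observed pN) oa _ _ ya.
  by have [] := prime_theta2 pN (mem_name pN) (valid_names va).
exists (context_of (Some (name N))).1, (context_of (Some (name N))).2.
split; last exact: valid_in_D.
by rewrite [X in _ ++ X ++ _]nN; exact: letter_in_D.
Qed.

Lemma start_observed X alpha : is_rclass X -> X `<=` L -> exact_factorization h L X alpha ->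
  names_cat alpha \in D /\ observed (names_cat alpha).
Proof.
move=> cX XL ea; have [pa XE] := ea; have inD : names_cat alpha \in D.
  apply: D_charset; rewrite -word_of_names.
  by have := charset_rule (target_start cX XL ea); rewrite /rule_word /= cats0.
split=> //; apply: (@observed_in [::] _ [::]); rewrite ?cats0 // => /(names_cat_nil pa) a0.
by apply: hL0; apply: XL; rewrite XE a0.
Qed.

Lemma generated_L w : generated (W h D) w <-> L w.
Proof.
rewrite generated_W; split.
  move=> [d dD /yields_theta dw]; have := theta_L (l := [::]) (r := [::]) dw.
  by rewrite !cats0; apply; exact: D_L.
move=> Lw; have w0 : w <> [::] by move=> w0; apply: hL0; rewrite -w0.
have lw : live w by exists ([::], [::]); rewrite /contexts /= cats0.
have [alpha [pa XE]] := exact_exists lw w0.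
have aw : set_cats alpha w by rewrite -XE.
have XL : rclass w `<=` L.
  by move=> v wv; have := theta_L (l := [::]) (r := [::]) wv; rewrite !cats0; apply.
have a0 : alpha <> [::] by move=> a0; rewrite a0 in aw.
have [inD on] := start_observed (is_rclass_rclass w) XL (conj pa XE).
exists (names_cat alpha) => //; apply: yields_names => //.
by move=> B y Ba By _; apply: prime_yields => //; exact: pa.
Qed.

Lemma accepts_L x z : accepts h sel D x z <-> L (in_context sel D x z).
Proof. exact: generated_L. Qed.

Lemma in_context_L u : observed u -> L (in_context sel D u u).
Proof. by have [inD _] := D_sel; move=> /inD; apply: D_L. Qed.

(** Of the whole signature, the test in the context chosen for [u] already yields congruence. *)
Lemma oclassP u v : observed u -> oclass u v <-> observed v /\ theta u v.
Proof.
move=> ou; split.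
  move=> [ov hvu acc]; split=> //; apply: substitute (esym hvu) (in_context_L ou) _.
  by apply/accepts_L/acc => //; apply/accepts_L; exact: in_context_L.
move=> [ov uv]; split=> //; first by case: uv.
move=> x ox; rewrite !accepts_L; split; apply: theta_L => //; exact: theta_sym.
Qed.

Lemma oclass_name u : observed u -> observed (name (oclass u)) /\ theta u (name (oclass u)).
Proof. by move=> ou; apply/oclassP => //; have [] := name_least (oclass_refl h sel ou). Qed.

Lemma class_testP u z : observed u -> class_test h sel D z (oclass u) <-> theta u z.
Proof.
move=> ou; have [on un] := oclass_name ou; rewrite /class_test accepts_L; split.
  move=> [hz Lz]; apply: theta_trans un _; apply: substitute (esym hz) (in_context_L on) Lz.
move=> uz; have nz : theta (name (oclass u)) z by apply: theta_trans uz; apply: theta_sym.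
by split; [case: nz|apply: theta_L nz (in_context_L on)].
Qed.

(** The least word of the full class is a letter that the sample exhibits, so restriction to
    observed words keeps the name. *)
Lemma name_oclass_prime u : observed u -> prime (rclass u) -> name (oclass u) = name (rclass u).
Proof.
move=> ou pu; apply: nameP; split.
  by apply/oclassP => //; split; [exact: name_observed|exact: mem_name].
move=> v /(oclassP _ ou)[_ uv].
have [_ least] := name_least (X := rclass u) (u := v) uv; exact: least.
Qed.

(** A prime has a one-letter representative, which has no cut to test. Otherwise an exact
    factorization cuts the representative after its first factor, and all members of the class admit
    a cut into the same two classes. *)
Lemma declared_primeP u : observed u -> declared (oclass u) <-> prime (rclass u).
Proof.
move=> ou; split=> [[_ cut]|pu]; last first.
  split; first exact: is_oclass_oclass.
  move=> x y Y Z nE x0 y0; have := name_oclass_prime ou pu.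
  have [a -> _] := prime_name pu; rewrite nE.
  by case: x x0 {nE} => // b [|c x]; case: y y0.
have [ln un] := oclass_name ou; have lu := observed_live ou.
apply: contrapT => npu.
have [alpha ea] := exact_exists lu (observed_nil ou).
have [pa XE] := ea.
case: alpha pa XE {ea} => [|P [|Q alpha]] pa XE.
- have : rclass u u by []. by rewrite XE => /(observed_nil ou).
- by apply: npu; rewrite XE set_cats1; apply: pa; rewrite mem_head.
have cut_mem w : theta u w -> exists x y, [/\ w = x ++ y, P x & set_cats (Q :: alpha) y].
  by move=> uw; apply/set_cats_cons; rewrite -XE.
have [pP pQ] := (prime_seq_cons _ _).1 pa.
have [x [y [nE Px ay]]] := cut_mem _ un.
have x0 : x <> [::] by move=> x0; rewrite x0 in Px; case: (prime_nil pP).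
have y0 : y <> [::] by move=> y0; have := set_cats_size pQ ay; rewrite y0.
have on : observed (x ++ y) by rewrite -nE.
have ox := observed_catl on x0; have oy := observed_catr on y0.
have [z uz] := cut _ _ _ _ nE x0 y0 (is_oclass_oclass h sel ox) (oclass_refl h sel ox)
  (is_oclass_oclass h sel oy) (oclass_refl h sel oy).
apply; have /cut_mem[x' [y' [-> Px' ay']]] : theta u z by case/(oclassP _ ou): uz.
exists x', y'; split=> //; apply/class_testP => //; first exact: prime_theta2 pP Px Px'.
rewrite -[theta _ _]/(rclass y y') -(rclass_muls_mem pQ ay) (rclass_muls_mem pQ ay').
exact: theta_refl.
Qed.

Lemma path_ltn_last i p : path ltn i p -> i <= last i p.
Proof.
by elim: p i => //= j p IH i /andP[ij /IH]; apply: leq_trans; apply: ltnW.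
Qed.

Lemma flatten_segments w i p : path ltn i p ->
  flatten (pairmap (segment w) i p) = segment w i (last i p).
Proof.
elim: p i => [|j p IH] i /=; first by rewrite /segment subnn take0.
case/andP => ij pj; rewrite (IH _ pj) /segment.
have jl := path_ltn_last pj.
have -> : last j p - i = (j - i) + (last j p - j) by lia.
by rewrite takeD drop_drop subnK // ltnW.
Qed.

Lemma edge_lt w : subrel (fun i j => `[< edge h sel D w i j >]) ltn.
Proof. by move=> i j /asboolP[/andP[]]. Qed.

Lemma edgeP w i j : observed w -> edge h sel D w i j <->
  [/\ i < j, j <= size w & prime (rclass (segment w i j))].
Proof.
move=> ow; have oseg := @observed_segment _ _ D w i j ow.
split=> [[/andP[ij jw] [P dP Ps]]|[ij jw ps]].
  split=> //; apply/declared_primeP; first exact: oseg.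
  by rewrite -(is_oclass_eq dP.1 Ps).
split; first by rewrite ij.
by exists (oclass (segment w i j)); [apply/declared_primeP => //|apply: oclass_refl]; exact: oseg.
Qed.

Lemma factor_path_primes w i p : observed w ->
  path (fun i j => `[< edge h sel D w i j >]) i p ->
  forall v, v \in pairmap (segment w) i p -> observed v /\ prime (rclass v).
Proof.
move=> ow; elim: p i => //= j p IH i /andP[/asboolP e pj] v.
rewrite inE => /predU1P[->|/(IH _ pj)//].
have [_ [P dP Ps]] := e; have [_ _ ps] := (edgeP _ _ ow).1 e.
by split=> //; have := Ps; rewrite (is_oclass_eq dP.1 Ps) => -[].
Qed.

(* Merging a block with prime class into one edge would shorten a minimum-edge
   path, so such a path reads off an exact factorization. *)
Lemma alpha_ofP u : observed u -> exists vs,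
  [/\ alpha_of h sel D (oclass u) = [seq oclass v | v <- vs],
      forall v, v \in vs -> observed v /\ prime (rclass v) &
      exact_factorization h L (rclass u) [seq rclass v | v <- vs]].
Proof.
move=> ou; have [ow uw] := oclass_name ou; set w := name (oclass u) in ow uw.
have [_ /(_ _ ow)] := D_sel; rewrite /alpha_of -/w; set p := sel_path sel D w.
move=> [[pp pl] p_min]; set vs := pairmap (segment w) 0 p.
have vs_prime := factor_path_primes ow pp.
exists vs; split=> //.
  by rewrite /path_classes /vs; elim: (p) 0 => //= j q IH i; rewrite IH.
have pa : prime_seq [seq rclass v | v <- vs] by move=> P /mapP[v /vs_prime[_ pv] ->].
have cats_flatten (ws : seq (seq Sigma)) : set_cats [seq rclass v | v <- ws] (flatten ws).
  elim: ws => // v ws IH; apply/set_cats_cons; by exists v, (flatten ws).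
have aw : set_cats [seq rclass v | v <- vs] w.
  have <- : flatten vs = w; last exact: cats_flatten.
  rewrite /vs flatten_segments; last exact: sub_path (@edge_lt w) _ _ pp.
  by rewrite pl /segment drop0 subn0 take_size.
rewrite (rclass_eq uw); apply: no_prime_block_exact => //; last first.
- exact: observed_nil.
- exact: observed_live.
move=> beta [l [r vsE]] sz2 pb.
pose p1 := take (size l) p; pose p2 := take (size beta) (drop (size l) p).
pose p3 := drop (size beta) (drop (size l) p).
have pE : p = p1 ++ p2 ++ p3 by rewrite !cat_take_drop.
have sz_vs : size l + (size beta + size r) = size p.
  by rewrite -!size_cat -vsE size_map size_pairmap.
have sz1 : size p1 = size l by rewrite size_takel //; lia.
have sz2' : size p2 = size beta by rewrite size_takel // size_drop; lia.
have pairmap_cat (f : nat -> nat -> seq Sigma) i q q' :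
    pairmap f i (q ++ q') = pairmap f i q ++ pairmap f (last i q) q'.
  by elim: q i => //= j q IH i; rewrite IH.
have bE : beta = [seq rclass v | v <- pairmap (segment w) (last 0 p1) p2].
  have : drop (size l) [seq rclass v | v <- vs] = beta ++ r by rewrite vsE drop_size_cat.
  rewrite /vs pE pairmap_cat map_cat drop_size_cat ?size_map ?size_pairmap // => H.
  have : take (size beta) (beta ++ r) = beta by rewrite take_size_cat.
  by rewrite -H pairmap_cat map_cat take_size_cat // size_map size_pairmap.
set i := last 0 p1 in bE; set j := last i p2.
move: pp pl; rewrite pE !cat_path !last_cat -/i -/j => /and3P[pp1 pp2 pp3] pl.
have j_le : j <= size w by rewrite -pl; apply/path_ltn_last/(sub_path (@edge_lt w) pp3).
have i_lt : i < j.
  move: pp2 @j sz2' {pp3 pl bE pE j_le} => /(sub_path (@edge_lt w)).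
  case: p2 => [|k q] /=; first by move=> _ s0; rewrite -s0 in sz2.
  by case/andP => ik /path_ltn_last kl _; exact: leq_trans ik kl.
have seg : flatten (pairmap (segment w) i p2) = segment w i j.
  exact: flatten_segments (sub_path (@edge_lt w) pp2).
have eij : `[< edge h sel D w i j >].
  apply/asboolP/edgeP => //; split=> //.
  rewrite -(rclass_muls_mem (alpha := beta)) //.
    by move=> P Pb; apply: pa; rewrite vsE !mem_cat Pb orbT.
  by rewrite bE -seg; exact: cats_flatten.
(* The vertices [p2] of the block, at least two, are replaced by the last of them. *)
have := p_min (p1 ++ j :: p3); rewrite pE !size_cat /= sz2'.
suff : factor_path h sel D w (p1 ++ j :: p3) by move=> f /(_ f); lia.
split; first by rewrite cat_path pp1 /= -/i eij.
by rewrite last_cat.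
Qed.

Notation prime_words ws := (forall v, v \in ws -> observed v /\ prime (rclass v)).

Lemma names_oclass (ws : seq (seq Sigma)) : prime_words ws ->
  [seq name B | B <- [seq oclass v | v <- ws]] = [seq name B | B <- [seq rclass v | v <- ws]].
Proof.
by move=> pw; rewrite -!map_comp; apply/eq_in_map => v /pw[ov pv]; apply: name_oclass_prime.
Qed.

Lemma prime_words_seq (ws : seq (seq Sigma)) : prime_words ws ->
  prime_seq [seq rclass v | v <- ws].
Proof. by move=> pw P /mapP[v /pw[_ pv] ->]. Qed.

Lemma class_test_names (bs : seq (seq Sigma)) u : prime_words bs -> observed u ->
  class_test h sel D (names_cat [seq oclass v | v <- bs]) (oclass u) <->
  rclass_muls [seq rclass v | v <- bs] = rclass u.
Proof.
move=> pw ou; rewrite class_testP // /names_cat names_oclass // -/(names_cat _).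
have pb := prime_words_seq pw.
rewrite (rclass_muls_mem pb (names_cat_mem pb)); split=> [/rclass_eq -> //|E].
by rewrite -[theta _ _]/(rclass u _) -E; apply: theta_refl.
Qed.

Lemma prime_oclass_name P : prime P ->
  [/\ declared (oclass (name P)), name (oclass (name P)) = name P & rclass (name P) = P].
Proof.
move=> pP; have PE := esym (prime_rclass pP (mem_name pP)).
have on := name_observed pP.
split=> //; first by apply/declared_primeP; rewrite ?PE.
by rewrite name_oclass_prime ?PE.
Qed.

(** The learner tests blocks against declared primes only, but every relative prime is declared
    under its own letter, so no forbidden block escapes. *)
Lemma kept_valid n (ws : seq (seq Sigma)) : observed n -> prime (rclass n) ->
  prime_words ws -> 2 <= size ws ->
  kept h sel D (oclass n) [seq oclass v | v <- ws] <->
  valid h L (rclass n) [seq rclass v | v <- ws].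
Proof.
move=> on pn pw sz2; rewrite /kept (class_test_names pw on).
have sub_words (bs : seq (seq Sigma)) : block bs ws -> prime_words bs.
  by move=> [l [r wsE]] v vb; apply: pw; rewrite wsE !mem_cat vb orbT.
split.
  move=> [nE blocks]; split.
    by split; rewrite ?size_map //; exact: prime_words_seq.
  move=> _ [/block_map[bs -> bws]]; rewrite !size_map => szb sz2b pR.
  have [dR _ RE] := prime_oclass_name pR.
  apply: (blocks [seq oclass v | v <- bs] _ _ _ dR); rewrite ?size_map //.
    by split; [exact: map_block|rewrite !size_map].
  by apply/class_test_names; [exact: sub_words|exact: name_observed|rewrite RE].
move=> [[_ _ _ nE] blocks]; split=> //.
move=> _ P [/block_map[bs -> bws]]; rewrite !size_map => szb sz2b dP.
have [[p op PE] _] := dP; rewrite PE in dP *.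
move/(class_test_names (sub_words _ bws) op) => RE.
apply: (blocks [seq rclass v | v <- bs]); rewrite ?size_map //.
  by split; [exact: map_block|rewrite !size_map].
by rewrite RE; apply/declared_primeP.
Qed.

Lemma declared_primeE P : declared P ->
  exists u, [/\ observed u, prime (rclass u), P = oclass u & name P = name (rclass u)].
Proof.
move=> dP; have [[u ou PE] _] := dP; exists u; rewrite PE in dP *.
by have pu := (declared_primeP ou).1 dP; split=> //; apply: name_oclass_prime.
Qed.

Lemma alpha_of_names u alpha : observed u -> exact_factorization h L (rclass u) alpha ->
  [seq NT (name B) | B <- alpha_of h sel D (oclass u)] = [seq NT (name A) | A <- alpha].
Proof.
move=> ou ea; have [vs [-> pvs evs]] := alpha_ofP ou.
rewrite (exact_unique (is_rclass_rclass u) ea evs).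
by rewrite ![map (fun B => NT (name B)) _](map_comp (@NT _ _) name) names_oclass.
Qed.

Lemma learned_rule_target r : learned_rule h sel D r -> target_rule h L r.
Proof.
case=> {r} [N A Q dN dA [q oq ->] kN|P a dP Pa|w wD].
- have [n [on pn NE nN]] := declared_primeE dN.
  have [a [oa pa AE nA]] := declared_primeE dA.
  have [vs [vsE pvs [pseq qE]]] := alpha_ofP oq.
  have pw : prime_words (a :: vs) by move=> v; rewrite inE => /predU1P[->|/pvs].
  have sz2 : 2 <= size (a :: vs).
    case: vs qE {vsE pvs pseq pw} => // qE; have : rclass q q by [].
    by rewrite qE => /(observed_nil oq).
  move: kN; rewrite vsE NE AE => /(kept_valid on pn pw sz2) va.
  have := target_production va; rewrite /= (name_oclass_prime on pn) (name_oclass_prime oa pa).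
  by rewrite ![map (fun B => NT (name B)) _](map_comp (@NT _ _) name) names_oclass.
- have [u [ou pu PE nP]] := declared_primeE dP; rewrite nP.
  apply: target_lexical => //; rewrite PE in Pa.
  by have [] := (oclassP [:: a] ou).1 Pa.
- have ow : observed w.
    apply: (@observed_in [::] _ [::]); rewrite ?cats0 // => w0.
    by apply: hL0; rewrite -w0; exact: D_L.
  have [vs [_ _ ea]] := alpha_ofP ow.
  rewrite (alpha_of_names ow ea); apply: target_start ea; first exact: is_rclass_rclass.
  move=> v wv; have := theta_L (l := [::]) (r := [::]) wv.
  by rewrite !cats0; apply; exact: D_L.
Qed.

Lemma target_rule_learned r : target_rule h L r -> learned_rule h sel D r.
Proof.
case=> {r} [P [|A alpha] va|P a pP Pa|X alpha cX XL ea]; first by case: va => -[].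
- have [[pP /prime_seq_cons[pA pa] sz _] _] := va.
  have [dP nP PE] := prime_oclass_name pP; have [dA nA AE] := prime_oclass_name pA.
  (* The spelled tail is an observed word and the tail is the exact factorization of its class: this
     is the class [Q] from which the learner builds the rule. *)
  have eq := valid_tail va (names_cat_mem pa).
  have oq : observed (names_cat alpha).
    apply: (observed_catr (valid_observed va : observed (name A ++ _))).
    by move=> /(names_cat_nil pa) a0; rewrite a0 in sz.
  have [vs [vsE pvs evs]] := alpha_ofP oq.
  have aE := exact_unique (is_rclass_rclass _) eq evs.
  have := learned_production dP dA (is_oclass_oclass h sel oq).
  rewrite /= nP nA (alpha_of_names oq eq); apply.
  have pw : prime_words (name A :: vs).
    move=> v; rewrite inE => /predU1P[->|/pvs//].
    by split; [exact: name_observed|rewrite AE].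
  rewrite vsE; apply/(kept_valid (name_observed pP) _ pw).
  + by rewrite PE.
  + by move: sz; rewrite aE /= size_map.
  + by rewrite /= PE AE -aE.
- have [dP nP PE] := prime_oclass_name pP.
  rewrite -nP; apply: learned_lexical => //.
  apply/oclassP; first exact: name_observed.
  split; first exact: letter_observed pP Pa.
  exact: prime_theta2 pP (mem_name pP) Pa.
- have [inD on] := start_observed cX XL ea; have [pa XE] := ea.
  have := @learned_start _ _ _ h sel D _ inD; rewrite (alpha_of_names (alpha := alpha) on) //.
  by rewrite -(mem_rclass cX) // XE; exact: names_cat_mem.
Qed.

Lemma learned_eq_target : learned_grammar h sel D = target_grammar h L.
Proof.
rewrite /learned_grammar /target_grammar; congr Grammar.
  apply/predeqP => n; split=> -[->|[P dP ->]]; try by left.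
    by have [u [_ pu _ ->]] := declared_primeE dP; right; exists (rclass u).
  by have [dn <- _] := prime_oclass_name dP; right; exists (oclass (name P)).
apply/predeqP => r; split; [exact: learned_rule_target|exact: target_rule_learned].
Qed.

End Listing.
End Theory.

Theorem corollary15p17
  (disp : Order.disp_t) (Sigma : finOrderType disp)
  (M : monoidType) (hM : finite_set [set: M])
  (h : word Sigma -> M)
  (h1 : h [::] = 1%g)
  (hmul : forall u v : word Sigma, h (u ++ v) = (h u * h v)%g) :
  exists p1 p2 : {poly nat},
    (exists (sel : selector) (prog : program),
        admissible h sel /\
        computes_in_time prog (learned_grammar h sel)
          (fun n => (p1.[n])%R)) /\
    (forall L : set (word Sigma), target_class h L ->
      exists (g : listing Sigma) (CS : {fset (word Sigma)}),
        lists (target_grammar h L) g /\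
        (forall w, w \in CS -> L w) /\
        (sample_size CS <= (p2.[listing_size g])%R)%N /\
        (forall (sel : selector) (D : {fset (word Sigma)}),
           admissible h sel ->
           (forall w, w \in CS -> w \in D) ->
           (forall w, w \in D -> L w) ->
           learned_grammar h sel D = target_grammar h L)).
Proof.
have [p1 [sel [prog [adm comp]]]] := learner_ptime hM h1 hmul.
(* The second polynomial is the bound of [size_charset]. *)
exists p1, (#|Sigma|.+1%:P * 'X^2 + 'X)%R; split; first by exists sel, prog.
move=> L [hL0 [hsub [hunit [hptld [hfin hlex]]]]].
have [g g_lists] := listing_exists hmul hsub hunit hptld hM hfin.
exists g, (charset L g); split=> //; split.
  by move=> w; apply: (charset_sub hmul hunit hlex g_lists).
split.
  apply: leq_trans (size_charset hlex g_lists) _.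
  by rewrite hornerD hornerCM hornerXn hornerX leq_add2r expr2 mulnCA.
move=> sel' D adm' CS_D D_L.
apply: (learned_eq_target hmul hsub hunit hptld hL0 hlex g_lists) => //.
(* A sample inside [L] omits the empty word, as admissibility presupposes. *)
by apply: adm'; apply/negP => /D_L.
Qed.
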